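(* Let $N\ge1$, $p\in(1,\infty)$, let $\Omega\subset\mathbb{R}^N$ be a bounded open set, and fix $s\in(0,1)$. Then $t\mapsto\lambda^r_{s,t}$ ($t>1$) is non-decreasing and uniformly continuous in $t$; moreover $$\lim_{t\to+\infty}\lambda^r_{s,t}=\lambda_s,$$ and $$\lim_{t\to+\infty}[u^r_{s,t}-u_s]_{\widetilde W^{s,p}(\Omega)}=0 .$$
   Context: $R$ is the radius of the smallest ball containing $\Omega$, and for $t>1$, $B_{tR}(\Omega)$ is the ball of radius $tR$ with the same center as that smallest ball. Put $$[u]_{\widetilde W^{s,p}(\Omega)}=\left(\int_{\mathbb{R}^N}\int_{\mathbb{R}^N}\frac{|u(x)-u(y)|^p}{|x-y|^{N+sp}}dxdy\right)^{1/p},\quad [u]_{\widetilde W^{s,p}_{tR}(\Omega)}=\left(\int_{B_{tR}(\Omega)}\int_{B_{tR}(\Omega)}\frac{|u(x)-u(y)|^p}{|x-y|^{N+sp}}dxdy\right)^{1/p}.$$ $\widetilde W^{s,p}_0(\Omega)$ and $\widetilde W^{s,p}_{0,tR}(\Omega)$ are the completions of $C_0^\infty(\Omega)$ (functions extended by $0$) with respect to the first and second of these, respectively. Then $$\lambda_s=\min\{[u]^p_{\widetilde W^{s,p}(\Omega)}:u\in\widetilde W^{s,p}_0(\Omega),\|u\|_{L^p(\Omega)}=1,u\ge0\},$$ $$\lambda^r_{s,t}=\min\{[u]^p_{\widetilde W^{s,p}_{tR}(\Omega)}:u\in\widetilde W^{s,p}_{0,tR}(\Omega),\|u\|_{L^p(\Omega)}=1,u\ge0\},$$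 and $u_s$, $u^r_{s,t}$ are the corresponding unique minimizers (nonnegative first eigenfunctions with $L^p(\Omega)$-norm $1$), extended by $0$ to $\mathbb{R}^N$. *)

(* Defs.v *)
From HB Require Import structures.
From mathcomp Require Import all_boot all_order all_algebra.
From mathcomp Require Import all_classical all_reals all_analysis.
From mathcomp Require Import measurable_realfun.
Set Implicit Arguments.
Unset Strict Implicit.
Unset Printing Implicit Defensive.
Import Order.TTheory GRing.Theory Num.Theory.
Import numFieldNormedType.Exports.
Local Open Scope classical_set_scope.
Local Open Scope ring_scope.

(* R^N is 'rV[R]_N.  Its sigma-algebra is the one generated by the coordinate
   projections, as for n.-tuple; this is the Borel sigma-algebra. *)
Definition row_display : measure_display. Proof. exact: (default_measure_display). Qed.

Section measurable_row.
Context (R : realType) (n : nat).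

Definition row_coord (i : 'I_n) (v : 'rV[R]_n) : measurableTypeR R := v ord0 i.

Let row_set0 : g_sigma_preimage row_coord set0.
Proof. exact: sigma_algebra0. Qed.

Let row_setC A :
  g_sigma_preimage row_coord A -> g_sigma_preimage row_coord (~` A).
Proof. exact: sigma_algebraC. Qed.

Let row_bigcup (F : (set 'rV[R]_n)^nat) :
  (forall i, g_sigma_preimage row_coord (F i)) ->
  g_sigma_preimage row_coord (\bigcup_i (F i)).
Proof. exact: sigma_algebra_bigcup. Qed.

HB.instance Definition _ := @isMeasurable.Build row_display
  'rV[R]_n (g_sigma_preimage row_coord) row_set0 row_setC row_bigcup.

End measurable_row.

Lemma measurable_row_coord (R : realType) n (i : 'I_n) :
  measurable_fun [set: 'rV[R]_n] (@row_coord R n i).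
Proof.
move=> _ Y mY; rewrite setTI; apply: sub_sigma_algebra => /=.
rewrite -bigcup_seq/=; exists i => /=; first by rewrite mem_index_enum.
by exists Y => //; rewrite setTI.
Qed.

Lemma measurable_fun_rowP d (T : measurableType d) (R : realType) n
    (f : T -> 'rV[R]_n) :
  (forall i, measurable_fun [set: T] (@row_coord R n i \o f)) ->
  measurable_fun [set: T] f.
Proof.
move=> mf; rewrite /measurable_fun => _.
have H : g_sigma_preimage (@row_coord R n) `<=`
    [set A | measurable (f @^-1` A)].
  apply: smallest_sub => /=.
    split => /=.
    - by rewrite preimage_set0; exact: measurable0.
    - by move=> A /= mA; rewrite setTD preimage_setC; exact: measurableC.
    - by move=> F mF; rewrite /= preimage_bigcup; exact: bigcup_measurable.
  move=> A; rewrite -bigcup_seq => -[i _ [B mB <-]] /=.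
  by rewrite setTI -comp_preimage -[X in measurable X]setTI; exact: mf.
by move=> A /H; rewrite setTI.
Qed.

Section row_cons.
Context (R : realType) (n : nat).

Definition row_cons (x : R) (v : 'rV[R]_n) : 'rV[R]_n.+1 :=
  row_mx (x%:M : 'rV[R]_1) v.

Definition row_behead (v : 'rV[R]_n.+1) : 'rV[R]_n := @rsubmx _ 1 1 n v.

Lemma row_cons0 (x : R) (v : 'rV[R]_n) : (row_cons x v) ord0 ord0 = x.
Proof.
rewrite /row_cons; have -> : ord0 = lshift n (ord0 : 'I_1) by exact/val_inj.
by rewrite (row_mxEl (x%:M : 'rV[R]_1)) !mxE eqxx mulr1n.
Qed.

Lemma row_consK (x : R) (v : 'rV[R]_n) : row_behead (row_cons x v) = v.
Proof. by rewrite /row_behead /row_cons row_mxKr. Qed.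

Lemma row_beheadK (v : 'rV[R]_n.+1) : row_cons (v ord0 ord0) (row_behead v) = v.
Proof.
have vE : (v ord0 ord0)%:M = @lsubmx _ 1 1 n v.
  by apply/rowP => i; rewrite !mxE !ord1 eqxx mulr1n; congr (v _ _); apply/val_inj.
by rewrite /row_cons vE; exact: (@hsubmxK _ 1 1 n v).
Qed.

Lemma measurable_row_cons :
  measurable_fun [set: measurableTypeR R * 'rV[R]_n]
    (fun p => row_cons p.1 p.2).
Proof.
apply: measurable_fun_rowP => i.
have [->|[j ->]] : i = ord0 \/ exists j : 'I_n, i = rshift 1 j.
  case: (unliftP ord0 i) => [j ->|->]; [right|by left].
  by exists j; apply/val_inj.
- apply: eq_measurable_fun measurable_fst => p _ /=.
  by rewrite /row_coord row_cons0.
- apply: (@eq_measurable_fun _ _ _ _ _ (@row_coord R n j \o snd)); last first.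
    by apply: measurableT_comp => //; exact: measurable_row_coord.
  by move=> p _ /=; rewrite /row_coord /row_cons (@row_mxEr _ 1 1 n).
Qed.

Lemma measurable_row_behead :
  measurable_fun [set: 'rV[R]_n.+1] (row_behead).
Proof.
apply: measurable_fun_rowP => i.
apply: eq_measurable_fun (@measurable_row_coord R n.+1 (rshift 1 i)) => v _ /=.
by rewrite /row_coord /row_behead mxE.
Qed.

Variable m : {sigma_finite_measure set 'rV[R]_n -> \bar R}.

Definition lebesgue_cons : set 'rV[R]_n.+1 -> \bar R :=
  pushforward (lebesgue_measure \x m)%E
    (fun p : measurableTypeR R * 'rV[R]_n => row_cons p.1 p.2).

Let lebesgue_cons0 : lebesgue_cons set0 = 0%E.
Proof. by rewrite /lebesgue_cons /pushforward preimage_set0 measure0. Qed.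

Let lebesgue_cons_ge0 A : (0 <= lebesgue_cons A)%E.
Proof. by rewrite /lebesgue_cons /pushforward; exact: measure_ge0. Qed.

Let lebesgue_cons_sigma_additive : semi_sigma_additive lebesgue_cons.
Proof.
move=> F mF tF mUF; rewrite /lebesgue_cons /pushforward preimage_bigcup.
apply: (@measure_semi_sigma_additive _ _ _ (lebesgue_measure \x m)%E).
- by move=> k; rewrite -[X in measurable X]setTI; exact: measurable_row_cons.
- apply/trivIsetP => /= i j _ _ ij; rewrite -preimage_setI.
  by move/trivIsetP : tF => /(_ _ _ _ _ ij) ->//; rewrite preimage_set0.
- rewrite -preimage_bigcup -[X in measurable X]setTI.
  exact: measurable_row_cons.
Qed.

HB.instance Definition _ := isMeasure.Build _ _ _ lebesgue_cons
  lebesgue_cons0 lebesgue_cons_ge0 lebesgue_cons_sigma_additive.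

Let lebesgue_cons_sigma_finite : sigma_finite setT lebesgue_cons.
Proof.
have /sigma_finiteP[G [TG ndG mG]] := sigma_finiteT m.
have /sigma_finiteP[F [TF ndF mF]] := sigma_finiteT (@lebesgue_measure R).
exists (fun k => [set v : 'rV[R]_n.+1 | F k (v ord0 ord0) /\ G k (row_behead v)]).
  apply/esym; rewrite -subTset => v _.
  have [i _ Fi] : (\bigcup_i F i) (v ord0 ord0) by rewrite -TF.
  have [j _ Gj] : (\bigcup_i G i) (row_behead v) by rewrite -TG.
  exists (maxn i j) => //; split.
  - by move: Fi; exact/subsetPset/ndF/leq_maxl.
  - by move: Gj; exact/subsetPset/ndG/leq_maxr.
move=> k; have [mFk Fkoo] := mF k; have [mGk Gkoo] := mG k; split.
  apply: measurableI; rewrite -[X in measurable X]setTI.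
  - exact: measurable_row_coord.
  - exact: measurable_row_behead.
rewrite /lebesgue_cons /pushforward.
rewrite (_ : _ @^-1` _ = F k `*` G k).
  by rewrite product_measure1E// lte_mul_pinfty// ge0_fin_numE.
by apply/seteqP; split => -[x v] /=; rewrite row_cons0 row_consK.
Qed.

HB.instance Definition _ := Measure_isSigmaFinite.Build _ _ _ lebesgue_cons
  lebesgue_cons_sigma_finite.

End row_cons.

(* Lebesgue measure on R^n, slice by slice: the measure of A in R^(n+1) is the
   integral over x of the n-dimensional measure of {v | (x, v) in A}. *)
Fixpoint lebesgue_row (R : realType) (n : nat) : set 'rV[R]_n -> \bar R :=
  match n with
  | 0%N => \d_(0 : 'rV[R]_0)
  | m.+1 => fun A => (\int[lebesgue_measure]_(x in [set: measurableTypeR R])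
      lebesgue_row [set v | A (row_cons x v)])%E
  end.

Lemma lebesgue_row_sigma_finite_measure (R : realType) n :
  exists m : {sigma_finite_measure set 'rV[R]_n -> \bar R},
    @lebesgue_row R n = m.
Proof.
elim: n => [|n [m IH]]; first by exists (\d_(0 : 'rV[R]_0)).
exists (lebesgue_cons m); apply/funext => A.
rewrite /lebesgue_cons /pushforward /product_measure1 /= IH.
by apply: eq_integral => x _ /=; rewrite xsectionE.
Qed.

Section lebesgue_row.
Context (R : realType) (n : nat).

Let lebesgue_row0 : @lebesgue_row R n set0 = 0%E.
Proof. by have [m ->] := lebesgue_row_sigma_finite_measure R n. Qed.

Let lebesgue_row_ge0 A : (0 <= @lebesgue_row R n A)%E.
Proof. by have [m ->] := lebesgue_row_sigma_finite_measure R n. Qed.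

Let lebesgue_row_sigma_additive : semi_sigma_additive (@lebesgue_row R n).
Proof.
have [m ->] := lebesgue_row_sigma_finite_measure R n.
exact: measure_semi_sigma_additive.
Qed.

HB.instance Definition _ := isMeasure.Build _ _ _ (@lebesgue_row R n)
  lebesgue_row0 lebesgue_row_ge0 lebesgue_row_sigma_additive.

Let lebesgue_row_sigma_finite : sigma_finite setT (@lebesgue_row R n).
Proof.
have [m ->] := lebesgue_row_sigma_finite_measure R n.
exact: sigma_finiteT.
Qed.

HB.instance Definition _ := Measure_isSigmaFinite.Build _ _ _
  (@lebesgue_row R n) lebesgue_row_sigma_finite.

End lebesgue_row.

Lemma lebesgue_row_box (R : realType) n (A : 'I_n -> set (measurableTypeR R)) :
  (forall i, measurable (A i)) ->
  lebesgue_row [set v : 'rV[R]_n | forall i, A i (v ord0 i)] =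
  (\prod_(i < n) lebesgue_measure (A i))%E.
Proof.
elim: n A => [|n IH] A mA /=.
  by rewrite big_ord0 /dirac indicE mem_set// => -[].
rewrite big_ord_recl /= -IH; last by move=> i; exact: mA.
set c := lebesgue_row _.
transitivity (\int[lebesgue_measure]_(x in [set: measurableTypeR R])
    ((\1_(A ord0) x)%:E * c))%E; last first.
  rewrite ge0_integralZr//; last exact: measure_ge0.
    by rewrite integral_indic// setIT.
  exact/measurable_EFinP/measurable_indic.
apply: eq_integral => x _; rewrite indicE.
have [/set_mem Ax|/negP nAx] := boolP (x \in A ord0).
  rewrite mul1e; congr lebesgue_row; apply/seteqP; split => v /= H i.
    have := H (lift ord0 i).
    by rewrite /row_cons (_ : lift ord0 i = rshift 1 i) ?(@row_mxEr _ 1 1 n)//;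
      exact/val_inj.
  have [->|[j ->]] : i = ord0 \/ exists j, i = lift ord0 j.
    by case: (unliftP ord0 i) => [j ->|->]; [right; exists j|left].
    by rewrite row_cons0.
  have := H j; rewrite /row_cons [in X in _ -> X](_ : _ ord0 (lift ord0 j) = v ord0 j)//.
  by rewrite (_ : lift ord0 j = rshift 1 j) ?(@row_mxEr _ 1 1 n)//; exact/val_inj.
rewrite mul0e (_ : [set v | _] = set0) ?measure0//.
apply/seteqP; split => // v /= /(_ ord0); rewrite row_cons0 => Ax.
by apply: nAx; exact/mem_set.
Qed.

(* The norm of 'rV[R]_n in the library is the sup norm; balls and |x - y| below
   use the Euclidean one. *)
Definition enorm (R : realType) (n : nat) (x : 'rV[R]_n) : R :=
  Num.sqrt (\sum_(i < n) x ord0 i ^+ 2).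

Definition eball (R : realType) (n : nat) (c : 'rV[R]_n) (r : R) :
  set 'rV[R]_n := [set x | enorm (x - c) < r].

Definition smallest_ball (R : realType) (n : nat) (Omega : set 'rV[R]_n)
    (c : 'rV[R]_n) (r : R) : Prop :=
  (Omega `<=` [set x | enorm (x - c) <= r]) /\
  (forall (c' : 'rV[R]_n) (r' : R),
     Omega `<=` [set x | enorm (x - c') <= r'] -> r <= r').

Fixpoint Cn (R : realType) (n k : nat) (f : 'rV[R]_n -> R) : Prop :=
  match k with
  | 0%N => continuous f
  | j.+1 => continuous f /\
      forall i : 'I_n, (forall x, derivable f x (delta_mx ord0 i)) /\
        Cn j (fun x => 'D_(delta_mx ord0 i) f x)
  end.

Definition smooth (R : realType) (n : nat) (f : 'rV[R]_n -> R) : Prop :=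
  forall k, Cn k f.

Definition test_function (R : realType) (n : nat) (Omega : set 'rV[R]_n)
    (phi : 'rV[R]_n -> R) : Prop :=
  [/\ smooth phi,
      compact (closure [set x | phi x != 0]) &
      closure [set x | phi x != 0] `<=` Omega].

(* [u] = (int_D int_D |u(x) - u(y)|^p / |x - y|^(n + s p) dx dy)^(1/p).
   The integrand is 0 for x = y, since 0 / 0 = 0 in R. *)
Definition gagliardo (R : realType) (n : nat) (s p : R) (D : set 'rV[R]_n)
    (u : 'rV[R]_n -> R) : \bar R :=
  ((\int[@lebesgue_row R n]_(y in D) \int[@lebesgue_row R n]_(x in D)
      (`|u x - u y| `^ p / enorm (x - y) `^ (n%:R + s * p))%:E) `^ p^-1)%E.

(* Functional realization of the completion of C_0^oo(Omega) with respect to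
   the seminorm above: measurable functions vanishing outside Omega that are
   limits of test functions.  When D contains Omega and D `\` Omega is not
   negligible, a fractional Poincare inequality bounds the L^p(Omega)-norm by the
   seminorm on such functions, so that this space is complete and the
   seminorm is a norm up to equality almost everywhere. *)
Definition sobolev0 (R : realType) (n : nat) (s p : R)
    (Omega D : set 'rV[R]_n) : set ('rV[R]_n -> R) :=
  [set u : 'rV[R]_n -> R | [/\ measurable_fun [set: 'rV[R]_n] u,
     forall x, ~ Omega x -> u x = 0 &
     exists phi : nat -> 'rV[R]_n -> R,
       (forall k, test_function Omega (phi k)) /\
       gagliardo s p D (fun x => u x - phi k x) @[k --> \oo] --> 0%E]].

Definition admissible (R : realType) (n : nat) (s p : R)
    (Omega D : set 'rV[R]_n) : set ('rV[R]_n -> R) :=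
  [set u : 'rV[R]_n -> R | [/\ sobolev0 s p Omega D u,
     Lnorm (@lebesgue_row R n) p%:E ((EFin \o u) \_ Omega) = 1%E &
     {ae @lebesgue_row R n, forall x, 0 <= u x}]].

(* The minimum of the energy is written as its infimum; the two agree as soon as
   a first eigenfunction exists. *)
Definition first_eigenvalue (R : realType) (n : nat) (s p : R)
    (Omega D : set 'rV[R]_n) : R :=
  fine (ereal_inf
    [set (gagliardo s p D u `^ p)%E | u in admissible s p Omega D]).

Definition first_eigenfunction (R : realType) (n : nat) (s p : R)
    (Omega D : set 'rV[R]_n) (u : 'rV[R]_n -> R) : Prop :=
  admissible s p Omega D u /\
  forall v, admissible s p Omega D v ->
    (gagliardo s p D u `^ p <= gagliardo s p D v `^ p)%E.

(* Main.v *)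
Require Import Defs.
From HB Require Import structures.
From mathcomp Require Import all_boot all_order all_algebra.
From mathcomp Require Import all_classical all_reals all_analysis.
From mathcomp Require Import measurable_realfun.
From mathcomp Require Import ring lra.
Import Order.TTheory GRing.Theory Num.Theory.
Import numFieldNormedType.Exports.
Local Open Scope classical_set_scope.
Local Open Scope ring_scope.

(** Write E_D(u) for the double integral over D x D of
    |u(x) - u(y)|^p / |x - y|^(N + s p), so that the seminorm of u to the power
    p is E_D(u), and let B_t be the ball of radius t R.

    Eigenvalues.  A function u that vanishes outside Omega only sees the kernel
    between Omega and the rest, hence
      E_D(u) <= E_D'(u) <= E_D(u) + 2 tau int |u|^p       (Omega in D in D')
    where tau bounds the integral of the kernel over D' minus D from a point of
    Omega ([energy_tail]).  Since B_t minus Omega contains a ball, a Poincare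
    inequality int |u|^p <= K E_{B_t}(u) holds ([poincare_ball]), so all the
    spaces, for all t > 1 and for the whole space, coincide
    ([sobolev0_eball]) and the eigenvalues are infima over one and the same
    class of functions.  Therefore lambda_t is nondecreasing, and
    lambda_s - lambda_t <= C ((t - 1) R)^(- s p) tends to 0.  For t close to t',
    tau is small because spheres are null sets ([eigenvalue_loc]); a bounded
    monotone continuous function is uniformly continuous
    ([monotone_bounded_unif]).

    Eigenfunctions.  Let u be the eigenfunction of the whole space, v_n those of
    B_{t_n} with t_n -> oo, and E the energy of the whole space.  The tail
    estimate gives E(v_n) <= E(u) + tau_n with tau_n -> 0, and strong
    convergence follows from strict convexity.  The energy is submodular:
      E(v_n) + E(u) = E(max(v_n, u)) + E(min(v_n, u)) + X_n
    where X_n is the integral of a nonnegative excess that is positive at (x, y)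
    when v_n > u at one of the points and v_n < u at the other
    ([energy_max_min], [deficit_gap]).  Maximum and minimum lie in the same
    space ([sobolev0_max], [sobolev0_min]), so the Rayleigh quotient of each is
    at least E(u); as the p-th powers of their L^p norms add up to 2, X_n <= tau_n
    ([excess_le]).  Along a subsequence the excess tends to 0 almost
    everywhere, so the sets where v_n^p > u^p + eta and where v_n^p < u^p - eta
    have measures whose product tends to 0: one of the two is small
    ([above_prod_cvg0]).  Bounded energy makes the v_n^p equi-integrable
    ([equi_integrable]), and v_n^p and u^p have the same integral, so their
    positive and negative differences have equal integrals: as one of these is
    small, both are ([powR_dist_cvg0]).  Thus v_n -> u almost everywhere along a
    further subsequence, and since E(v_n) -> E(u), dominated convergence with a
    varying bound ([pratt], [energy_dominated]) gives E(v_n - u) -> 0. *)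

(** * Balls and Borel sets of the coordinate space *)

Lemma lt_mx_norm (R : realType) (n : nat) (x : 'rV[R]_n) (e : R) : 0 < e ->
  (`|x| < e) <-> (forall i, `|x ord0 i| < e).
Proof.
move=> e0; rewrite /Num.Def.normr /= mx_normrE; split.
  by move=> /bigmax_ltP[_ +] i => /(_ (ord0, i)); exact.
by move=> xe; apply/bigmax_ltP; split=> // -[i j] _ /=; rewrite ord1; exact: xe.
Qed.

Lemma measurable_box (R : realType) (n : nat)
    (A : 'I_n -> set (measurableTypeR R)) : (forall i, measurable (A i)) ->
  measurable [set v : 'rV[R]_n | forall i, A i (v ord0 i)].
Proof.
move=> mA.
have -> : [set v : 'rV[R]_n | forall i, A i (v ord0 i)] =
    \big[setI/setT]_(i < n) (@row_coord R n i @^-1` A i).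
  rewrite -bigcap_seq; apply/seteqP; split => v /= H i; first by move=> _; exact: H.
  by apply: (H i); rewrite /= mem_index_enum.
apply: bigsetI_measurable => i _; rewrite -[X in measurable X]setTI.
exact: measurable_row_coord.
Qed.

(** The sigma-algebra is generated by the coordinates, while open sets come
    from the norm: an open set is a countable union of boxes with rational
    centre and size. *)
Lemma measurable_open_row (R : realType) (n : nat) (U : set 'rV[R]_n) :
  open U -> measurable U.
Proof.
move=> oU.
pose box (qr : 'rV[rat]_n * rat) := [set v : 'rV[R]_n |
  forall i, ball (ratr (qr.1 ord0 i) : R) (ratr qr.2) (v ord0 i)].
have mbox qr : measurable (box qr).
  apply: (@measurable_box R n (fun i => ball (ratr (qr.1 ord0 i) : R) (ratr qr.2))).
  by move=> i; exact: measurable_ball.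
have -> : U = \bigcup_qr (if asbool (box qr `<=` U) then box qr else set0).
  apply/seteqP; split => [x Ux|x [qr _]]; last by case: asboolP => // /[apply].
  move: (oU); rewrite openE => /(_ _ Ux) /nbhs_ballP[e /= e0 eU].
  have e20 : 0 < e / 2 by rewrite divr_gt0.
  have [r re] := rat_in_itvoo e20.
  move: re; rewrite in_itv /= => /andP[r0 re].
  have /choice[q qx] : forall i, exists q : rat, `|x ord0 i - ratr q| < ratr r.
    move=> i; have : x ord0 i - ratr r < x ord0 i by rewrite ltrBlDr ltrDl.
    move=> /rat_in_itvoo[q]; rewrite in_itv /= => /andP[q1 q2].
    by exists q; rewrite ger0_norm; lra.
  exists (\row_i q i, r) => //.
  case: asboolP => [_|]; first by move=> i /=; rewrite mxE /ball/= distrC.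
  apply: contra_notP => _ v /= vb; apply: eU; rewrite mx_norm_ball /ball_ /=.
  apply/lt_mx_norm => // i; rewrite !mxE; have := vb i; rewrite mxE /ball /=.
  move=> vq; have := qx i.
  have := ler_normD (x ord0 i - ratr (q i)) (ratr (q i) - v ord0 i).
  by rewrite subrKA; lra.
apply: countable_bigcupT_measurable; first exact: countableP.
by move=> qr; case: asboolP.
Qed.

Lemma measurable_continuous_row (R : realType) (n : nat) (f : 'rV[R]_n -> R) :
  continuous f -> measurable_fun setT f.
Proof.
move=> cf; apply: (measurability _ (@RGenOpens.measurableE R)) => //.
move=> _ [_ [a [b ->] <-]]; rewrite setTI; apply: measurable_open_row.
by apply: open_comp; [move=> x _; exact: cf|exact: interval_open].
Qed.

Lemma measurable_enorm (R : realType) (n : nat) :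
  measurable_fun setT (@enorm R n).
Proof.
apply: (@measurableT_comp _ _ _ _ _ _ (@Num.sqrt R) _
  (fun x : 'rV[R]_n => \sum_(i < n) x ord0 i ^+ 2)).
  by apply: continuous_measurable_fun; exact: sqrt_continuous.
apply: measurable_sum => i; apply: measurable_funX.
exact: measurable_row_coord.
Qed.

Lemma measurable_rowB (R : realType) (n : nat) :
  measurable_fun setT (fun z : 'rV[R]_n * 'rV[R]_n => z.1 - z.2).
Proof.
apply: measurable_fun_rowP => i.
rewrite (_ : _ \o _ = (@row_coord R n i \o fst) \- (@row_coord R n i \o snd)).
  apply: measurable_funB; apply: measurableT_comp => //;
  exact: measurable_row_coord.
by apply/funext => z /=; rewrite /row_coord !mxE.
Qed.

Section euclid.
Context {R : realType} {n : nat}.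
Implicit Types x y : 'rV[R]_n.

Lemma enorm_ge0 x : 0 <= enorm x. Proof. exact: sqrtr_ge0. Qed.

Lemma enorm_sqr x : enorm x ^+ 2 = \sum_(i < n) x ord0 i ^+ 2.
Proof. by rewrite sqr_sqrtr// sumr_ge0// => i _; exact: sqr_ge0. Qed.

Lemma enormN x : enorm (- x) = enorm x.
Proof. by congr Num.sqrt; apply: eq_bigr => i _; rewrite mxE sqrrN. Qed.

Lemma enormC x y : enorm (x - y) = enorm (y - x).
Proof. by rewrite -enormN opprB. Qed.

Lemma le_coord_enorm x i : `|x ord0 i| <= enorm x.
Proof.
rewrite -sqrtr_sqr ler_sqrt; last by apply: sumr_ge0 => j _; exact: sqr_ge0.
rewrite (bigD1 i)//= lerDl; apply: sumr_ge0 => j _; exact: sqr_ge0.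
Qed.

Lemma enorm_le_sum x : enorm x <= \sum_(i < n) `|x ord0 i|.
Proof.
have S0 (P : pred 'I_n): 0 <= \sum_(i < n | P i) `|x ord0 i| by exact: sumr_ge0.
rewrite -(@ler_pXn2r _ 2)// ?nnegrE ?enorm_ge0// enorm_sqr.
rewrite [leRHS]expr2 mulr_suml; apply: ler_sum => i _.
rewrite -real_normK ?num_real// expr2 ler_wpM2l//.
by rewrite (bigD1 i)//= lerDl.
Qed.

Lemma enorm_eq0 x : (enorm x == 0) = (x == 0).
Proof.
apply/eqP/eqP => [x0|->]; last first.
  by rewrite /enorm big1 ?sqrtr0// => i _; rewrite mxE expr0n.
apply/rowP => i; rewrite mxE; apply/eqP; rewrite -normr_eq0 eq_le normr_ge0 andbT.
by rewrite -x0 le_coord_enorm.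
Qed.

Lemma enormD x y : enorm (x + y) <= enorm x + enorm y.
Proof.
pose A := enorm x; pose B := enorm y.
pose C := \sum_(i < n) x ord0 i * y ord0 i.
have A0 : 0 <= A := enorm_ge0 x; have B0 : 0 <= B := enorm_ge0 y.
have sE a b : \sum_(i < n) (a * x ord0 i + b * y ord0 i) ^+ 2 =
    a ^+ 2 * A ^+ 2 + a * b * C *+ 2 + b ^+ 2 * B ^+ 2.
  rewrite !enorm_sqr /C !mulr_sumr -sumrMnl -!big_split/=.
  by apply: eq_bigr => i _; ring.
(* Cauchy-Schwarz, by expansion of the sum of (B x_i - A y_i)^2. *)
have CAB : C <= A * B.
  have [AB0|AB0] := eqVneq (A * B) 0.
    have /orP[] : (A == 0) || (B == 0) by rewrite -mulf_eq0 AB0.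
      rewrite enorm_eq0 => /eqP x0; rewrite AB0 /C x0 big1// => i _.
      by rewrite mxE mul0r.
    rewrite enorm_eq0 => /eqP y0; rewrite AB0 /C y0 big1// => i _.
    by rewrite mxE mulr0.
  have ABgt0 : 0 < A * B by rewrite lt_neqAle eq_sym AB0 mulr_ge0.
  have : 0 <= \sum_(i < n) (B * x ord0 i + (- A) * y ord0 i) ^+ 2.
    by apply: sumr_ge0 => i _; exact: sqr_ge0.
  rewrite sE => H; rewrite -(ler_pM2l ABgt0); nra.
rewrite -(@ler_pXn2r _ 2)// ?nnegrE ?enorm_ge0 ?addr_ge0// enorm_sqr.
have -> : \sum_(i < n) (x + y) ord0 i ^+ 2 = A ^+ 2 + C *+ 2 + B ^+ 2.
  have := sE 1 1; rewrite !expr1n !mul1r => <-.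
  by apply: eq_bigr => i _; rewrite !mul1r mxE.
rewrite -/A -/B; nra.
Qed.

Lemma enormB_triangle x y z : enorm (x - z) <= enorm (x - y) + enorm (y - z).
Proof. by rewrite -{1}(subrKA y) enormD. Qed.

Lemma measurable_eball (c : 'rV[R]_n) r : measurable (eball c r).
Proof.
have mf : measurable_fun setT (fun x : 'rV[R]_n => enorm (x - c)).
  apply: (@measurableT_comp _ _ _ _ _ _ (@enorm R n) _ (fun x => x - c)).
    exact: measurable_enorm.
  have mp : measurable_fun setT (fun x : 'rV[R]_n => (x, c)).
    exact: measurable_fun_pair.
  exact: (measurableT_comp (@measurable_rowB R n) mp).
rewrite (_ : eball c r = setT `&` (fun x => enorm (x - c)) @^-1` `]-oo, r[).
  by apply: mf => //; exact: measurable_itv.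
by rewrite setTI; apply/seteqP; split => x; rewrite /eball /= in_itv.
Qed.

(** The ball lies in the cube of side 2 r. *)
Lemma lebesgue_row_eball_le (c : 'rV[R]_n) r : 0 <= r ->
  (@lebesgue_row R n (eball c r) <= ((2 * r) ^+ n)%:E)%E.
Proof.
move=> r0.
have mB i : measurable (ball (c ord0 i : R) r : set (measurableTypeR R)).
  exact: measurable_ball.
have -> : ((2 * r) ^+ n)%:E = lebesgue_row [set v : 'rV[R]_n |
    forall i, ball (c ord0 i : R) r (v ord0 i)].
  rewrite (@lebesgue_row_box _ _ (fun i => ball (c ord0 i : R) r))//.
  rewrite (eq_bigr (fun=> (2 * r)%:E)); last first.
    by move=> i _; rewrite lebesgue_measure_ball// mulr2n mulrDl !mul1r.
  by rewrite prodEFin prodr_const card_ord.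
apply: le_measure; rewrite ?inE.
- exact: measurable_eball.
- exact: (@measurable_box R n (fun i => ball (c ord0 i : R) _)).
- move=> v; rewrite /eball /= => vr i; rewrite /ball /= distrC.
  apply: le_lt_trans vr; have := le_coord_enorm (v - c) i.
  by rewrite !mxE.
Qed.

(** The ball contains the cube of half-side r / n, by the comparison of the
    Euclidean norm with the l^1 norm. *)
Lemma lebesgue_row_eball_ge (c : 'rV[R]_n) r : (0 < n)%N -> 0 < r ->
  (((2 * (r / n%:R)) ^+ n)%:E <= @lebesgue_row R n (eball c r))%E.
Proof.
move=> n0 r0; have rn : 0 < r / n%:R by rewrite divr_gt0// ltr0n.
have mB i : measurable (ball (c ord0 i : R) (r / n%:R) : set (measurableTypeR R)).
  exact: measurable_ball.
have -> : ((2 * (r / n%:R)) ^+ n)%:E = lebesgue_row [set v : 'rV[R]_n |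
    forall i, ball (c ord0 i : R) (r / n%:R) (v ord0 i)].
  rewrite (@lebesgue_row_box _ _ (fun i => ball (c ord0 i : R) (r / n%:R)))//.
  rewrite (eq_bigr (fun=> (2 * (r / n%:R))%:E)); last first.
    by move=> i _; rewrite lebesgue_measure_ball// ?ltW// mulr2n mulrDl !mul1r.
  by rewrite prodEFin prodr_const card_ord.
apply: le_measure; rewrite ?inE.
- exact: (@measurable_box R n (fun i => ball (c ord0 i : R) _)).
- exact: measurable_eball.
- move=> v vr; rewrite /eball /=.
  apply: le_lt_trans (enorm_le_sum _) _.
  have -> : r = \sum_(i < n) r / n%:R.
    by rewrite sumr_const card_ord -[RHS]mulr_natr divfK// pnatr_eq0 -lt0n.
  apply: ltr_sum => [|i _]; first by apply/hasP; exists (Ordinal n0); rewrite ?mem_index_enum.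
  by have := vr i; rewrite /ball /= distrC !mxE.
Qed.

End euclid.

Lemma sqr_level_set0 (R : realType) (c r : R) :
  lebesgue_measure [set x : measurableTypeR R | (x - c) ^+ 2 = r] = 0%E.
Proof.
apply: countable_lebesgue_measure0.
apply: (@sub_countable _ _ _ [set c + Num.sqrt r; c - Num.sqrt r]).
  apply: subset_card_le => x /= <-; rewrite sqrtr_sqr.
  by case: (ltrP (x - c) 0) => xc; [right|left];
    rewrite ?(ltr0_norm xc) ?(ger0_norm xc); ring.
by apply: finite_set_countable; exact: finite_set2.
Qed.

(** Slicing along the first coordinate: each slice is again a level set of a
    sum of squares, one dimension lower.  The level r is an arbitrary real
    number, because the levels of the slices may be negative. *)
Lemma lebesgue_row_sphere0 (R : realType) (n : nat) (c : 'rV[R]_n.+1) (r : R) :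
  lebesgue_row [set v : 'rV[R]_n.+1 |
    \sum_(i < n.+1) (v ord0 i - c ord0 i) ^+ 2 = r] = 0%E.
Proof.
elim: n c r => [|n IH] c r.
  pose S := [set x : measurableTypeR R | (x - c ord0 ord0) ^+ 2 = r].
  rewrite -[RHS](sqr_level_set0 R (c ord0 ord0) r) -/S -[S]setIT -integral_indic//.
    apply: eq_integral => x _; rewrite /= /dirac !indicE; congr ((_ : bool)%:R%:E).
    by apply/idP/idP; rewrite !inE /S /= big_ord1 row_cons0.
  have mf : measurable_fun setT (fun x : measurableTypeR R => (x - c ord0 ord0) ^+ 2).
    by apply: measurable_funX; exact: measurable_funB.
  rewrite /S -[X in measurable X]setTI; exact: (mf measurableT [set r]).
apply: integral0_eq => x _.
rewrite -[RHS](IH (row_behead c) (r - (x - c ord0 ord0) ^+ 2)).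
have rs (v : 'rV[R]_n.+1) i : row_cons x v ord0 (lift ord0 i) = v ord0 i.
  by rewrite (_ : lift ord0 i = rshift 1 i) ?(@row_mxEr _ 1 1 n.+1)//; exact/val_inj.
have rc i : c ord0 (lift ord0 i) = row_behead c ord0 i.
  by rewrite /row_behead mxE; congr (c _ _); exact/val_inj.
transitivity (lebesgue_row [set v : 'rV[R]_n.+1 |
    \sum_(i < n.+2) (row_cons x v ord0 i - c ord0 i) ^+ 2 = r]); first by [].
congr lebesgue_row; apply/seteqP; split => v /=.
  rewrite big_ord_recl row_cons0 => <-.
  rewrite [RHS]addrC addKr.
  by apply: eq_bigr => i _; rewrite rs rc.
move=> H; rewrite big_ord_recl row_cons0.
under eq_bigr do rewrite rs rc.
by rewrite H addrC subrK.
Qed.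

Lemma lebesgue_row_esphere0 (R : realType) (n : nat) (c : 'rV[R]_n) (r : R) :
  (0 < n)%N -> 0 <= r ->
  lebesgue_row [set v : 'rV[R]_n | enorm (v - c) = r] = 0%E.
Proof.
case: n c => // n c _ r0.
rewrite -[RHS](lebesgue_row_sphere0 R n c (r ^+ 2)); congr lebesgue_row.
have sE (v : 'rV[R]_n.+1) : \sum_(i < n.+1) (v ord0 i - c ord0 i) ^+ 2 = enorm (v - c) ^+ 2.
  by rewrite enorm_sqr; apply: eq_bigr => i _; rewrite !mxE.
apply/seteqP; split => v /=; rewrite sE; first by move->.
by move/eqP; rewrite eqrXn2 ?enorm_ge0// => /eqP.
Qed.

(** * Limits of nonnegative integrals *)

Section limits.
Local Open Scope ereal_scope.

Lemma cvge0P {T : Type} {R : realType} (F : set_system T) {FF : Filter F}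
    (u : T -> \bar R) : (forall x, 0 <= u x) ->
  (u x @[x --> F] --> 0) <->
  (forall e : R, (0 < e)%R -> \forall x \near F, u x <= e%:E).
Proof.
move=> u0; split => [/fine_cvgP[ufin /cvgrPdist_le uF] e e0|H].
  have := uF _ e0; apply: filterS2 ufin => x xfin /=.
  by rewrite sub0r normrN ger0_norm ?fine_ge0// -lee_fin fineK.
have fin (x : T) (e : R) : u x <= e%:E -> u x \is a fin_num.
  by rewrite ge0_fin_numE// => /le_lt_trans; apply; exact: ltry.
apply/fine_cvgP; split; first by have := H _ ltr01; apply: filterS => x /fin.
apply/cvgrPdist_le => e e0.
have := H _ e0; apply: filterS => x ue /=.
by rewrite sub0r normrN ger0_norm ?fine_ge0// -lee_fin fineK// (fin _ _ ue).
Qed.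

Lemma cvge0_leZ {T : Type} {R : realType} (F : set_system T) {FF : Filter F}
    (K : R) (u v : T -> \bar R) :
  (forall x, 0 <= u x) -> (forall x, 0 <= v x) ->
  (forall x, u x <= K%:E * v x) ->
  v x @[x --> F] --> 0 -> u x @[x --> F] --> 0.
Proof.
move=> u0 v0 uv /cvge0P -/(_ v0) H; apply/cvge0P => // e e0.
have K0 : (0 < `|K| + 1)%R by rewrite ltr_wpDl.
have := H _ (divr_gt0 e0 K0); apply: filterS => x vx.
apply: (le_trans (uv x)); apply: (@le_trans _ _ ((`|K| + 1)%:E * v x)).
  by rewrite lee_wpmul2r// lee_fin; have := ler_norm K; lra.
by rewrite -lee_pdivlMl// -EFinM mulrC.
Qed.

Lemma geometric_eseries {R : realType} (c q : R) : (0 <= q < 1)%R ->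
  \sum_(k <oo) (c * q ^+ k)%:E = (c / (1 - q))%:E.
Proof.
move=> /andP[q0 q1].
have nq : (`|q| < 1)%R by rewrite ger0_norm.
have cq := @cvg_geometric_series R c q nq.
apply/cvg_lim => //.
rewrite (_ : (fun n => _) = EFin \o series (geometric c q)); last first.
  by apply/funext => n /=; rewrite sumEFin.
by apply/cvg_EFin => //; exact: nearW.
Qed.

Section tools.
Context d (T : measurableType d) (R : realType) (mu : {measure set T -> \bar R}).

(** If the integrals along the subsequence are at most 2^-n, the series of the
    functions has a finite integral; it converges almost everywhere and its
    terms tend to 0. *)
Lemma cvg_integral0_subseq_ae (f : nat -> T -> \bar R) :
  (forall n, measurable_fun setT (f n)) -> (forall n x, 0 <= f n x) ->
  \int[mu]_x f n x @[n --> \oo] --> 0 ->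
  exists2 sigma : nat -> nat, (forall n, (n <= sigma n)%N) &
    {ae mu, forall x, f (sigma n) x @[n --> \oo] --> 0}.
Proof.
move=> mf f0 /cvge0P; rewrite /=.
have if0 n : 0 <= \int[mu]_x f n x by exact: integral_ge0.
move=> /(_ if0) H.
have /choice[sigma sigmaP] : forall n, exists k, (n <= k)%N /\
    \int[mu]_x f k x <= (1 * 2^-1 ^+ n)%:E.
  move=> n; have e0 : (0 < (1 * 2^-1 ^+ n) :> R)%R by rewrite mul1r exprn_gt0.
  have [k _ Hk] := H _ e0; exists (maxn n k); split; first exact: leq_maxl.
  by apply: Hk => /=; exact: leq_maxr.
exists sigma; first by move=> n; have [] := sigmaP n.
have mg : measurable_fun setT (fun x => \sum_(n <oo) f (sigma n) x).
  by apply: ge0_emeasurable_sum.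
have ig : mu.-integrable setT (fun x => \sum_(n <oo) f (sigma n) x).
  apply/integrableP; split => //.
  under eq_integral do rewrite gee0_abs ?nneseries_ge0//.
  rewrite integral_nneseries//.
  apply: (@le_lt_trans _ _ (\sum_(n <oo) (1 * 2^-1 ^+ n)%:E)).
    by apply: lee_nneseries => n _ //; have [] := sigmaP n.
  by rewrite geometric_eseries ?ltry//; lra.
have := integrable_ae measurableT ig.
apply: filterS => x /(_ Logic.I) fx.
have : \sum_(n <oo) f (sigma n) x < +oo by rewrite -ge0_fin_numE// nneseries_ge0.
move=> /nneseries_tail_cvg => /(_ (fun _ _ => f0 _ x)) tx.
apply/cvge0P => // e e0.
have /cvge0P : forall N, 0 <= \big[+%E/0]_(N <= k <oo) f (sigma k) x.
  by move=> N; exact: nneseries_ge0.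
move=> /(_ \oo _)/iffLR/(_ tx _ e0); apply: filterS => n; apply: le_trans.
apply: le_trans (nneseries_lim_ge n.+1 (fun _ _ _ => f0 _ x)).
by rewrite big_nat1.
Qed.

(** Dominated convergence with a dominating function that varies: this is
    Fatou's lemma for the nonnegative functions g n - f n. *)
Lemma pratt (f g : nat -> T -> R) (g' : T -> R) :
  (forall n, measurable_fun setT (f n)) ->
  (forall n, measurable_fun setT (g n)) -> measurable_fun setT g' ->
  (forall n x, (0 <= f n x <= g n x)%R) -> (forall x, (0 <= g' x)%R) ->
  {ae mu, forall x, f n x @[n --> \oo] --> (0 : R)%R} ->
  {ae mu, forall x, g n x @[n --> \oo] --> g' x} ->
  \int[mu]_x (g n x)%:E @[n --> \oo] --> \int[mu]_x (g' x)%:E ->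
  \int[mu]_x (g' x)%:E < +oo ->
  \int[mu]_x (f n x)%:E @[n --> \oo] --> 0.
Proof.
move=> mf mg mg' fg g'0 f_0 g_g' ig ig'.
have f0 n x : 0 <= (f n x)%:E by rewrite lee_fin; have /andP[] := fg n x.
have h0 n x : 0 <= (g n x - f n x)%:E.
  by rewrite lee_fin subr_ge0; have /andP[] := fg n x.
have mh n : measurable_fun setT (fun x => (g n x - f n x)%:E).
  by apply/measurable_EFinP; exact: measurable_funB.
have mf' n : measurable_fun setT (fun x => (f n x)%:E) by exact/measurable_EFinP.
have := @fatou _ _ _ mu setT measurableT (fun n x => (g n x - f n x)%:E) mh
  (fun n x _ => h0 n x).
have -> : \int[mu]_x limn_einf (fun n => (g n x - f n x)%:E) = \int[mu]_x (g' x)%:E.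
  apply: ae_eq_integral => //.
  - rewrite (_ : (fun x => _) =
        -%E \o (fun x => limn_esup (fun n => - (g n x - f n x)%:E)))//.
    apply: measurableT_comp => //; apply: measurable_fun_limn_esup => n.
    exact: measurableT_comp.
  - exact/measurable_EFinP.
  apply: filterS2 f_0 g_g' => x fx gx _.
  have := @cvg_limn_einf_sup R (fun n => (g n x - f n x)%:E) (g' x)%:E.
  move=> /(_ _)[|-> //].
  apply/cvg_EFin; first exact: nearW.
  by rewrite -[X in _ --> X]subr0; exact: cvgB.
set L := \int[mu]_x (g' x)%:E in ig ig' *.
have L0 : 0 <= L by apply: integral_ge0 => x _; rewrite lee_fin.
have Lfin : L \is a fin_num by rewrite ge0_fin_numE.
rewrite limn_einf_lim => HL.
apply/cvge0P => [n|e e0]; first exact: integral_ge0.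
have e20 : (0 < e / 2)%R by rewrite divr_gt0.
have ghf n : \int[mu]_x (g n x)%:E =
    \int[mu]_x (g n x - f n x)%:E + \int[mu]_x (f n x)%:E.
  rewrite -ge0_integralD//; apply: eq_integral => x _.
  by rewrite -EFinD subrK.
have Le : (fine L - e / 2)%:E < limn (einfs (fun n => \int[mu]_x (g n x - f n x)%:E)).
  apply: lt_le_trans HL.
  by rewrite -[ltRHS]fineK// lte_fin ltrBlDr ltrDl.
have N1 := @lte_lim R _ _ (nondecreasing_einfs _) (@is_cvg_einfs _ _) Le.
have [gfin /cvgrPdist_le/(_ _ e20) N2] : (\forall n \near \oo,
    \int[mu]_x (g n x)%:E \is a fin_num) /\
    fine (\int[mu]_x (g n x)%:E) @[n --> \oo] --> fine L.
  by apply/fine_cvgP; rewrite fineK.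
near=> n.
have gn : \int[mu]_x (g n x)%:E \is a fin_num by near: n.
have := ghf n => /esym; rewrite -[RHS]fineK//.
have hn : (fine L - e / 2)%:E <= \int[mu]_x (g n x - f n x)%:E.
  have : (fine L - e / 2)%:E <= einfs (fun n => \int[mu]_x (g n x - f n x)%:E) n.
    by near: n.
  move=> /le_trans; apply; apply: ereal_inf_lbound.
  by exists n => //=.
have : (`|fine L - fine (\int[mu]_x (g n x)%:E)| <= e / 2)%R by near: n.
rewrite ler_norml => /andP[gn1 _] E.
have : (fine L - e / 2)%:E + \int[mu]_x (f n x)%:E <= (fine (\int[mu]_x (g n x)%:E))%:E.
  by rewrite -E leeD2r.
rewrite -leeBrDl// => /le_trans; apply.
rewrite -EFinB lee_fin; lra.
Unshelve. all: by end_near. Qed.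

End tools.

End limits.

(** Both A x T and T x A are null when A is. *)
Lemma ae_prod d (T : measurableType d) {R : realType}
    (m : {sigma_finite_measure set T -> \bar R}) (P : T -> Prop) :
  {ae m, forall x, P x} -> {ae (m \x m)%E, forall z, P z.1 /\ P z.2}.
Proof.
move=> [A [mA mA0 PA]].
exists ((A `*` setT) `|` (setT `*` A)); split.
- by apply: measurableU; exact: measurableX.
- apply: null_set_setU; try exact: measurableX.
    have := product_measure1E m m mA measurableT.
    by rewrite [X in _ = (X * _)%E -> _]mA0 mul0e.
  have := product_measure1E m m measurableT mA.
  by rewrite [X in _ = (_ * X)%E -> _]mA0 mule0.
- move=> z /= /not_andP[nP|nP]; [left|right]; split => //; exact: PA.
Qed.

Lemma cvg_sigma {T : topologicalType} (u : nat -> T) (l : T) (sigma : nat -> nat) :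
  (forall n, (n <= sigma n)%N) -> u n @[n --> \oo] --> l ->
  u (sigma n) @[n --> \oo] --> l.
Proof.
move=> sn ul; apply: (cvg_comp sigma u _ ul) => A [k _ kA].
exists k => // m /= km; apply: kA => /=; exact: leq_trans (sn m).
Qed.

Lemma cvg0_norm_le {R : realType} (u v : nat -> R) :
  (forall k, `|u k| <= v k) -> v k @[k --> \oo] --> (0 : R) -> u k @[k --> \oo] --> (0 : R).
Proof.
move=> uv /cvgrPdist_le H; apply/cvgrPdist_le => e e0.
have := H _ e0; apply: filterS => k; rewrite !sub0r !normrN; apply: le_trans.
exact: le_trans (uv k) (ler_norm _).
Qed.

Lemma cvge0D {R : realType} (u v : nat -> \bar R) :
  (forall k, 0 <= u k)%E -> (forall k, 0 <= v k)%E ->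
  u k @[k --> \oo] --> 0%E -> v k @[k --> \oo] --> 0%E ->
  (u k + v k)%E @[k --> \oo] --> 0%E.
Proof.
move=> u0 v0 /cvge0P -/(_ u0) U /cvge0P -/(_ v0) V.
apply/cvge0P => [k|e e0]; first by rewrite adde_ge0.
have e20 : 0 < e / 2 by rewrite divr_gt0.
apply: filterS2 (U _ e20) (V _ e20) => k uk vk.
by apply: le_trans (leeD uk vk) _; rewrite -EFinD lee_fin; lra.
Qed.

(** * The Gagliardo energy *)

Lemma ler_powRN {R : realType} (a x y : R) : 0 <= a -> 0 < x -> x <= y ->
  y `^ (- a) <= x `^ (- a).
Proof.
move=> a0 x0 xy; rewrite !powRN lef_pV2 ?posrE ?powR_gt0//; last exact: lt_le_trans xy.
by rewrite ge0_ler_powR// nnegrE ?ltW// (lt_le_trans x0).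
Qed.

(** |a + b| is at most twice the larger of |a| and |b|. *)
Lemma normD_powR_le {R : realType} (p a b : R) : 0 <= p ->
  `|a + b| `^ p <= 2 `^ p * (`|a| `^ p + `|b| `^ p).
Proof.
move=> p0; wlog ab : a b / `|a| <= `|b|.
  move=> H; have [/H//|/ltW/H] := leP `|a| `|b|.
  by rewrite [b + a]addrC [X in _ * X]addrC.
apply: (@le_trans _ _ ((2 * `|b|) `^ p)).
  apply: ge0_ler_powR; rewrite ?nnegrE ?mulr_ge0//.
  by have := ler_normD a b; lra.
by rewrite powRM// ler_wpM2l ?powR_ge0// lerDr powR_ge0.
Qed.

Lemma ge0_integral_prodM d1 d2 (T1 : measurableType d1) (T2 : measurableType d2)
    {R : realType} (m1 : {sigma_finite_measure set T1 -> \bar R})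
    (m2 : {sigma_finite_measure set T2 -> \bar R}) (f : T1 -> \bar R) (g : T2 -> \bar R) :
  measurable_fun setT f -> measurable_fun setT g ->
  (forall x, 0 <= f x)%E -> (forall x, 0 <= g x)%E ->
  (\int[(m1 \x m2)]_z (f z.1 * g z.2) = \int[m1]_x f x * \int[m2]_y g y)%E.
Proof.
move=> mf mg f0 g0; rewrite fubini_tonelli1; last 2 first.
- by apply: emeasurable_funM; exact: measurableT_comp.
- by move=> z; rewrite mule_ge0.
rewrite -ge0_integralZr//; last by apply: integral_ge0.
by apply: eq_integral => x _; rewrite /fubini_F/= ge0_integralZl.
Qed.

Section energy.
Context {R : realType} {n : nat} (s p : R).
Context (mu : {sigma_finite_measure set 'rV[R]_n -> \bar R}).
Implicit Types (u v : 'rV[R]_n -> R) (D : set 'rV[R]_n).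

(** The exponent is negative: the kernel is the inverse of |x - y|^(n + s p), with
    value 0 on the diagonal when n + s p is not 0. *)
Definition sing_kernel (z : 'rV[R]_n * 'rV[R]_n) : R :=
  enorm (z.1 - z.2) `^ (- (n%:R + s * p)).

Definition density (u : 'rV[R]_n -> R) (z : 'rV[R]_n * 'rV[R]_n) : R :=
  `|u z.1 - u z.2| `^ p * sing_kernel z.

Definition energy (D : set 'rV[R]_n) (u : 'rV[R]_n -> R) : \bar R :=
  (\int[(mu \x mu)]_(z in D `*` D) (density u z)%:E)%E.

Lemma sing_kernel_ge0 z : 0 <= sing_kernel z. Proof. exact: powR_ge0. Qed.

Lemma sing_kernelC x y : sing_kernel (x, y) = sing_kernel (y, x).
Proof. by rewrite /sing_kernel /= enormC. Qed.

Lemma density_ge0 u z : 0 <= density u z.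
Proof. by rewrite mulr_ge0 ?powR_ge0 ?sing_kernel_ge0. Qed.

Lemma energy_ge0 D u : (0 <= energy D u)%E.
Proof. by apply: integral_ge0 => z _; rewrite lee_fin density_ge0. Qed.

Lemma measurable_sing_kernel : measurable_fun setT sing_kernel.
Proof.
apply: (measurableT_comp (measurable_powR _)).
apply: (measurableT_comp (@measurable_enorm R n)).
exact: measurable_rowB.
Qed.

Lemma measurable_normr_powR d (T : measurableType d) (f : T -> R) :
  measurable_fun setT f -> measurable_fun setT (fun x => `|f x| `^ p).
Proof.
move=> mf; apply: (measurableT_comp (measurable_powR _)).
exact: measurableT_comp.
Qed.

Lemma measurable_diff (u : 'rV[R]_n -> R) : measurable_fun setT u ->
  measurable_fun setT (fun z : 'rV[R]_n * 'rV[R]_n => u z.1 - u z.2).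
Proof. by move=> mu_; apply: measurable_funB; exact: measurableT_comp. Qed.

Lemma measurable_density u : measurable_fun setT u ->
  measurable_fun setT (density u).
Proof.
move=> mu_; apply: measurable_funM; last exact: measurable_sing_kernel.
apply: (@measurable_normr_powR _ _ (fun z : 'rV[R]_n * 'rV[R]_n => u z.1 - u z.2)).
exact: measurable_diff.
Qed.

Lemma measurable_density_EFin (D : set ('rV[R]_n * 'rV[R]_n)) u : measurable_fun setT u ->
  measurable_fun D (fun z => (density u z)%:E).
Proof.
by move=> ?; apply/measurable_EFinP/measurable_funTS; exact: measurable_density.
Qed.

Lemma tonelli_energy (D : set 'rV[R]_n) (f : 'rV[R]_n * 'rV[R]_n -> \bar R) :
  measurable D -> measurable_fun setT f -> (forall z, (0 <= f z)%E) ->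
  (\int[mu]_(y in D) \int[mu]_(x in D) f (x, y) =
   \int[(mu \x mu)]_(z in D `*` D) f z)%E.
Proof.
move=> mD mf f0.
have mDD : measurable (D `*` D) by exact: measurableX.
rewrite [RHS]integral_mkcond.
have mfD : measurable_fun setT (f \_ (D `*` D)).
  by apply/(measurable_restrictT _ _).1 => //; exact: measurable_funTS.
rewrite (fubini_tonelli2 _ mfD); last by move=> z; apply: erestrict_ge0.
rewrite [LHS]integral_mkcond; apply: eq_integral => y _.
rewrite /fubini_G patchE; case: ifPn => yD; last first.
  apply/esym/integral0_eq => x _; rewrite patchE ifF//.
  by apply/negbTE; apply: contra yD; rewrite !inE => -[].
rewrite [LHS]integral_mkcond; apply: eq_integral => x _; rewrite !patchE.
by rewrite in_setX yD andbT.
Qed.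

Lemma energyD D u v : 0 <= p -> measurable D -> measurable_fun setT u ->
  measurable_fun setT v ->
  (energy D (fun x => u x + v x)%R <= (2 `^ p)%:E * (energy D u + energy D v))%E.
Proof.
move=> p0 mD mu_ mv.
have mDD : measurable (D `*` D) by exact: measurableX.
rewrite /energy -ge0_integralD//; last 4 first.
- by move=> z _; rewrite lee_fin density_ge0.
- exact: measurable_density_EFin.
- by move=> z _; rewrite lee_fin density_ge0.
- exact: measurable_density_EFin.
rewrite -ge0_integralZl_EFin ?powR_ge0//; last 2 first.
- by move=> z _; rewrite adde_ge0// lee_fin density_ge0.
- by apply: emeasurable_funD; exact: measurable_density_EFin.
apply: ge0_le_integral => //.
- by move=> z _; rewrite lee_fin density_ge0.
- by apply: measurable_density_EFin; exact: measurable_funD.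
- by apply: measurable_funeM; apply: emeasurable_funD; exact: measurable_density_EFin.
move=> z _; rewrite -EFinD -EFinM lee_fin /density -mulrDl mulrA.
rewrite ler_wpM2r ?sing_kernel_ge0// (_ : _ - _ = (u z.1 - u z.2) + (v z.1 - v z.2)).
  exact: normD_powR_le.
by ring.
Qed.

Lemma energyZ D u (a : R) : measurable D -> measurable_fun setT u ->
  (energy D (fun x => a * u x)%R = (`|a| `^ p)%:E * energy D u)%E.
Proof.
move=> mD mu_.
have mDD : measurable (D `*` D) by exact: measurableX.
rewrite /energy -ge0_integralZl_EFin ?powR_ge0//; last 2 first.
- by move=> z _; rewrite lee_fin density_ge0.
- exact: measurable_density_EFin.
apply: eq_integral => z _; rewrite -EFinM /density -mulrBr normrM powRM//.
by rewrite mulrA.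
Qed.

Lemma energy_le D D' u : measurable D -> measurable D' -> measurable_fun setT u ->
  D `<=` D' -> (energy D u <= energy D' u)%E.
Proof.
move=> mD mD' mu_ DD'; apply: ge0_subset_integral.
- exact: measurableX.
- exact: measurableX.
- exact: measurable_density_EFin.
- by move=> z _; rewrite lee_fin density_ge0.
- by move=> z [/= /DD' ? /DD' ?].
Qed.

(** A pair in D' x D' outside D x D contributes only if one of its points is in
    Omega; the other one is then in D' minus D, where u vanishes, and the
    contribution is |u|^p times the kernel.  The factor 2 counts the two orders. *)
Lemma energy_tail (Omega D D' : set 'rV[R]_n) u (C : R) : 0 < p ->
  measurable D -> measurable D' -> D `<=` D' -> Omega `<=` D -> measurable_fun setT u ->
  (forall x, ~ Omega x -> u x = 0) ->
  (forall x, Omega x ->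
    (\int[mu]_(y in D' `\` D) (sing_kernel (x, y))%:E <= C%:E)%E) ->
  (energy D' u <= energy D u + (2 * C)%:E * \int[mu]_x (`|u x| `^ p)%:E)%E.
Proof.
move=> p0 mD mD' DD' OD mu_ u0 kC.
have mDD : measurable (D `*` D) by exact: measurableX.
have mE : measurable (D' `\` D) by exact: measurableD.
have mup : measurable_fun setT (fun x => `|u x| `^ p) by exact: measurable_normr_powR.
pose G (z : 'rV[R]_n * 'rV[R]_n) : \bar R :=
  (`|u z.1| `^ p * sing_kernel z * \1_(D' `\` D) z.2)%:E.
have G0 z : (0 <= G z)%E.
  by rewrite lee_fin !mulr_ge0 ?powR_ge0 ?sing_kernel_ge0// indicE.
have mG : measurable_fun setT G.
  apply/measurable_EFinP; apply: measurable_funM; last first.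
    exact: (measurableT_comp (measurable_indic mE)).
  apply: measurable_funM; last exact: measurable_sing_kernel.
  exact: (measurableT_comp mup).
have intG : (\int[(mu \x mu)]_z G z <= C%:E * \int[mu]_x (`|u x| `^ p)%:E)%E.
  rewrite fubini_tonelli1//.
  have mF := measurable_fun_fubini_tonelli_F G mG G0.
  have up0 x : (0 <= (`|u x| `^ p)%:E)%E by rewrite lee_fin powR_ge0.
  have mupE : measurable_fun setT (fun x => (`|u x| `^ p)%:E) by exact/measurable_EFinP.
  have [[x0 Ox0]|nO] := pselect (exists x, Omega x); last first.
    rewrite integral0_eq; last first.
      move=> x _; apply: integral0_eq => y _; rewrite /G /= u0 ?normr0 ?powR0 ?gt_eqF ?mul0r//.
      by move=> Ox; apply: nO; exists x.
    rewrite integral0_eq ?mule0// => x _; rewrite u0 ?normr0 ?powR0 ?gt_eqF//.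
    by move=> Ox; apply: nO; exists x.
  have C0 : 0 <= C.
    rewrite -lee_fin; apply: le_trans (kC _ Ox0).
    by apply: integral_ge0 => y _; rewrite lee_fin sing_kernel_ge0.
  rewrite -ge0_integralZl_EFin//.
  apply: ge0_le_integral => //.
  - by move=> x _; apply: integral_ge0.
  - exact: measurable_funeM.
  move=> x _; rewrite /fubini_F /G /=.
  have [Ox|/u0 ux0] := pselect (Omega x); last first.
    rewrite ux0 normr0 powR0 ?gt_eqF// mule0 integral0_eq// => y _.
    by rewrite !mul0r.
  rewrite muleC; apply: le_trans (_ : _ <= (`|u x| `^ p)%:E *
      \int[mu]_(y in D' `\` D) (sing_kernel (x, y))%:E)%E _; last first.
    by apply: lee_wpmul2l => //; exact: kC.
  rewrite [X in (_ <= _ * X)%E]integral_mkcond -ge0_integralZl_EFin ?powR_ge0//; last 2 first.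
  - by move=> y _; apply: erestrict_ge0 => ? _; rewrite lee_fin sing_kernel_ge0.
  - apply/(measurable_restrictT _ _).1 => //; apply: measurable_funTS.
    apply/measurable_EFinP; exact: (measurableT_comp measurable_sing_kernel (pair1_measurable x)).
  rewrite le_eqVlt; apply/orP; left; apply/eqP; apply: eq_integral => y _.
  by rewrite patchE indicE; case: (y \in _); rewrite ?mulr1 ?mulr0 ?mule0.
pose G' z := G (z.2, z.1).
have mG' : measurable_fun setT G'.
  exact: (measurableT_comp mG (@measurable_swap _ _ _ _)).
have G'0 z : (0 <= G' z)%E by exact: G0.
have intG' : (\int[(mu \x mu)]_z G' z = \int[(mu \x mu)]_z G z)%E.
  have -> := @fubini_tonelli2 _ _ _ _ _ mu mu G' mG' G'0.
  by have -> := @fubini_tonelli1 _ _ _ _ _ mu mu G mG G0.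
rewrite EFinM -muleA -[2]/(1 + 1) EFinD ge0_muleDl// !mul1e.
rewrite addeA.
have -> : energy D' u = (energy D u +
   \int[(mu \x mu)]_(z in (D' `*` D') `\` (D `*` D)) (density u z)%:E)%E.
  rewrite -ge0_integral_setU//.
  - rewrite setDUK//. by move=> z [/= /DD' ? /DD' ?].
  - by apply: measurableD => //; exact: measurableX.
  - exact: measurable_density_EFin.
  - by move=> z _; rewrite lee_fin density_ge0.
  - by apply/disj_setPS => z [? []].
rewrite -addeA leeD2l//.
apply: (@le_trans _ _ (\int[(mu \x mu)]_z (G z + G' z))%E).
  rewrite integral_mkcond; apply: ge0_le_integral => //.
  - by move=> z _; apply: erestrict_ge0 => ? _; rewrite lee_fin density_ge0.
  - apply/(measurable_restrictT _ _).1; last exact: measurable_density_EFin.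
    by apply: measurableD => //; exact: measurableX.
  - exact: emeasurable_funD.
  move=> [x y] _; rewrite patchE; case: ifPn => [|_]; last by rewrite adde_ge0.
  rewrite inE /= => -[[D'x D'y] nD].
  have [Ox|nOx] := pselect (Omega x).
    have nDy : ~ D y by move=> Dy; apply: nD; split => //; exact: OD.
    have uy : u y = 0 by apply: u0 => /OD.
    rewrite /density /= uy subr0 -[leLHS]adde0; apply: leeD => //.
    by rewrite /G /= indicE mem_set// mulr1.
  rewrite /density /= (u0 _ nOx) sub0r normrN.
  have [Oy|nOy] := pselect (Omega y); last first.
    by rewrite (u0 _ nOy) normr0 powR0 ?gt_eqF// mul0r adde_ge0.
  have nDx : ~ D x by move=> Dx; apply: nD; split => //; exact: OD.
  rewrite -[leLHS]add0e; apply: leeD => //.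
  by rewrite /G' /G /= indicE mem_set// mulr1 sing_kernelC.
rewrite ge0_integralD// intG'; exact: leeD.
Qed.

(** For x in Omega and y in A, |u(x) - u(y)| = |u(x)|: these pairs alone
    contribute the left-hand side. *)
Lemma poincare (Omega A D : set 'rV[R]_n) u (kappa : R) : 0 < p -> 0 <= kappa ->
  measurable A -> measurable D -> measurable Omega -> measurable_fun setT u ->
  (forall x, ~ Omega x -> u x = 0) ->
  Omega `<=` D -> A `<=` D -> A `<=` ~` Omega ->
  (forall x y, Omega x -> A y -> kappa <= sing_kernel (x, y)) ->
  (kappa%:E * mu A * \int[mu]_x (`|u x| `^ p)%:E <= energy D u)%E.
Proof.
move=> p0 k0 mA mD mO mu_ u0 OD AD AO kk.
have mup : measurable_fun setT (fun x => `|u x| `^ p) by exact: measurable_normr_powR.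
have mupE : measurable_fun setT (fun x => (`|u x| `^ p)%:E) by exact/measurable_EFinP.
have up0 x : (0 <= (`|u x| `^ p)%:E)%E by rewrite lee_fin powR_ge0.
have iA z : (0 <= (\1_A z : R)%:E)%E by rewrite lee_fin indicE.
have miA : measurable_fun setT (fun x => (\1_A x : R)%:E).
  exact/measurable_EFinP/measurable_indic.
pose G (z : 'rV[R]_n * 'rV[R]_n) : \bar R :=
  (kappa%:E * ((`|u z.1| `^ p)%:E * (\1_A z.2)%:E))%E.
have mG : measurable_fun setT G.
  apply: measurable_funeM; apply: emeasurable_funM.
    exact: (measurableT_comp mupE).
  exact: (measurableT_comp miA).
have G0 z : (0 <= G z)%E by rewrite /G !mule_ge0.
have -> : (kappa%:E * mu A * \int[mu]_x (`|u x| `^ p)%:E =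
    \int[(mu \x mu)]_z G z)%E.
  rewrite ge0_integralZl_EFin//; last first.
    by apply: emeasurable_funM; [exact: (measurableT_comp mupE)|
      exact: (measurableT_comp miA)].
  rewrite (@ge0_integral_prodM _ _ _ _ _ _ _ (fun x => (`|u x| `^ p)%:E)
    (fun x => (\1_A x : R)%:E))// integral_indic// setIT.
  by rewrite -muleA; congr (_ * _)%E; rewrite muleC.
rewrite /energy [leRHS]integral_mkcond; apply: ge0_le_integral => //.
  apply/(measurable_restrictT _ _).1; last exact: measurable_density_EFin.
  exact: measurableX.
move=> [x y] _; rewrite /G /=.
have dx0 : (0 <= ((fun z => (density u z)%:E) \_ (D `*` D)) (x, y))%E.
  by apply: erestrict_ge0 => ? _; rewrite lee_fin density_ge0.
have [Ox|/u0 ux0] := pselect (Omega x); last first.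
  by rewrite ux0 normr0 powR0 ?gt_eqF// mul0e mule0.
rewrite indicE; have [yA|_] := boolP (y \in A); last by rewrite !mule0.
rewrite inE in yA.
rewrite patchE ifT; last by rewrite inE; split => /=; [exact: OD|exact: AD].
rewrite mule1 -EFinM lee_fin /density /= (u0 y) ?subr0; last exact: AO.
by rewrite mulrC ler_wpM2l ?powR_ge0// kk.
Qed.

End energy.

(** * Lebesgue measure and the singular kernel *)

(** Lebesgue measure as a sealed constant, because unification tends to unfold the
    recursion on the dimension. *)
HB.lock Definition leb (R : realType) (n : nat) :
  {sigma_finite_measure set 'rV[R]_n -> \bar R} := @lebesgue_row R n.

Lemma leb_eball_le (R : realType) (n : nat) (c : 'rV[R]_n) (r : R) : 0 <= r ->
  (leb R n (eball c r) <= ((2 * r) ^+ n)%:E)%E.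
Proof. by rewrite leb.unlock; exact: lebesgue_row_eball_le. Qed.

Lemma leb_eball_ge (R : realType) (n : nat) (c : 'rV[R]_n) (r : R) : (0 < n)%N -> 0 < r ->
  (((2 * (r / n%:R)) ^+ n)%:E <= leb R n (eball c r))%E.
Proof. by rewrite leb.unlock; exact: lebesgue_row_eball_ge. Qed.

Lemma leb_esphere0 (R : realType) (n : nat) (c : 'rV[R]_n) (r : R) : (0 < n)%N -> 0 <= r ->
  leb R n [set v | enorm (v - c) = r] = 0%E.
Proof. by rewrite leb.unlock; exact: lebesgue_row_esphere0. Qed.

Section gagliardo_energy.
Context {R : realType} {n : nat} (s p : R).
Let mu := leb R n.
Implicit Types (u v : 'rV[R]_n -> R) (D : set 'rV[R]_n).

(** The iterated integral is a double integral by Tonelli's theorem. *)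
Lemma gagliardoE D u : measurable D -> measurable_fun setT u ->
  gagliardo s p D u = (energy s p mu D u `^ p^-1)%E.
Proof.
move=> mD mu_; rewrite /mu leb.unlock /gagliardo /energy.
have mf := measurable_density_EFin s p setT u mu_.
have f0 (z : 'rV[R]_n * 'rV[R]_n) : (0 <= (density s p u z)%:E)%E.
  by rewrite lee_fin density_ge0.
rewrite -(tonelli_energy _ D _ mD mf f0).
congr (_ `^ _)%E; apply: eq_integral => y _; apply: eq_integral => x _.
by rewrite /density /sing_kernel [in RHS]powRN.
Qed.

Lemma gagliardo_powR D u : p != 0 -> measurable D -> measurable_fun setT u ->
  (gagliardo s p D u `^ p)%E = energy s p mu D u.
Proof.
by move=> p0 mD mu_; rewrite gagliardoE// -poweRrM mulVf// poweRe1// energy_ge0.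
Qed.

Lemma gagliardo_cvg0P {T : Type} (F : set_system T) {FF : Filter F} D
    (u : T -> 'rV[R]_n -> R) : 0 < p -> measurable D ->
  (forall t, measurable_fun setT (u t)) ->
  (gagliardo s p D (u t) @[t --> F] --> 0%E) <->
  (energy s p mu D (u t) @[t --> F] --> 0%E).
Proof.
move=> p0 mD mu_.
have le_pow (x : \bar R) (e q : R) : 0 < q -> 0 < e -> (0 <= x)%E ->
    (x <= e%:E -> x `^ q <= (e `^ q)%:E)%E.
  move=> q0 e0 x0 xe; rewrite -poweR_EFin; apply: gt0_ler_poweR => //; first exact: ltW.
  - by rewrite in_itv/= x0 leey.
  - by rewrite in_itv/= lee_fin ltW// leey.
have g0 t : (0 <= gagliardo s p D (u t))%E by exact: poweR_ge0.
have e0' t : (0 <= energy s p mu D (u t))%E by exact: energy_ge0.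
split => /cvge0P H; apply/cvge0P => // e e0.
- have := H g0 _ (powR_gt0 p^-1 e0); apply: filterS => t.
  move=> /(le_pow _ _ p p0 (powR_gt0 _ e0) (g0 t)).
  by rewrite gagliardo_powR ?gt_eqF// -powRrM mulVf ?gt_eqF// powRr1// ltW.
- have := H e0' _ (powR_gt0 p e0); apply: filterS => t.
  have pV0 : 0 < p^-1 by rewrite invr_gt0.
  move=> /(le_pow _ _ p^-1 pV0 (powR_gt0 _ e0) (e0' t)).
  by rewrite -gagliardoE// -powRrM mulfV ?gt_eqF// powRr1// ltW.
Qed.

End gagliardo_energy.

Section dyadic.
Context {R : realType} {n : nat}.
Let mu := leb R n.

Lemma ex_dyadic_ge (r t : R) : 0 < r -> r <= t ->
  exists k, 2 ^+ k * r <= t < 2 ^+ k.+1 * r.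
Proof.
move=> r0 rt.
have ex : exists k, t < 2 ^+ k.+1 * r.
  exists (Num.bound (t / r)); rewrite -ltr_pdivrMr//.
  have t0 : 0 <= t / r by rewrite divr_ge0// ltW// (lt_le_trans r0).
  apply: lt_trans (archi_boundP t0) _.
  rewrite -natrX ltr_nat (@leq_trans (2 ^ Num.bound (t / r)))//; first exact: ltn_expl.
  by rewrite leq_exp2l.
exists (ex_minn ex); case: ex_minnP => m -> min; rewrite andbT.
case: m min => [|m] min; first by rewrite expr0 mul1r.
by rewrite leNgt; apply/negP => /min; rewrite ltnn.
Qed.

Lemma ex_dyadic_lt1 (t : R) : 0 < t -> t < 1 ->
  exists k, 2^-1 ^+ k.+1 <= t < 2^-1 ^+ k.
Proof.
move=> t0 t1.
have ex : exists k, 2^-1 ^+ k.+1 <= t.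
  exists (Num.bound t^-1); rewrite exprVn invf_ple ?posrE ?exprn_gt0//.
  have t0' : 0 <= t^-1 by rewrite invr_ge0 ltW.
  apply/ltW/(lt_trans (archi_boundP t0')).
  rewrite -natrX ltr_nat (@leq_trans (2 ^ Num.bound t^-1))//; first exact: ltn_expl.
  by rewrite leq_exp2l.
exists (ex_minn ex); case: ex_minnP => m -> min; rewrite /=.
case: m min => [|m] min; first by rewrite expr0.
by rewrite ltNge; apply/negP => /min; rewrite ltnn.
Qed.

(** The balls of radius rho k cover the support of f, which is at most c k on
    the k-th one, and the measure of a ball is at most (2 rho)^n. *)
Lemma dyadic_integral_le (x : 'rV[R]_n) (f : 'rV[R]_n -> R) (c rho : nat -> R) :
  measurable_fun setT f -> (forall y, 0 <= f y) ->
  (forall k, 0 <= c k) -> (forall k, 0 <= rho k) ->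
  (forall y, f y <= 0 \/ exists k, f y <= c k /\ enorm (y - x) < rho k) ->
  (\int[mu]_y (f y)%:E <= \sum_(k <oo) (c k * (2 * rho k) ^+ n)%:E)%E.
Proof.
move=> mf f0 c0 rho0 H.
pose g k y : \bar R := ((c k)%:E * (\1_(eball x (rho k)) y)%:E)%E.
have g0 k y : (0 <= g k y)%E by rewrite mule_ge0// lee_fin ?indicE.
have mi k : measurable_fun setT (fun y => (\1_(eball x (rho k)) y : R)%:E).
  by apply/measurable_EFinP/measurable_indic; exact: measurable_eball.
have mg k : measurable_fun setT (g k) by exact: measurable_funeM.
apply: (@le_trans _ _ (\int[mu]_y \sum_(k <oo) g k y)%E).
  apply: ge0_le_integral => //.
  - by move=> y _; rewrite lee_fin.
  - exact/measurable_EFinP.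
  - exact: ge0_emeasurable_sum.
  move=> y _; case: (H y) => [fy0|[k [fyk yk]]].
    by apply: le_trans (nneseries_ge0 _) => //; rewrite lee_fin.
  apply: le_trans (nneseries_lim_ge k.+1 (fun i _ _ => g0 i y)).
  rewrite big_nat_recr//= -[leLHS]add0e; apply: leeD; first exact: sume_ge0.
  by rewrite /g indicE mem_set//= mule1 lee_fin.
rewrite integral_nneseries//; apply: lee_nneseries => k _; first by move=> _; exact: integral_ge0.
rewrite ge0_integralZl_EFin// integral_indic//; last exact: measurable_eball.
rewrite setIT EFinM lee_wpmul2l ?lee_fin//.
exact: leb_eball_le.
Qed.

Lemma powR_expn (b : R) (a : R) (k : nat) : 0 <= b ->
  (b ^+ k) `^ a = (b `^ a) ^+ k.
Proof. move=> b0; rewrite -powR_mulrn// powRAC powR_mulrn//; exact: powR_ge0. Qed.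

Lemma powRND (t : R) (a : R) : 0 < t ->
  t `^ (- (n%:R + a)) = (t ^+ n)^-1 * t `^ (- a).
Proof.
move=> t0; rewrite opprD powRD ?powRN ?powR_mulrn ?(ltW t0)//.
by apply/implyP => _; rewrite gt_eqF.
Qed.

Lemma powR2N_lt1 (a : R) : 0 < a -> 0 <= (2 : R) `^ (- a) < 1.
Proof.
move=> a0; rewrite powR_ge0/= powRN invf_lt1 ?powR_gt0//.
have e : (1 : R) `^ a = 1 by rewrite powR1.
by rewrite -[ltLHS]e; apply: gt0_ltr_powR; rewrite ?nnegrE// ltr1n.
Qed.

(** On the shell 2^k r <= |x - y| < 2^(k+1) r the integral of the kernel is of
    the order of (2^k r)^(- s p): a geometric series. *)
Lemma kernel_far (s p : R) : 0 < s * p -> exists2 C : R, 0 <= C &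
  forall (x : 'rV[R]_n) (r : R), 0 < r ->
  (\int[mu]_(y in ~` eball x r) (sing_kernel s p (x, y))%:E <=
    (C * r `^ (- (s * p)))%:E)%E.
Proof.
move=> a0; have /andP[q0 q1] := powR2N_lt1 _ a0; set q := 2 `^ (- (s * p)) in q0 q1.
exists (4 ^+ n / (1 - q)); first by rewrite divr_ge0 ?exprn_ge0// subr_ge0 ltW.
move=> x r r0.
have mS : measurable (~` eball x r) by apply: measurableC; exact: measurable_eball.
pose f y := sing_kernel s p (x, y) * \1_(~` eball x r) y.
pose c k := (2 ^+ k * r) `^ (- (n%:R + s * p)).
pose rho k := 2 ^+ k.+1 * r.
have -> : (4 ^+ n / (1 - q) * r `^ (- (s * p)))%:E =
    (\sum_(k <oo) (c k * (2 * rho k) ^+ n)%:E)%E.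
  rewrite mulrAC.
  rewrite -geometric_eseries ?q0//; apply: eq_eseriesr => k _; congr (_%:E).
  have k0 : 0 < 2 ^+ k :> R by rewrite exprn_gt0.
  rewrite /c powRND ?mulr_gt0// powRM ?(ltW k0) ?(ltW r0)// powR_expn//.
  rewrite -/q /rho exprS (_ : 2 * (2 * 2 ^+ k * r) = 4 * (2 ^+ k * r)); last by ring.
  rewrite [(4 * _) ^+ n]exprMn.
  have : (2 ^+ k * r) ^+ n != 0 by rewrite expf_neq0// gt_eqF// mulr_gt0.
  by move=> nz; field.
rewrite integral_mkcond.
rewrite (_ : (fun y => _) \_ _ = fun y => (f y)%:E); last first.
  by apply/funext => y; rewrite patchE /f indicE; case: (y \in _); rewrite ?mulr1 ?mulr0.
apply: (dyadic_integral_le x).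
- apply: measurable_funM; last exact: measurable_indic.
  exact: (measurableT_comp (measurable_sing_kernel _ _) (pair1_measurable x)).
- by move=> y; rewrite mulr_ge0 ?sing_kernel_ge0// indicE.
- by move=> k; exact: powR_ge0.
- by move=> k; rewrite mulr_ge0 ?exprn_ge0// ltW.
move=> y; rewrite /f indicE; case: (boolP (y \in _)); last by left; rewrite mulr0.
rewrite inE /eball /= enormC => /negP; rewrite -leNgt => ry; right; have [k /andP[k1 k2]] := ex_dyadic_ge _ _ r0 ry.
exists k; split => //; rewrite mulr1 /sing_kernel /c /=.
by apply: ler_powRN; rewrite ?addr_ge0 ?(ltW a0)// mulr_gt0// exprn_gt0.
Qed.

(** On the shell 2^-(k+1) <= |x - y| < 2^-k the integral is of the order of
    2^(- k (p - s p)), which is summable because s < 1. *)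
Lemma kernel_near (s p : R) : 0 < p -> 0 < s * p < p -> exists2 C : R, 0 <= C &
  forall (x : 'rV[R]_n),
  (\int[mu]_(y in eball x 1) (enorm (x - y)%R `^ p * sing_kernel s p (x, y))%:E <= C%:E)%E.
Proof.
move=> p0 /andP[a0 ap]; have b0 : 0 < p - s * p by rewrite subr_gt0.
have /andP[q0 q1] := powR2N_lt1 _ b0; set q := 2 `^ (- (p - s * p)) in q0 q1.
exists (4 ^+ n / (1 - q)); first by rewrite divr_ge0 ?exprn_ge0// subr_ge0 ltW.
move=> x.
have mS : measurable (eball x 1) by exact: measurable_eball.
pose f y := enorm (x - y)%R `^ p * sing_kernel s p (x, y) * \1_(eball x 1) y.
pose c k := (2^-1 ^+ k) `^ (p - s * p) * ((2^-1 ^+ k.+1) ^+ n)^-1.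
pose rho k : R := 2^-1 ^+ k.
have -> : (4 ^+ n / (1 - q))%:E = (\sum_(k <oo) (c k * (2 * rho k) ^+ n)%:E)%E.
  rewrite -geometric_eseries ?q0//; apply: eq_eseriesr => k _; congr (_%:E).
  have k0 : 0 < 2^-1 ^+ k :> R by rewrite exprn_gt0.
  rewrite /c powR_expn// /q -mulN1r powRrM powR_inv1//.
  rewrite /rho (_ : 2 * _ = 4 * 2^-1 ^+ k.+1); last by rewrite exprS; field.
  rewrite [in RHS]exprMn.
  have : (2^-1 ^+ k.+1) ^+ n != 0 :> R by rewrite !expf_neq0.
  by move=> nz; field.
rewrite integral_mkcond.
rewrite (_ : (fun y => _) \_ _ = fun y => (f y)%:E); last first.
  by apply/funext => y; rewrite patchE /f indicE; case: (y \in _); rewrite ?mulr1 ?mulr0.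
apply: (dyadic_integral_le x).
- apply: measurable_funM; last exact: measurable_indic.
  have mp := @pair1_measurable _ _ 'rV[R]_n 'rV[R]_n x.
  apply: measurable_funM; last exact: (measurableT_comp (measurable_sing_kernel _ _) mp).
  apply: (measurableT_comp (measurable_powR _)).
  apply: (measurableT_comp (@measurable_enorm R n)).
  exact: (measurableT_comp (@measurable_rowB R n) mp).
- by move=> y; rewrite !mulr_ge0 ?powR_ge0 ?sing_kernel_ge0// indicE.
- by move=> k; rewrite mulr_ge0 ?powR_ge0// invr_ge0 !exprn_ge0.
- by move=> k; rewrite exprn_ge0.
move=> y; rewrite /f indicE; case: (boolP (y \in _)); last by left; rewrite mulr0.
rewrite inE /eball /= => y1; rewrite [enorm (y - x)]enormC in y1 *.
have [xy0|xy0] := eqVneq (enorm (x - y)) 0.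
  by left; rewrite xy0 powR0 ?gt_eqF// mul0r mul0r.
have t0 : 0 < enorm (x - y) by rewrite lt_neqAle eq_sym xy0 enorm_ge0.
right; have [k /andP[k1 k2]] := ex_dyadic_lt1 _ t0 y1.
exists k; split => //; rewrite mulr1 /sing_kernel /= powRND// mulrCA.
rewrite -powRD; last by apply/implyP => _; rewrite gt_eqF.
rewrite /c mulrC; apply: ler_pM.
- exact: powR_ge0.
- by rewrite invr_ge0 exprn_ge0 ?enorm_ge0.
- by apply: ge0_ler_powR; rewrite ?nnegrE ?ltW ?exprn_gt0.
- rewrite lef_pV2 ?posrE ?exprn_gt0//.
  by rewrite lerXn2r ?nnegrE ?exprn_ge0 ?enorm_ge0.
Qed.

End dyadic.

(** * Smooth functions and test functions *)

Section Cn.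
Context {R : realType} {n : nat}.
Implicit Types f g : 'rV[R]_n -> R.
Local Notation e_ i := (delta_mx ord0 i : 'rV[R]_n).

Lemma Cn_continuous k f : Cn k f -> continuous f.
Proof. by case: k => [|k] //= []. Qed.

Lemma Cn_pred k f : Cn k.+1 f -> Cn k f.
Proof.
elim: k f => [|k IH] f; first by case.
move=> [cf Hf]; split => // i; have [df Cf] := Hf i; split => //.
exact: IH.
Qed.

Lemma CnS_derivable k f i x : Cn k.+1 f -> derivable f x (e_ i).
Proof. by move=> [_ /(_ i)[]]. Qed.

Lemma CnS_derive k f i : Cn k.+1 f -> Cn k (fun x => 'D_(e_ i) f x).
Proof. by move=> [_ /(_ i)[]]. Qed.

Lemma Cn_cst k (a : R) : Cn k (fun _ : 'rV[R]_n => a).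
Proof.
elim: k a => [|k IH] a /=; first exact: cst_continuous.
split; first exact: cst_continuous.
move=> i; split; first by move=> x; exact: derivable_cst.
rewrite (_ : 'D_(e_ i) _ = fun=> 0); first exact: IH.
by apply/funext => x; exact: derive_cst.
Qed.

Lemma continuous_funD f g : continuous f -> continuous g ->
  continuous (fun x => f x + g x).
Proof. by move=> cf cg x; apply: (@continuousD _ _ _ f g); [exact: cf|exact: cg]. Qed.

Lemma continuous_funM f g : continuous f -> continuous g ->
  continuous (fun x => f x * g x).
Proof. by move=> cf cg x; apply: (@continuousM _ _ f g); [exact: cf|exact: cg]. Qed.

Lemma CnD k f g : Cn k f -> Cn k g -> Cn k (fun x => f x + g x).
Proof.
elim: k f g => [|k IH] f g Cf Cg /=.
  exact: continuous_funD Cf Cg.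
split; first exact: continuous_funD (Cn_continuous _ _ Cf) (Cn_continuous _ _ Cg).
move=> i; split.
  by move=> x; apply: derivableD; [exact: (CnS_derivable _ _ _ _ Cf)|exact: (CnS_derivable _ _ _ _ Cg)].
rewrite (_ : (fun x => _) = fun x => 'D_(e_ i) f x + 'D_(e_ i) g x).
  by apply: IH; exact: CnS_derive.
apply/funext => x; apply: deriveD; [exact: (CnS_derivable _ _ _ _ Cf)|exact: (CnS_derivable _ _ _ _ Cg)].
Qed.

Lemma CnM k f g : Cn k f -> Cn k g -> Cn k (fun x => f x * g x).
Proof.
elim: k f g => [|k IH] f g Cf Cg /=.
  exact: continuous_funM Cf Cg.
split; first exact: continuous_funM (Cn_continuous _ _ Cf) (Cn_continuous _ _ Cg).
move=> i; split.
  by move=> x; apply: derivableM; [exact: (CnS_derivable _ _ _ _ Cf)|exact: (CnS_derivable _ _ _ _ Cg)].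
rewrite (_ : (fun x => _) = fun x => f x * 'D_(e_ i) g x + g x * 'D_(e_ i) f x).
  apply: CnD; apply: IH; first [exact: Cn_pred | exact: CnS_derive].
apply/funext => x; apply: deriveM; [exact: (CnS_derivable _ _ _ _ Cf)|exact: (CnS_derivable _ _ _ _ Cg)].
Qed.

(** The derivative in direction v is a derivative along a line, so that facts on
    functions of one variable apply. *)
Lemma is_derive_line f z v (t : R) : derivable f (t *: v + z) v ->
  is_derive t 1 (fun r : R => f (r *: v + z)) ('D_v f (t *: v + z)).
Proof.
have E : (fun h : R => h^-1 *: (((fun r : R => f (r *: v + z)) \o shift t) (h *: (1 : R))
      - f (t *: v + z))) =
    (fun h : R => h^-1 *: ((f \o shift (t *: v + z)) (h *: v) - f (t *: v + z))).
  apply/funext => h /=; congr (_ *: (f _ - _)).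
  by rewrite [h *: 1]mulr1 scalerDl addrA.
by move=> df; apply: DeriveDef; rewrite /derivable /derive E.
Qed.

Lemma is_derive_powR_comp f x v q : derivable f x v -> 0 < f x ->
  derivable (fun y => f y `^ q) x v /\
  'D_v (fun y => f y `^ q) x = q * f x `^ (q - 1) * 'D_v f x.
Proof.
move=> df fx0; pose F := fun h : R => f (h *: v + x).
have x0 : (0 : R) *: v + x = x by rewrite scale0r add0r.
have F0 : F 0 = f x by rewrite /F x0.
have [dF DF] : is_derive (0 : R) 1 F ('D_v f (0 *: v + x)).
  by apply: is_derive_line; rewrite x0.
rewrite x0 in DF.
have F0in : F 0 \in `]0, +oo[ by rewrite in_itv/= F0 fx0.
have dG : derivable (@powR R ^~ q) (F 0) 1 by exact: derivable_powR.
have dGF : derivable ((@powR R ^~ q) \o F) 0 1.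
  apply/derivable1_diffP.
  by apply: differentiable_comp; apply/derivable1_diffP.
have dg : derivable (fun y => f y `^ q) x v by exact: (iffRL (derivable1P _ _ _) dGF).
split => //.
have [_ DG] : is_derive (0 : R) 1 ((@powR R ^~ q) \o F)
    ('D_v (fun y => f y `^ q) (0 *: v + x)).
  by apply: is_derive_line; rewrite x0.
rewrite x0 in DG.
rewrite -DG -derive1E (derive1_comp dF dG) (powR_derive1 _ F0in) derive1E DF.
by rewrite F0.
Qed.

Lemma continuous_powR_comp f q : continuous f -> (forall x, 0 < f x) ->
  continuous (fun x => f x `^ q).
Proof.
move=> cf f0 x; apply: (@continuous_comp _ _ _ f (@powR R ^~ q)); first exact: cf.
have : derivable (@powR R ^~ q) (f x) 1.
  by apply: derivable_powR; rewrite in_itv/= f0.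
by move/derivable1_diffP/differentiable_continuous.
Qed.

Lemma Cn_powR k f q : Cn k f -> (forall x, 0 < f x) -> Cn k (fun x => f x `^ q).
Proof.
elim: k f q => [|k IH] f q Cf f0; first exact: continuous_powR_comp.
split; first exact/continuous_powR_comp/f0/Cn_continuous/Cf.
move=> i; have df x := CnS_derivable _ _ i x Cf; split.
  by move=> x; have [] := is_derive_powR_comp _ _ _ q (df x) (f0 x).
rewrite (_ : (fun x => _) = fun x => q * f x `^ (q - 1) * 'D_(e_ i) f x).
  apply: CnM; last exact: CnS_derive.
  by apply: CnM; [exact: Cn_cst|apply: IH => //; exact: Cn_pred].
by apply/funext => x; have [] := is_derive_powR_comp _ _ _ q (df x) (f0 x).
Qed.

Lemma smoothD f g : smooth f -> smooth g -> smooth (fun x => f x + g x).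
Proof. by move=> sf sg k; exact: CnD. Qed.

Lemma smoothM f g : smooth f -> smooth g -> smooth (fun x => f x * g x).
Proof. by move=> sf sg k; exact: CnM. Qed.

Lemma smooth_cst (a : R) : smooth (fun _ : 'rV[R]_n => a).
Proof. by move=> k; exact: Cn_cst. Qed.

(** A smooth substitute for |x|.  The subtraction of e makes it vanish at 0, so that
    it preserves supports. *)
Definition soft_abs (e x : R) : R := Num.sqrt (x ^+ 2 + e ^+ 2) - e.

Lemma smooth_soft_abs (e : R) f : 0 < e -> smooth f ->
  smooth (fun x => soft_abs e (f x)).
Proof.
move=> e0 sf k.
have pos x : 0 < f x * f x + e * e.
  by rewrite ltr_wpDl// ?mulr_gt0// -expr2 sqr_ge0.
rewrite (_ : (fun x => _) = (fun x => (f x * f x + e * e) `^ 2^-1 + (- e))).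
  apply: CnD; last exact: Cn_cst.
  apply: Cn_powR => //; apply: CnD; last exact: Cn_cst.
  exact: CnM.
by apply/funext => x; rewrite /soft_abs powR12_sqrt ?(ltW (pos x))// !expr2.
Qed.

Lemma soft_abs0 (e : R) : 0 <= e -> soft_abs e 0 = 0.
Proof. by move=> e0; rewrite /soft_abs expr0n add0r sqrtr_sqr ger0_norm// subrr. Qed.

Lemma soft_abs_lip (e x y : R) : 0 < e -> `|soft_abs e x - soft_abs e y| <= `|x - y|.
Proof.
move=> e0; rewrite /soft_abs opprB addrA subrK.
set a := Num.sqrt (x ^+ 2 + e ^+ 2); set b := Num.sqrt (y ^+ 2 + e ^+ 2).
have xe0 z : 0 < z ^+ 2 + e ^+ 2 by rewrite ltr_wpDl ?sqr_ge0// exprn_gt0.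
have a2 : a ^+ 2 = x ^+ 2 + e ^+ 2 by rewrite sqr_sqrtr// ltW.
have b2 : b ^+ 2 = y ^+ 2 + e ^+ 2 by rewrite sqr_sqrtr// ltW.
have ax : `|x| <= a by rewrite -sqrtr_sqr ler_sqrt ?lerDl ?sqr_ge0// ltW.
have bx : `|y| <= b by rewrite -sqrtr_sqr ler_sqrt ?lerDl ?sqr_ge0// ltW.
have ab0 : 0 < a + b.
  by rewrite ltr_pwDl// ?sqrtr_ge0// sqrtr_gt0.
rewrite -(ler_pM2r ab0).
have -> : `|a - b| * (a + b) = `|x - y| * `|x + y|.
  rewrite -[X in _ * X = _]ger0_norm ?ltW// -!normrM; congr (`|_|).
  by rewrite -!subr_sqr a2 b2 opprD addrACA subrr addr0.
apply: ler_wpM2l => //; apply: le_trans (ler_normD _ _) _; exact: lerD.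
Qed.

Lemma soft_abs_approx (e x : R) : 0 < e -> `|soft_abs e x - `|x| | <= e.
Proof.
move=> e0; rewrite /soft_abs.
have xe0 z : 0 < z ^+ 2 + e ^+ 2 by rewrite ltr_wpDl ?sqr_ge0// exprn_gt0.
have H1 : `|x| <= Num.sqrt (x ^+ 2 + e ^+ 2).
  by rewrite -sqrtr_sqr ler_sqrt ?lerDl ?sqr_ge0// ltW.
have H2 : Num.sqrt (x ^+ 2 + e ^+ 2) <= `|x| + e.
  rewrite -(@ler_pXn2r _ 2)// ?nnegrE ?sqrtr_ge0 ?addr_ge0 ?(ltW e0)//.
  rewrite sqr_sqrtr ?(ltW (xe0 _))// sqrrD real_normK ?num_real//.
  by rewrite -addrA lerD2l lerDr mulrn_wge0// mulr_ge0// ltW.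
rewrite ler_norml; lra.
Qed.

Lemma bounded_derive_line (F : R -> R) (dF : R -> R) (M b : R) :
  (forall t : R, is_derive t 1 F (dF t)) -> (forall t, `|dF t| <= M) ->
  `|F b - F 0| <= M * `|b|.
Proof.
move=> HF HM.
have cF : continuous F.
  move=> t; have [dt _] := HF t.
  by move/derivable1_diffP/differentiable_continuous : dt.
have [b0|b0] := leP 0 b.
  have [c _ ->] := @MVT_segment R F dF 0 b b0 (fun x _ => HF x) (continuous_subspaceT cF).
  by rewrite subr0 normrM ler_wpM2r.
have [c _] := @MVT_segment R F dF b 0 (ltW b0) (fun x _ => HF x) (continuous_subspaceT cF).
by rewrite distrC => ->; rewrite sub0r normrM normrN ler_wpM2r.
Qed.

(** One passes from y to x by changing one coordinate at a time, and applies
    the mean value theorem to each step. *)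
Lemma bounded_derive_lipschitz f (M : R) :
  (forall x i, derivable f x (e_ i)) -> (forall x i, `|'D_(e_ i) f x| <= M) ->
  forall x y, `|f x - f y| <= n%:R * M * enorm (x - y).
Proof.
move=> df HM x y.
(* z k has the first k coordinates of x and the others of y. *)
pose z k : 'rV[R]_n := \row_j (if (j < k)%N then x ord0 j else y ord0 j).
have -> : f x = f (z n) by congr f; apply/rowP => j; rewrite mxE ltn_ord.
have -> : f y = f (z 0%N) by congr f; apply/rowP => j; rewrite mxE.
rewrite -(telescope_sumr (fun k => f (z k)))// big_mkord.
apply: le_trans (ler_norm_sum _ _ _) _.
have -> : n%:R * M * enorm (x - y) = \sum_(i < n) M * enorm (x - y).
  by rewrite sumr_const card_ord -[RHS]mulr_natl mulrA.
apply: ler_sum => i _.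
have -> : z i.+1 = (x ord0 i - y ord0 i) *: e_ i + z i.
  apply/rowP => j; rewrite !mxE /= eq_sym.
  case: (ltngtP j i) => [ji|ij|/val_inj ->].
  - rewrite ltnS ltnW// (_ : (i == j) = false) ?mulr0 ?add0r//.
    by apply/negbTE; rewrite -val_eqE/= neq_ltn ji orbT.
  - rewrite ltnS leqNgt ij/= (_ : (i == j) = false) ?mulr0 ?add0r//.
    by apply/negbTE; rewrite -val_eqE/= neq_ltn ij.
  - by rewrite ltnSn eqxx mulr1 subrK.
pose F (t : R) := f (t *: e_ i + z i).
have F0 : f (z i) = F 0 by rewrite /F scale0r add0r.
rewrite F0 -/(F _).
have HF (t : R) : is_derive t 1 F ('D_(e_ i) f (t *: e_ i + z i)).
  exact: is_derive_line.
apply: le_trans (bounded_derive_line _ _ M _ HF _) _; first by move=> t.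
have M0 : 0 <= M by apply: le_trans (HM x i).
apply: ler_wpM2l => //; have := le_coord_enorm (x - y) i; by rewrite !mxE.
Qed.

End Cn.

Section test_functions.
Context {R : realType} {n : nat} (Omega : set 'rV[R]_n).
Implicit Types phi psi : 'rV[R]_n -> R.

Lemma test_function_supp_sub phi psi : smooth psi -> test_function Omega phi ->
  (forall x, phi x = 0 -> psi x = 0) -> test_function Omega psi.
Proof.
move=> spsi [sphi cphi subphi] H.
have sub : closure [set x | psi x != 0] `<=` closure [set x | phi x != 0].
  by apply: closure_subset => x /=; apply: contra => /eqP /H ->.
split => //; last exact: subset_trans subphi.
by apply: subclosed_compact cphi sub; exact: closed_closure.
Qed.

Lemma test_functionD phi psi : test_function Omega phi -> test_function Omega psi ->
  test_function Omega (fun x => phi x + psi x).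
Proof.
move=> [sphi cphi subphi] [spsi cpsi subpsi].
have sub : closure [set x | phi x + psi x != 0] `<=`
    closure [set x | phi x != 0] `|` closure [set x | psi x != 0].
  rewrite -closureU; apply: closure_subset => x /=.
  have [->|] := eqVneq (phi x) 0; last by left.
  by rewrite add0r => ?; right.
split; first exact: smoothD.
- apply: subclosed_compact sub; [exact: closed_closure|exact: compactU].
- by apply: subset_trans sub _ => x [/subphi|/subpsi].
Qed.

Lemma test_functionZ (a : R) phi : test_function Omega phi ->
  test_function Omega (fun x => a * phi x).
Proof.
move=> tphi; apply: (test_function_supp_sub phi) => //.
  by apply: smoothM; [exact: smooth_cst|case: tphi].
by move=> x ->; rewrite mulr0.
Qed.

Lemma test_function_soft_abs (e : R) phi : 0 < e -> test_function Omega phi ->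
  test_function Omega (fun x => soft_abs e (phi x)).
Proof.
move=> e0 tphi; apply: (test_function_supp_sub phi) => //.
  by apply: smooth_soft_abs => //; case: tphi.
by move=> x ->; rewrite soft_abs0// ltW.
Qed.

Lemma compact_supp_bounded (g : 'rV[R]_n -> R) (K : set 'rV[R]_n) :
  continuous g -> compact K -> (forall x, ~ K x -> g x = 0) ->
  exists2 M, 0 <= M & forall x, `|g x| <= M.
Proof.
move=> cg cK g0.
have : compact (g @` K).
  by apply: continuous_compact => //; exact: continuous_subspaceT.
move=> /compact_bounded[M [_ HM]].
exists (`|M| + 1); first by rewrite addr_ge0.
move=> x; have [Kx|/g0 ->] := pselect (K x); last by rewrite normr0 addr_ge0.
apply: (HM (`|M| + 1)); last by exists x.
by have := ler_norm M; lra.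
Qed.

Lemma test_function_bounded phi : test_function Omega phi ->
  exists2 M, 0 <= M & forall x, `|phi x| <= M.
Proof.
move=> [sphi cphi _]; apply: compact_supp_bounded cphi _; first exact: (sphi 0%N).
by move=> x nx; apply/eqP; apply: contra_notT nx => px; exact: subset_closure.
Qed.

(** The partial derivatives are continuous and vanish outside the compact
    support, hence are bounded. *)
Lemma test_function_lipschitz phi : test_function Omega phi ->
  exists2 L, 0 <= L & forall x y, `|phi x - phi y| <= L * enorm (x - y).
Proof.
move=> [sphi cphi _].
have Hi (i : 'I_n) : exists M, 0 <= M /\ forall x, `|'D_(delta_mx ord0 i) phi x| <= M.
  suff [M M0 HM] : exists2 M, 0 <= M & forall x, `|'D_(delta_mx ord0 i) phi x| <= M by exists M.
  apply: compact_supp_bounded cphi _.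
    by have := CnS_derive _ _ i (sphi 1%N).
  move=> x nx.
  have : \forall y \near x, phi y = cst 0 y.
    have oC : open (~` closure [set x | phi x != 0]).
      by apply: closed_openC; exact: closed_closure.
    have : nbhs x (~` closure [set x | phi x != 0]) by apply: open_nbhs_nbhs.
    apply: filterS => y ny.
    by apply/eqP; apply: contra_notT ny => px; exact: subset_closure.
  by move/near_eq_derive => ->; rewrite derive_cst.
have [M M0 HM] : exists2 M, 0 <= M & forall x i, `|'D_(delta_mx ord0 i) phi x| <= M.
  have [M HM] := choice Hi.
  exists (\sum_i M i); first by apply: sumr_ge0 => i _; have [] := HM i.
  move=> x i; apply: (@le_trans _ _ (M i)); first by have [_] := HM i.
  by rewrite (bigD1 i)//= lerDl; apply: sumr_ge0 => j _; have [] := HM j.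
exists (n%:R * M); first by rewrite mulr_ge0.
apply: bounded_derive_lipschitz HM => x i.
by have := CnS_derivable _ _ i x (sphi 1%N).
Qed.

End test_functions.

(** * Convexity of the p-th power *)

Section convexity.
Context {R : realType} (p : R) (hp : 1 < p).
Let p0 : 0 < p. Proof. exact: lt_trans hp. Qed.
Local Notation f x := (`|x| `^ p).

(** For x > 0 and L = ln x, write x^p = x exp((p - 1) L); the inequality follows from
    1 - L < exp(- L) and 1 + (p - 1) L <= exp((p - 1) L). *)
Lemma bernoulli_powR (x : R) : 0 <= x -> x != 1 -> 1 + p * (x - 1) < x `^ p.
Proof.
rewrite le_eqVlt => /predU1P[<- _|x0 x1].
  by rewrite powR0 ?gt_eqF// sub0r mulrN1 subr_lt0.
pose L := ln x.
have xL : x = expR L by rewrite lnK.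
have L0 : L != 0 by apply: contra x1 => /eqP L0; rewrite xL L0 expR0.
have H1 : 1 - L < expR (- L) by have := @expR_gt1Dx R (- L); rewrite oppr_eq0 => /(_ L0).
have H2 : 1 + (p - 1) * L <= expR ((p - 1) * L) by exact: expR_ge1Dx.
have -> : x `^ p = x * expR ((p - 1) * L).
  have -> : x * expR ((p - 1) * L) = expR (L + (p - 1) * L) by rewrite expRD -xL.
  by rewrite /powR gt_eqF// -/L; congr expR; ring.
have H3 : x * (1 - L) < 1.
  have : x * expR (- L) = 1 by rewrite {1}xL -expRD subrr expR0.
  by move=> E1; rewrite -[ltRHS]E1 ltr_pM2l.
have H4 : (p - 1) * (x * (1 - L)) < (p - 1) * 1 by rewrite ltr_pM2l ?subr_gt0.
have := ler_wpM2l (ltW x0) H2; move: H4; set E := expR _; set y := x * E; nra.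
Qed.

(** Strict convexity of |.|^p, in the form of strict supporting lines: by
    homogeneity it reduces to the point 1, and by symmetry to s >= 0. *)
Lemma tangent_powR (s : R) : exists m : R, forall t, t != s ->
  f s + m * (t - s) < f t.
Proof.
wlog s0 : s / 0 <= s.
  move=> H; have [/H//|/ltW s0] := leP 0 s.
  have [|m Hm] := H (- s); first by rewrite oppr_ge0.
  exists (- m) => t ts; have := Hm (- t); rewrite eqr_opp => /(_ ts).
  by rewrite !normrN; apply: le_lt_trans; rewrite le_eqVlt; apply/orP; left; apply/eqP; ring.
move: s0; rewrite le_eqVlt => /predU1P[<-|s0].
  exists 0 => t t0; rewrite mul0r addr0 normr0 powR0 ?gt_eqF// powR_gt0//.
  by rewrite normr_gt0.
exists (p * s `^ p / s) => t ts.
have ts1 : t / s != 1 by apply: contra ts => /eqP /divr1_eq ->.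
have sp0 : 0 < s `^ p by rewrite powR_gt0.
have -> : f s + p * s `^ p / s * (t - s) = s `^ p * (1 + p * (t / s - 1)).
  by rewrite ger0_norm ?ltW//; field; rewrite gt_eqF.
have [t0|t0] := leP 0 t.
  have -> : f t = s `^ p * (t / s) `^ p.
    rewrite -powRM ?divr_ge0// ?ltW// ger0_norm// mulrCA divff ?mulr1// gt_eqF//.
  by rewrite ltr_pM2l// bernoulli_powR// divr_ge0// ltW.
apply: lt_le_trans (_ : 0 <= _); last exact: powR_ge0.
rewrite pmulr_rlt0//.
have : t / s < 0 by rewrite pmulr_llt0// invr_gt0.
have pp := p0; have p1 := hp.
set q := t / s => q0; nra.
Qed.

(** The mixed second difference of |.|^p. *)
Definition cross_diff (Q h k : R) := f (Q + h + k) + f Q - f (Q + h) - f (Q + k).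

(** Q + h and Q + k are convex combinations of Q and Q + h + k, whose values are
    compared with the supporting lines at these two points. *)
Lemma cross_diff_gt0 Q h k : 0 < h -> 0 < k -> 0 < cross_diff Q h k.
Proof.
move=> h0 k0; rewrite /cross_diff.
have [m1 H1] := tangent_powR (Q + h); have [m2 H2] := tangent_powR (Q + k).
have a1 := H1 Q _; have a2 := H1 (Q + h + k) _.
have b1 := H2 Q _; have b2 := H2 (Q + h + k) _.
have {}a1 : f (Q + h) + m1 * (Q - (Q + h)) < f Q by apply: a1; rewrite lt_eqF// ltrDl.
have {}a2 : f (Q + h) + m1 * ((Q + h + k) - (Q + h)) < f (Q + h + k).
  by apply: a2; rewrite gt_eqF// ltrDl.
have {}b1 : f (Q + k) + m2 * (Q - (Q + k)) < f Q by apply: b1; rewrite lt_eqF// ltrDl.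
have {}b2 : f (Q + k) + m2 * ((Q + h + k) - (Q + k)) < f (Q + h + k).
  by apply: b2; rewrite gt_eqF//; lra.
have hk : 0 < h + k by rewrite addr_gt0.
rewrite -(pmulr_rgt0 _ hk); nra.
Qed.

Lemma cross_diff_ge0 Q h k : 0 <= h -> 0 <= k -> 0 <= cross_diff Q h k.
Proof.
rewrite le_eqVlt => /predU1P[<- _|h0].
  rewrite /cross_diff !addr0 (_ : _ - _ = 0) //; ring.
rewrite le_eqVlt => /predU1P[<-|k0]; last exact/ltW/cross_diff_gt0.
rewrite /cross_diff !addr0 (_ : _ - _ = 0) //; ring.
Qed.

(** A second difference over a larger rectangle is a sum of second differences
    over smaller ones. *)
Lemma cross_diff_mono Q h k h' k' : 0 <= h -> 0 <= k -> h <= h' -> k <= k' ->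
  cross_diff Q h k <= cross_diff Q h' k'.
Proof.
move=> h0 k0 hh' kk'; apply: (@le_trans _ _ (cross_diff Q h' k)).
  have := @cross_diff_ge0 (Q + h) (h' - h) k; rewrite subr_ge0 => /(_ hh' k0).
  rewrite /cross_diff; have -> : Q + h + (h' - h) = Q + h' by ring.
  lra.
have := @cross_diff_ge0 (Q + k) h' (k' - k); rewrite subr_ge0.
move=> /(_ (le_trans h0 hh') kk').
rewrite /cross_diff; have -> : Q + k + h' + (k' - k) = Q + h' + k' by ring.
have -> : Q + k + (k' - k) = Q + k' by ring.
have -> : Q + k + h' = Q + h' + k by ring.
lra.
Qed.

(** What the sum of the p-th powers of the increments of two functions loses when
    the functions, with values a, b and c, e at two points, are replaced by their
    maximum and their minimum. *)
Definition deficit (a b c e : R) : R := f (a - b) + f (c - e) -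
  f (Num.max a c - Num.max b e) - f (Num.min a c - Num.min b e).

(** The only case where the deficit does not vanish, up to exchanging the points,
    is that of pairs ordered in opposite ways. *)
Lemma deficitE_cross a b c e : c <= a -> b <= e ->
  deficit a b c e = cross_diff (c - e) (a - c) (e - b).
Proof.
move=> ca be; rewrite /deficit /cross_diff (max_idPl ca) (max_idPr be).
rewrite (min_idPr ca) (min_idPl be).
have -> : c - e + (a - c) + (e - b) = a - b by ring.
have -> : c - e + (a - c) = a - e by ring.
by have -> : c - e + (e - b) = c - b by ring.
Qed.

Lemma deficit_swap a b c e : deficit a b c e = deficit b a e c.
Proof.
rewrite /deficit (distrC a b) (distrC c e).
by rewrite (distrC (Num.max a c)) (distrC (Num.min a c)).
Qed.

Lemma deficit_ge0 a b c e : 0 <= deficit a b c e.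
Proof.
have [ac|ca] := leP a c; have [be|eb] := leP b e.
- rewrite /deficit (max_idPr ac) (max_idPr be) (min_idPl ac) (min_idPl be).
  by rewrite addrK subrr.
- rewrite deficit_swap deficitE_cross ?(ltW eb)//.
  by rewrite cross_diff_ge0// subr_ge0// ltW.
- rewrite deficitE_cross ?(ltW ca)//.
  by rewrite cross_diff_ge0// subr_ge0// ltW.
- rewrite /deficit (max_idPl (ltW ca)) (max_idPl (ltW eb)) (min_idPr (ltW ca)) (min_idPr (ltW eb)).
  by rewrite [X in X - _ - _]addrC addrK subrr.
Qed.

Lemma deficit_ge a b c e h k : 0 <= h -> 0 <= k -> c + h <= a -> b <= e - k ->
  cross_diff (c - e) h k <= deficit a b c e.
Proof.
move=> h0 k0 ca be; rewrite deficitE_cross; [|lra|lra].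
by apply: cross_diff_mono => //; lra.
Qed.

Lemma cvg_normr_powR0 {T : Type} (F : set_system T) {FF : Filter F} (u : T -> R) :
  (u t @[t --> F] --> 0) <-> (`|u t| `^ p @[t --> F] --> 0).
Proof.
split => /cvgrPdist_le H; apply/cvgrPdist_le => e e0.
- have := H _ (powR_gt0 p^-1 e0); apply: filterS => t; rewrite !sub0r !normrN => ut.
  rewrite ger0_norm ?powR_ge0//.
  have := @ge0_ler_powR R p (ltW p0) `|u t| (e `^ p^-1).
  rewrite !nnegrE normr_ge0 powR_ge0 => /(_ isT isT ut).
  by rewrite -powRrM mulVf ?gt_eqF// powRr1// ltW.
- have := H _ (powR_gt0 p e0); apply: filterS => t; rewrite !sub0r !normrN => ut.
  rewrite ger0_norm ?powR_ge0// in ut.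
  rewrite leNgt; apply/negP => eu; move: ut; rewrite leNgt => /negP; apply.
  by apply: gt0_ltr_powR; rewrite ?nnegrE// ltW.
Qed.

Lemma continuous_normr_powR : continuous (fun x : R => `|x| `^ p).
Proof.
move=> x; have [->|x0] := eqVneq x 0.
  rewrite /continuous_at normr0 powR0 ?gt_eqF//.
  by apply: (iffLR (cvg_normr_powR0 _ _)); exact: cvg_id.
apply: (@continuous_comp _ _ _ (fun x : R => `|x|) (@powR R ^~ p)); first exact: norm_continuous.
have : derivable (@powR R ^~ p) `|x| 1.
  by apply: derivable_powR; rewrite in_itv/= normr_gt0 x0.
by move/derivable1_diffP/differentiable_continuous.
Qed.

End convexity.

(** * Finite energy and equi-integrability *)

Section energy_estimates.
Context {R : realType} {N : nat} (hN : (1 <= N)%N) (p : R) (hp : 1 < p) (s : R)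
  (hs0 : 0 < s) (hs1 : s < 1).
Local Notation mu := (leb R N).
Local Notation energy := (energy s p mu).
Implicit Types (u v : 'rV[R]_N -> R).

Let p0 : 0 < p. Proof. exact: lt_trans hp. Qed.
Let sp0 : 0 < s * p. Proof. exact: mulr_gt0. Qed.

Lemma measurable_near_diagonal (delta : R) :
  measurable [set z : 'rV[R]_N * 'rV[R]_N | enorm (z.1 - z.2) < delta].
Proof.
have md : measurable_fun setT (fun z : 'rV[R]_N * 'rV[R]_N => enorm (z.1 - z.2)).
  apply: (measurableT_comp (@measurable_enorm R N)); exact: measurable_rowB.
rewrite (_ : mkset _ = setT `&` (fun z : 'rV[R]_N * 'rV[R]_N => enorm (z.1 - z.2)) @^-1` `]-oo, delta[).
  by apply: md => //; exact: measurable_itv.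
by rewrite setTI; apply/seteqP; split => x; rewrite /= in_itv.
Qed.

(** Near the diagonal the Lipschitz bound beats the singularity, away from it
    the boundedness of u suffices. *)
Lemma lipschitz_energy_lty (B : set 'rV[R]_N) u (L M : R) : measurable B ->
  (mu B < +oo)%E -> measurable_fun setT u -> 0 <= L -> 0 <= M ->
  (forall x y, `|u x - u y| <= L * enorm (x - y)) -> (forall x, `|u x| <= M) ->
  (energy B u < +oo)%E.
Proof.
move=> mB muB mu_ L0 M0 HL HM.
have sp_lt : 0 < s * p < p by rewrite sp0/= gtr_pMl.
have [C1 C10 near1] := @kernel_near R N s p p0 sp_lt.
have [C2 C20 far2] := @kernel_far R N s p sp0.
have mk : measurable_fun setT (sing_kernel s p : 'rV[R]_N * 'rV[R]_N -> R).
  exact: measurable_sing_kernel.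
have md : measurable_fun setT (fun z : 'rV[R]_N * 'rV[R]_N => enorm (z.1 - z.2) `^ p).
  apply: (measurableT_comp (measurable_powR _)).
  apply: (measurableT_comp (@measurable_enorm R N)); exact: measurable_rowB.
pose S := [set z : 'rV[R]_N * 'rV[R]_N | enorm (z.1 - z.2) < 1].
have mS : measurable S by exact: measurable_near_diagonal.
have mSC : measurable (~` S) by exact: measurableC.
pose H1 (z : 'rV[R]_N * 'rV[R]_N) := enorm (z.1 - z.2) `^ p * sing_kernel s p z * \1_S z.
pose H2 (z : 'rV[R]_N * 'rV[R]_N) := sing_kernel s p z * \1_(~` S) z.
have H10 z : 0 <= H1 z by rewrite !mulr_ge0 ?powR_ge0// indicE.
have H20 z : 0 <= H2 z by rewrite !mulr_ge0 ?powR_ge0// indicE.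
have mH1 : measurable_fun setT H1.
  by apply: measurable_funM; [exact: measurable_funM|exact: measurable_indic].
have mH2 : measurable_fun setT H2.
  by apply: measurable_funM => //; exact: measurable_indic.
pose H (z : 'rV[R]_N * 'rV[R]_N) : \bar R :=
  ((L `^ p)%:E * (H1 z)%:E + ((2 * M) `^ p)%:E * (H2 z)%:E)%E.
have H0 z : (0 <= H z)%E by rewrite adde_ge0// mule_ge0// lee_fin ?powR_ge0.
have mH : measurable_fun setT H.
  by apply: emeasurable_funD; apply: measurable_funeM; exact/measurable_EFinP.
have dH z : ((density s p u z)%:E <= H z)%E.
  rewrite /H -!EFinM -EFinD lee_fin /H1 /H2 /density !indicE in_setC.
  case: (boolP (z \in S)) => zS /=; rewrite !(mulr1, mulr0) ?add0r ?addr0.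
    rewrite mulrA ler_wpM2r ?sing_kernel_ge0// -powRM ?enorm_ge0//.
    by apply: ge0_ler_powR; rewrite ?nnegrE ?mulr_ge0 ?enorm_ge0 ?(ltW p0).
  rewrite ler_wpM2r ?sing_kernel_ge0//.
  apply: ge0_ler_powR; rewrite ?nnegrE ?mulr_ge0 ?(ltW p0)//.
  apply: le_trans (ler_normB _ _) _; have := HM z.1; have := HM z.2; lra.
pose K := L `^ p * C1 + (2 * M) `^ p * C2.
have K0 : 0 <= K by rewrite addr_ge0// mulr_ge0// powR_ge0.
have intH x : (\int[mu]_y H (x, y) <= K%:E)%E.
  have mx := @pair1_measurable _ _ 'rV[R]_N 'rV[R]_N x.
  have mH1x : measurable_fun setT (fun y => (H1 (x, y))%:E).
    by apply/measurable_EFinP; exact: (measurableT_comp mH1 mx).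
  have mH2x : measurable_fun setT (fun y => (H2 (x, y))%:E).
    by apply/measurable_EFinP; exact: (measurableT_comp mH2 mx).
  have inS y : ((x, y) \in S) = (y \in eball x 1).
    by apply/idP/idP; rewrite !inE /S /eball /= enormC.
  rewrite /H ge0_integralD//; last 4 first.
  - by move=> y _; rewrite mule_ge0// lee_fin ?powR_ge0.
  - exact: measurable_funeM.
  - by move=> y _; rewrite mule_ge0// lee_fin ?powR_ge0.
  - exact: measurable_funeM.
  rewrite !ge0_integralZl_EFin ?powR_ge0//; last 2 first.
  - by move=> y _; rewrite lee_fin.
  - by move=> y _; rewrite lee_fin.
  rewrite /K EFinD !EFinM; apply: leeD; apply: lee_wpmul2l; rewrite ?lee_fin ?powR_ge0//.
    apply: le_trans (near1 x); rewrite [leRHS]integral_mkcond le_eqVlt.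
    apply/orP; left; apply/eqP; apply: eq_integral => y _.
    by rewrite patchE /H1 indicE inS; case: (y \in _); rewrite ?mulr1 ?mulr0.
  have := far2 x 1 ltr01; rewrite powR1 mulr1; apply: le_trans.
  rewrite [leRHS]integral_mkcond le_eqVlt.
  apply/orP; left; apply/eqP; apply: eq_integral => y _.
  by rewrite patchE /H2 indicE !in_setC inS; case: (y \in _); rewrite ?mulr1 ?mulr0.
have miB : measurable_fun setT (fun x => (\1_B x : R)%:E).
  exact/measurable_EFinP/measurable_indic.
pose G (z : 'rV[R]_N * 'rV[R]_N) : \bar R := ((\1_B z.1)%:E * H z)%E.
have G0 z : (0 <= G z)%E by rewrite mule_ge0// lee_fin indicE.
have mG : measurable_fun setT G.
  by apply: emeasurable_funM => //; exact: (measurableT_comp miB).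
apply: (@le_lt_trans _ _ (\int[(mu \x mu)]_z G z)%E).
  rewrite /energy integral_mkcond; apply: ge0_le_integral => //.
  - by move=> z _; apply: erestrict_ge0 => ? _; rewrite lee_fin density_ge0.
  - apply/(measurable_restrictT _ _).1; first exact: measurableX.
    exact: measurable_density_EFin.
  move=> z _; rewrite patchE; case: ifPn => // zB; rewrite inE in zB.
  by rewrite /G indicE mem_set ?mul1e//; case: zB.
apply: (@le_lt_trans _ _ (\int[mu]_x (K%:E * (\1_B x)%:E))%E).
  have mF := measurable_fun_fubini_tonelli_F G mG G0.
  rewrite fubini_tonelli1//; apply: ge0_le_integral => //.
  - by move=> x _; exact: integral_ge0.
  - exact: measurable_funeM.
  move=> x _; rewrite /fubini_F /G /=.
  have mHx : measurable_fun setT (fun y => H (x, y)).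
    exact: (measurableT_comp mH (@pair1_measurable _ _ 'rV[R]_N 'rV[R]_N x)).
  by rewrite ge0_integralZl_EFin ?indicE// muleC lee_wpmul2r// lee_fin.
rewrite ge0_integralZl_EFin//.
by rewrite integral_indic// setIT lte_mul_pinfty// lee_fin.
Qed.

(** Average |v(x)|^p <= 2^p (|v(x) - v(y)|^p + |v(y)|^p) over the points y at
    distance less than delta from x, and integrate over x in A.  The first term
    is controlled by the energy, since the kernel is at least
    delta^-(N + s p) there, and the second by the measure of A. *)
Lemma equi_integrable (delta : R) v (A : set 'rV[R]_N) : 0 < delta ->
  measurable_fun setT v -> measurable A ->
  (((2 * (delta / N%:R)) ^+ N)%:E * \int[mu]_(x in A) (`|v x| `^ p)%:E <=
   (2 `^ p)%:E * ((delta `^ (N%:R + s * p))%:E * energy setT v +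
      mu A * \int[mu]_x (`|v x| `^ p)%:E))%E.
Proof.
move=> d0 mv mA.
have mvp : measurable_fun setT (fun x => (`|v x| `^ p)%:E).
  exact/measurable_EFinP/measurable_normr_powR.
have vp0 x : (0 <= (`|v x| `^ p)%:E)%E by rewrite lee_fin powR_ge0.
have miA : measurable_fun setT (fun x => (\1_A x : R)%:E).
  exact/measurable_EFinP/measurable_indic.
have iA0 x : (0 <= (\1_A x : R)%:E)%E by rewrite lee_fin indicE.
pose S := [set z : 'rV[R]_N * 'rV[R]_N | enorm (z.1 - z.2) < delta].
have mS : measurable S by exact: measurable_near_diagonal.
pose W (z : 'rV[R]_N * 'rV[R]_N) : \bar R :=
  ((`|v z.1| `^ p)%:E * (\1_A z.1)%:E * (\1_S z)%:E)%E.
have W0 z : (0 <= W z)%E by rewrite !mule_ge0// lee_fin indicE.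
have mW : measurable_fun setT W.
  apply: emeasurable_funM.
    apply: emeasurable_funM.
      exact: (measurableT_comp mvp).
    exact: (measurableT_comp miA).
  exact/measurable_EFinP/measurable_indic.
apply: (@le_trans _ _ (\int[(mu \x mu)]_z W z)%E).
  rewrite fubini_tonelli1//.
  have mF := measurable_fun_fubini_tonelli_F W mW W0.
  rewrite integral_mkcond.
  have b0 : 0 <= (2 * (delta / N%:R)) ^+ N.
    by rewrite exprn_ge0// mulr_ge0// divr_ge0// ltW.
  rewrite -ge0_integralZl_EFin//; last 2 first.
  - by move=> x _; apply: erestrict_ge0.
  - by apply/(measurable_restrictT _ _).1 => //; exact: measurable_funTS.
  apply: ge0_le_integral => //.
  - by move=> x _; rewrite mule_ge0//; apply: erestrict_ge0.
  - apply: measurable_funeM.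
    by apply/(measurable_restrictT _ _).1 => //; exact: measurable_funTS.
  move=> x _; rewrite patchE /fubini_F /W /=.
  case: ifPn => [xA|_]; last by rewrite mule0; apply: integral_ge0 => y _; exact: (W0 (x, y)).
  rewrite (_ : (fun y => _) = fun y => ((`|v x| `^ p)%:E * (\1_(eball x delta) y)%:E)%E); last first.
    apply/funext => y; rewrite indicE xA mule1; congr (_ * (_ : bool)%:R%:E)%E.
    by apply/idP/idP; rewrite !inE /S /eball /= enormC.
  have mB : measurable (eball x delta) by exact: measurable_eball.
  rewrite ge0_integralZl_EFin ?powR_ge0//; last first.
    exact/measurable_EFinP/measurable_indic.
  rewrite integral_indic// setIT muleC lee_wpmul2l//.
  exact: leb_eball_ge.
pose V (z : 'rV[R]_N * 'rV[R]_N) : \bar R :=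
  ((delta `^ (N%:R + s * p))%:E * (density s p v z)%:E +
   (\1_A z.1)%:E * (`|v z.2| `^ p)%:E)%E.
have md := measurable_density_EFin s p setT v mv.
have den0 z : (0 <= (density s p v z)%:E)%E by rewrite lee_fin density_ge0.
have mAv : measurable_fun setT (fun z : 'rV[R]_N * 'rV[R]_N =>
    (\1_A z.1)%:E * (`|v z.2| `^ p)%:E)%E.
  apply: emeasurable_funM.
    exact: (measurableT_comp miA).
  exact: (measurableT_comp mvp).
have V10 z : (0 <= (delta `^ (N%:R + s * p))%:E * (density s p v z)%:E)%E.
  by rewrite mule_ge0// lee_fin powR_ge0.
have V20 (z : 'rV[R]_N * 'rV[R]_N) : (0 <= (\1_A z.1)%:E * (`|v z.2| `^ p)%:E)%E.
  by rewrite mule_ge0.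
have mV : measurable_fun setT V.
  by apply: emeasurable_funD => //; exact: measurable_funeM.
have -> : ((delta `^ (N%:R + s * p))%:E * energy setT v +
      mu A * \int[mu]_x (`|v x| `^ p)%:E = \int[(mu \x mu)]_z V z)%E.
  rewrite ge0_integralD//; last exact: measurable_funeM.
  rewrite ge0_integralZl_EFin ?powR_ge0// /energy setXTT.
  rewrite (@ge0_integral_prodM _ _ _ _ _ _ _ (fun x => (\1_A x)%:E)
    (fun x => (`|v x| `^ p)%:E))//.
  by rewrite integral_indic// setIT.
rewrite -ge0_integralZl_EFin ?powR_ge0//; last by move=> z _; rewrite adde_ge0.
apply: ge0_le_integral => //; first exact: measurable_funeM.
move=> [x y] _.
have V0 : (0 <= (2 `^ p)%:E * V (x, y))%E.
  apply: mule_ge0; first by rewrite lee_fin powR_ge0.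
  exact: (adde_ge0 (V10 (x, y)) (V20 (x, y))).
case: (boolP (x \in A)) => xA; last first.
  by rewrite /W /= indicE (negbTE xA) mule0 mul0e.
case: (boolP ((x, y) \in S)) => xyS; last first.
  by rewrite /W /= !indicE (negbTE xyS) mule0.
rewrite /W /V /= !indicE xA xyS.
suff : `|v x| `^ p <= 2 `^ p * (delta `^ (N%:R + s * p) * density s p v (x, y) + `|v y| `^ p).
  by rewrite -lee_fin EFinM EFinD EFinM !mule1 mul1e.
have := normD_powR_le p (v x - v y) (v y) (ltW p0); rewrite subrK => /le_trans; apply.
rewrite ler_wpM2l ?powR_ge0// lerD2r /density /=.
have [->|xy] := eqVneq x y.
  by rewrite subrr normr0 powR0 ?gt_eqF// mul0r mulr0.
have exy0 : 0 < enorm (x - y).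
  by rewrite lt_neqAle enorm_ge0 eq_sym enorm_eq0 subr_eq0 xy.
rewrite mulrCA -[leLHS]mulr1 ler_wpM2l ?powR_ge0// /sing_kernel /= powRN.
rewrite ler_pdivlMr ?powR_gt0// mul1r.
apply: ge0_ler_powR; rewrite ?nnegrE ?enorm_ge0 ?addr_ge0 ?(ltW d0) ?(ltW sp0)//.
by move: xyS; rewrite inE /S /= => /ltW.
Qed.

End energy_estimates.

Section energy_limits.
Context {R : realType} {N : nat} (p : R) (hp : 1 < p) (s : R).
Local Notation mu := (leb R N).
Local Notation energyT := (energy s p mu setT).
Implicit Types (u v : 'rV[R]_N -> R).

Let p0 : 0 < p. Proof. exact: lt_trans hp. Qed.

Lemma density_cvg (a : nat -> 'rV[R]_N -> R) a' z :
  a k z.1 @[k --> \oo] --> a' z.1 -> a k z.2 @[k --> \oo] --> a' z.2 ->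
  density s p (a k) z @[k --> \oo] --> density s p a' z.
Proof.
move=> a1 a2; apply: cvgM; last exact: cvg_cst.
have H : a k z.1 - a k z.2 @[k --> \oo] --> a' z.1 - a' z.2 by exact: cvgB.
exact: (cvg_comp (fun k => a k z.1 - a k z.2) (fun r => `|r| `^ p) H (continuous_normr_powR p hp _)).
Qed.

(** By the pointwise hypothesis the density of f k is at most 2^p times the sum
    of the densities of a k and of b, and the integrals of these bounds converge. *)
Lemma energy_dominated (f a : nat -> 'rV[R]_N -> R) (a' b : 'rV[R]_N -> R) :
  (forall k, measurable_fun setT (f k)) -> (forall k, measurable_fun setT (a k)) ->
  measurable_fun setT a' -> measurable_fun setT b ->
  (forall k x y, `|f k x - f k y| <= `|a k x - a k y| + `|b x - b y|) ->
  {ae mu, forall x, f k x @[k --> \oo] --> (0 : R)} ->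
  {ae mu, forall x, a k x @[k --> \oo] --> a' x} ->
  energyT (a k) @[k --> \oo] --> energyT a' ->
  (energyT a' < +oo)%E -> (energyT b < +oo)%E ->
  energyT (f k) @[k --> \oo] --> 0%E.
Proof.
move=> mf ma ma' mb fab f_0 a_a' Ea Ea' Eb.
have twop0 : 0 <= 2 `^ p :> R by exact: powR_ge0.
pose g k z := 2 `^ p * (density s p (a k) z + density s p b z).
pose g' z := 2 `^ p * (density s p a' z + density s p b z).
have intg u : measurable_fun setT u ->
    (\int[(mu \x mu)]_z (2 `^ p * (density s p u z + density s p b z))%:E =
     (2 `^ p)%:E * (energyT u + energyT b))%E.
  move=> mu_; rewrite /energy setXTT -ge0_integralD//; last 4 first.
  - by move=> z _; rewrite lee_fin density_ge0.
  - exact: measurable_density_EFin.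
  - by move=> z _; rewrite lee_fin density_ge0.
  - exact: measurable_density_EFin.
  rewrite -ge0_integralZl_EFin//.
  - by move=> z _; rewrite adde_ge0// lee_fin density_ge0.
  - by apply: emeasurable_funD; exact: measurable_density_EFin.
have mg u : measurable_fun setT u ->
    measurable_fun setT (fun z => 2 `^ p * (density s p u z + density s p b z)).
  move=> mu_; apply: measurable_funM; first exact: measurable_cst.
  by apply: measurable_funD; exact: measurable_density.
rewrite /energy setXTT.
apply: (@pratt _ _ _ (mu \x mu)%E (fun k => density s p (f k)) g g').
- by move=> k; exact: measurable_density.
- by move=> k; exact: mg.
- exact: mg.
- move=> k z; rewrite density_ge0/= /g /density -mulrDl mulrA.
  rewrite ler_wpM2r ?sing_kernel_ge0//.
  set A := a k z.1 - a k z.2; set B := b z.1 - b z.2.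
  apply: (@le_trans _ _ (`| `|A| + `|B| | `^ p)).
    apply: ge0_ler_powR; rewrite ?nnegrE ?(ltW p0)//.
    by rewrite (@ger0_norm _ (`|A| + `|B|)) ?addr_ge0//; exact: fab.
  apply: le_trans (normD_powR_le _ _ _ (ltW p0)) _.
  by rewrite !normr_id.
- by move=> z; rewrite mulr_ge0// addr_ge0// density_ge0.
- have := ae_prod _ _ mu _ f_0; apply: filterS => z [z1 z2].
  have -> : 0 = density s p (fun _ => 0) z :> R.
    by rewrite /density subrr normr0 powR0 ?gt_eqF// mul0r.
  exact: density_cvg.
- have := ae_prod _ _ mu _ a_a'; apply: filterS => z [z1 z2].
  apply: cvgM; first exact: cvg_cst.
  by apply: cvgD; [exact: density_cvg|exact: cvg_cst].
- rewrite /g' intg//; under eq_cvg do rewrite /g intg//.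
  apply: cvgeZl; first by [].
  apply: cvgeD; [|exact: Ea|exact: cvg_cst].
  by rewrite ge0_adde_def// inE energy_ge0.
- rewrite /g' intg//; apply: lte_mul_pinfty; [by rewrite lee_fin|by []|].
  exact: (lte_add_pinfty Ea' Eb).
Qed.

End energy_limits.

(** * Real-variable preliminaries *)

(** Monotonicity and boundedness make the oscillation of f less than e / 3 below
    some t0 and beyond some T; on the segment [t0, T] the local estimates are
    uniform by compactness. *)
Lemma monotone_bounded_unif {R : realType} (f : R -> R) (a M : R) :
  (forall t t', a < t -> t <= t' -> f t <= f t') ->
  (forall t, a < t -> 0 <= f t <= M) ->
  (forall t e, a < t -> 0 < e -> exists2 delta, 0 < delta & forall t1 t2,
     a < t1 -> t - delta <= t1 -> t1 <= t2 -> t2 <= t + delta ->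
     f t2 <= f t1 + e) ->
  forall e, 0 < e -> exists2 delta, 0 < delta & forall t t', a < t -> a < t' ->
    `|t - t'| < delta -> `|f t - f t'| < e.
Proof.
move=> nd bd loc e e0.
pose e' := e / 3; have e'0 : 0 < e' by rewrite divr_gt0.
have a1 : a < a + 1 by rewrite ltrDl.
pose S := f @` [set t | a < t].
have S0 : S !=set0 by exists (f (a + 1)); exists (a + 1).
(* f is within e / 3 of its infimum at t0, and of its supremum at T. *)
have [t0 at0 Ht0] : exists2 t0, a < t0 & forall t, a < t -> f t0 <= f t + e'.
  have iS : has_inf S by split => //; exists 0 => _ [t /= at_ <-]; have /andP[] := bd _ at_.
  have [_ [t0 /= at0 <-] ft0] := inf_adherent e'0 iS.
  exists t0 => // t at_; apply/ltW/(lt_le_trans ft0).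
  by rewrite lerD2r; apply: ge_inf; [exact: iS.2|exists t].
have [T aT HT] : exists2 T, t0 <= T & forall t, a < t -> f t <= f T + e'.
  have sS : has_sup S by split => //; exists M => _ [t /= at_ <-]; have /andP[] := bd _ at_.
  have [_ [T /= aT <-] fT] := sup_adherent e'0 sS.
  exists (Num.max t0 T); first by rewrite le_max lexx.
  move=> t at_; have : f t <= sup S by apply: ub_le_sup; [exact: sS.2|exists t].
  have : f T <= f (Num.max t0 T) by apply: nd => //; rewrite le_max lexx orbT.
  lra.
pose P d x := forall t1 t2, a < t1 -> x - d <= t1 -> t1 <= t2 -> t2 <= x + d ->
  f t2 <= f t1 + e'.
have : \forall d \near (0 : R)^'+, `[t0, T]%classic `<=` P d.
  have /compact_near_coveringP := @segment_compact R t0 T.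
  apply => x /=; rewrite in_itv /= => /andP[t0x xT].
  have [d d0 Hd] := loc x e' (lt_le_trans at0 t0x) e'0.
  have d20 : 0 < d / 2 by rewrite divr_gt0.
  exists (ball x (d / 2), [set y | y < d / 2]).
    split => /=; first exact: nbhsx_ballx.
    exact: nbhs_right_lt.
  move=> [y r] /= [xy rd] t1 t2 at1 H1 H2 H3; apply: Hd => //.
    by move: xy; rewrite /ball /= ltr_norml => /andP[]; lra.
  by move: xy; rewrite /ball /= ltr_norml => /andP[]; lra.
move=> Hnear.
have [d /= d0 Pd] : exists2 d : R, 0 < d & `[t0, T]%classic `<=` P d.
  near (0 : R)^'+ => d; exists d => //.
  by near: d.
exists d => //.
have main t t' : a < t -> a < t' -> t <= t' -> t' < t + d -> f t' <= f t + 2 * e'.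
  move=> at_ at' tt' t'd.
  have [tt0|t0t] := leP t t0.
    have [t't0|t0t'] := leP t' t0.
      have := Ht0 _ at_; have := nd _ _ at' t't0; lra.
    have : f t' <= f t0 + e'.
      apply: (Pd t0); rewrite /= ?in_itv ?lexx//=; lra.
    by have := Ht0 _ at_; lra.
  have [tT|Tt] := leP t T.
    have : f t' <= f t + e'.
      apply: (Pd t) => //; rewrite /= ?in_itv/= ?tT ?ltW//; lra.
    lra.
  have := HT _ at'; have := nd _ _ (lt_le_trans at0 aT) (ltW Tt); lra.
move=> t t' at_ at'; rewrite ltr_norml => /andP[H1 H2].
rewrite /e' in main; rewrite ltr_norml; case: (leP t t') => tt'.
  have := nd _ _ at_ tt'; have := main _ _ at_ at' tt'; lra.
have := nd _ _ at' (ltW tt'); have := main _ _ at' at_ (ltW tt'); lra.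
Unshelve. all: by end_near. Qed.

(** If one of x and y is infinite, so is the other, and [fine] sends both to 0;
    so the eigenvalues are compared even when no function is admissible. *)
Lemma fine_le_add {R : realType} (x y : \bar R) (c : R) : (0 <= x)%E -> 0 <= c ->
  (x <= y)%E -> (y <= x + c%:E)%E -> fine x <= fine y <= fine x + c.
Proof.
case: x => [x| |]//; case: y => [y| |]// => x0 c0; rewrite ?lee_fin => xy.
  by move=> ->; rewrite xy.
by rewrite lexx/= lerDl.
Qed.

Lemma powRN_cvg0 {R : realType} (a r : R) : 0 < a -> 0 < r ->
  ((t - 1) * r) `^ (- a) @[t --> +oo] --> 0.
Proof.
move=> a0 r0; apply/cvgrPdist_le => e e0.
near=> t; rewrite sub0r normrN ger0_norm ?powR_ge0//.
have T : 1 + (e `^ (- a^-1)) / r <= t by near: t; apply: nbhs_pinfty_ge; exact: num_real.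
have te : e `^ (- a^-1) <= (t - 1) * r by rewrite -ler_pdivrMr//; lra.
have := ler_powRN a _ _ (ltW a0) (powR_gt0 _ e0) te.
by rewrite -powRrM mulrNN mulVf ?gt_eqF// powRr1// ltW.
Unshelve. all: by end_near. Qed.

Lemma ge0_lty_EFin {R : realType} (x : \bar R) : (0 <= x)%E -> (x < +oo)%E ->
  exists2 r : R, 0 <= r & x = r%:E.
Proof. by case: x => [r| |]//; rewrite lee_fin => r0 _; exists r. Qed.

Section real_inequalities.
Context {R : realType} (p : R) (hp : 1 < p).
Let p0 : 0 < p. Proof. exact: lt_trans hp. Qed.

(** Superadditivity of t^p on nonnegative numbers, which is the second difference
    at Q = 0. *)
Lemma distr_powR_le (a c : R) : 0 <= a -> 0 <= c ->
  `|a - c| `^ p <= `| `|a| `^ p - `|c| `^ p|.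
Proof.
wlog ca : a c / c <= a.
  move=> H a0 c0; have [/H H1|/ltW/H H1] := leP c a; first exact: H1.
  by rewrite distrC (distrC (_ `^ p)); exact: H1.
move=> a0 c0; have := cross_diff_ge0 p hp 0 (a - c) c.
rewrite subr_ge0 => /(_ ca c0); rewrite /cross_diff !add0r subrK normr0 powR0 ?gt_eqF//.
by move=> H; apply: le_trans (ler_norm _); lra.
Qed.

(** The condition a^p >= c^p + eta forces a >= c + h for a fixed h > 0, and
    b^p <= e^p - eta forces b <= e - k for a fixed k > 0; the second condition is
    void if e^p < eta. *)
Lemma deficit_gap (c e eta : R) : 0 <= c -> 0 <= e -> 0 < eta ->
  exists2 d : R, 0 < d & forall a b, 0 <= a -> 0 <= b ->
    `|c| `^ p + eta <= `|a| `^ p -> `|b| `^ p + eta <= `|e| `^ p ->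
    d <= deficit p a b c e.
Proof.
move=> c0 e0 eta0; have [ee|ee] := ltP (`|e| `^ p) eta.
  exists 1 => // a b a0 b0 _ be; have := powR_ge0 `|b| p; lra.
have ip0 : 0 <= p^-1 by rewrite invr_ge0 ltW.
have root (x : R) : 0 <= x -> (`|x| `^ p) `^ p^-1 = x.
  by move=> x0; rewrite -powRrM mulfV ?gt_eqF// powRr1// ger0_norm.
have mono (x y : R) : 0 <= x -> x <= y -> x `^ p^-1 <= y `^ p^-1.
  by move=> x0 xy; apply: ge0_ler_powR; rewrite ?nnegrE// (le_trans x0).
have smono (x y : R) : 0 <= x -> x < y -> x `^ p^-1 < y `^ p^-1.
  move=> x0 xy; apply: gt0_ltr_powR; rewrite ?nnegrE ?invr_gt0//.
  by rewrite ltW// (le_lt_trans x0).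
pose h := (`|c| `^ p + eta) `^ p^-1 - c; pose k := e - (`|e| `^ p - eta) `^ p^-1.
have cp0 := powR_ge0 `|c| p.
have h0 : 0 < h by rewrite subr_gt0 -[ltLHS]root//; apply: smono => //; lra.
have k0 : 0 < k by rewrite subr_gt0 -[ltRHS]root//; apply: smono; lra.
exists (cross_diff p (c - e) h k); first exact: cross_diff_gt0.
move=> a b a0 b0 ca be; apply: deficit_ge => //; rewrite ?(ltW h0) ?(ltW k0)//.
  by rewrite /h addrC subrK -[leRHS]root//; apply: mono => //; lra.
rewrite /k opprB addrC subrK -[leLHS]root//; apply: mono; rewrite ?powR_ge0//.
lra.
Qed.

End real_inequalities.

(** * Eigenvalues as functions of the radius *)

Section eigenvalue_problem.
Context {R : realType} {N : nat} (hN : (1 <= N)%N) (p : R) (hp : 1 < p) (s : R)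
  (hs0 : 0 < s) (hs1 : s < 1) (Omega : set 'rV[R]_N) (Omega_open : open Omega)
  (Omega_neq0 : Omega !=set0) (c : 'rV[R]_N) (Rad : R)
  (hball : smallest_ball Omega c Rad).
Local Notation mu := (leb R N).
Local Notation energy := (energy s p mu).
Local Notation energyT := (energy setT).
Local Notation S := (sobolev0 s p Omega setT).
Local Notation adm := (admissible s p Omega setT).
Implicit Types (u v : 'rV[R]_N -> R) (D : set 'rV[R]_N).

Let p0 : 0 < p. Proof. exact: lt_trans hp. Qed.
Let sp0 : 0 < s * p. Proof. exact: mulr_gt0. Qed.
Let np0 : p != 0. Proof. by rewrite gt_eqF. Qed.
Let lt12 : 1 < 2 :> R. Proof. by rewrite ltr1n. Qed.

Lemma measurable_Omega : measurable Omega.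
Proof. exact: measurable_open_row. Qed.

(** A nonempty open set in positive dimension is not a point. *)
Lemma Rad_gt0 : 0 < Rad.
Proof.
have [sub _] := hball; have [x Ox] := Omega_neq0.
rewrite ltNge; apply/negP => Rad0.
have all0 y : Omega y -> y = c.
  move=> /sub /= /le_trans/(_ Rad0) yc; apply/eqP; rewrite -subr_eq0 -enorm_eq0.
  by rewrite eq_le yc enorm_ge0.
move: (Omega_open); rewrite openE => /(_ _ Ox) /nbhs_ballP[e /= e0 eO].
pose y : 'rV[R]_N := x + const_mx (e / 2).
have Oy : Omega y.
  apply: eO; rewrite mx_norm_ball /ball_ /=; apply/lt_mx_norm => // i.
  rewrite !mxE opprD addrA subrr sub0r normrN ger0_norm ?divr_ge0 ?ltW//.
  by rewrite ltr_pdivrMr// ltr_pMr// ltr1n.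
have := all0 _ Oy; rewrite -(all0 _ Ox) => /eqP; rewrite -subr_eq0 /y addrC addKr.
move=> /eqP/rowP/(_ (Ordinal hN)); rewrite !mxE => /eqP.
by rewrite gt_eqF// divr_gt0.
Qed.

Lemma Omega_sub_eball t : 1 < t -> Omega `<=` eball c (t * Rad).
Proof.
move=> t1 x /hball.1 /= xc; apply: le_lt_trans xc _.
by rewrite ltr_pMl// Rad_gt0.
Qed.

Lemma dist_Omega_far t x y : 1 < t -> Omega x -> ~ eball c (t * Rad) y ->
  ~ eball x ((t - 1) * Rad) y.
Proof.
move=> t1 /hball.1 /= xc yc yx; apply: yc; rewrite /eball /=.
have := enormB_triangle y x c; move: yx; rewrite /eball /= => yx H.
apply: le_lt_trans H _; have := Rad_gt0; nra.
Qed.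

Lemma mu_Omega_lty : (mu Omega < +oo)%E.
Proof.
apply: le_lt_trans (_ : _ <= mu (eball c (2 * Rad)))%E _.
  apply: le_measure; rewrite ?inE; [exact: measurable_Omega|exact: measurable_eball|].
  by apply: Omega_sub_eball; rewrite ltr1n.
apply: le_lt_trans (leb_eball_le _ _ _ _ _) _; last exact: ltry.
by rewrite mulr_ge0// ltW// Rad_gt0.
Qed.

(** A point outside the ball of radius t Rad is at distance at least
    (t - 1) Rad from Omega. *)
Lemma tail_bound : exists2 C : R, 0 <= C & forall t D, 1 < t -> measurable D ->
  forall x, Omega x ->
  (\int[mu]_(y in D `\` eball c (t * Rad)) (sing_kernel s p (x, y))%:E <=
    (C * ((t - 1) * Rad) `^ (- (s * p)))%:E)%E.
Proof.
have [C C0 HC] := @kernel_far R N s p sp0.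
exists C => // t D t1 mD x Ox.
have r0 : 0 < (t - 1) * Rad by rewrite mulr_gt0 ?subr_gt0 ?Rad_gt0.
apply: le_trans (HC x _ r0); apply: ge0_subset_integral.
- by apply: measurableD => //; exact: measurable_eball.
- by apply: measurableC; exact: measurable_eball.
- apply: measurable_funTS; apply/measurable_EFinP.
  exact: (measurableT_comp (measurable_sing_kernel s p) (@pair1_measurable _ _ 'rV[R]_N 'rV[R]_N x)).
- by move=> y _; rewrite lee_fin sing_kernel_ge0.
- by move=> y [_ /(dist_Omega_far _ _ _ t1 Ox)].
Qed.

(** The shell between the radii Rad and t Rad contains a ball disjoint from
    Omega. *)
Lemma poincare_ball t : 1 < t -> exists2 K : R, 0 <= K & forall u,
  measurable_fun setT u -> (forall x, ~ Omega x -> u x = 0) ->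
  (\int[mu]_x (`|u x| `^ p)%:E <= K%:E * energy (eball c (t * Rad)) u)%E.
Proof.
move=> t1; have Rad0 := Rad_gt0.
pose rho := (t - 1) / 2 * Rad.
have rho0 : 0 < rho by rewrite mulr_gt0// divr_gt0// subr_gt0.
(* c' is halfway between the spheres of radii Rad and t Rad, on the first axis. *)
pose c' := c + ((1 + t) / 2 * Rad) *: delta_mx ord0 (Ordinal hN) : 'rV[R]_N.
have c'E : enorm (c' - c) = (1 + t) / 2 * Rad.
  rewrite /c' addrAC subrr add0r /enorm (bigD1 (Ordinal hN))//= big1 => [|i iN].
    rewrite !mxE !eqxx mulr1 addr0 sqrtr_sqr ger0_norm//.
    by rewrite mulr_ge0 ?ltW//; lra.
  by rewrite !mxE (negbTE iN) andbF mulr0 expr0n.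
pose A := eball c' rho.
have Ac y : A y -> Rad < enorm (y - c) < t * Rad.
  rewrite /A /eball /= => yc'.
  have := enormB_triangle y c' c; rewrite c'E => H1.
  have := enormB_triangle c' y c; rewrite c'E (enormC c' y) => H2.
  rewrite /rho in yc'; apply/andP; split; nra.
pose kappa := ((t + 1) * Rad) `^ (- (N%:R + s * p)).
have k0 : 0 < kappa by rewrite powR_gt0// mulr_gt0//; lra.
have mA0 : (((2 * (rho / N%:R)) ^+ N)%:E <= mu A)%E by exact: leb_eball_ge.
pose m := (2 * (rho / N%:R)) ^+ N.
have m0 : 0 < m by rewrite exprn_gt0// mulr_gt0// divr_gt0// ltr0n.
exists (kappa * m)^-1; first by rewrite invr_ge0 mulr_ge0 ?ltW.
move=> u mu_ u0.
have H := @poincare R N s p mu Omega A (eball c (t * Rad)) u kappa p0 (ltW k0).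
have {}H : (kappa%:E * mu A * \int[mu]_x (`|u x| `^ p)%:E <= energy (eball c (t * Rad)) u)%E.
  apply: H => //.
  - exact: measurable_eball.
  - exact: measurable_eball.
  - exact: measurable_Omega.
  - exact: Omega_sub_eball.
  - by move=> y /Ac /andP[].
  - by move=> y /Ac/andP[yc _] /hball.1 /=; rewrite leNgt yc.
  - move=> x y /hball.1 /= xc /Ac/andP[y1 y2]; rewrite /kappa /sing_kernel /=.
    apply: ler_powRN; first by rewrite addr_ge0// ltW.
      have := enormB_triangle y x c; rewrite (enormC y x); lra.
    have := enormB_triangle x c y; rewrite (enormC c y); lra.
have i0 : (0 <= \int[mu]_x (`|u x| `^ p)%:E)%E.
  by apply: integral_ge0 => x _; rewrite lee_fin powR_ge0.
rewrite -lee_pdivrMl ?invr_gt0 ?mulr_gt0// invrK; apply: le_trans H.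
by rewrite EFinM lee_wpmul2r// lee_wpmul2l// lee_fin ltW.
Qed.

(** The tail of the energy is controlled by int |u|^p, which is controlled by
    the energy on the ball. *)
Lemma energy_equiv t : 1 < t -> exists2 K : R, 0 <= K & forall u,
  measurable_fun setT u -> (forall x, ~ Omega x -> u x = 0) ->
  (energy setT u <= K%:E * energy (eball c (t * Rad)) u)%E.
Proof.
move=> t1; have [C C0 HC] := tail_bound; have [K K0 HK] := poincare_ball _ t1.
set B := eball c (t * Rad); pose C' := C * ((t - 1) * Rad) `^ (- (s * p)).
have C'0 : 0 <= C' by rewrite mulr_ge0// powR_ge0.
have mB : measurable B by exact: measurable_eball.
exists (1 + (2 * C') * K).
  by apply: addr_ge0 => //; apply: mulr_ge0 => //; exact: mulr_ge0.
move=> u mu_ u0.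
have H : (energy setT u <= energy B u + (2 * C')%:E * \int[mu]_x (`|u x| `^ p)%:E)%E.
  apply: (@energy_tail _ _ _ _ mu Omega) => //.
  - exact: Omega_sub_eball.
  - by move=> x Ox; exact: HC.
apply: le_trans H _; rewrite EFinD.
rewrite ge0_muleDl; [|by rewrite lee_fin|
  by rewrite lee_fin; apply: mulr_ge0 => //; exact: mulr_ge0].
rewrite mul1e leeD2l//.
rewrite [in leRHS]EFinM -muleA; apply: lee_wpmul2l; last exact: HK.
by rewrite lee_fin; exact: mulr_ge0.
Qed.

Lemma test_function_supp phi : test_function Omega phi ->
  measurable_fun setT phi /\ (forall x, ~ Omega x -> phi x = 0).
Proof.
move=> [sm _ sub]; split.
  by apply: measurable_continuous_row; exact: (sm 0%N).
move=> x nO; apply/eqP; apply: contra_notT nO => phix.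
by apply: sub; exact: subset_closure.
Qed.

Lemma sobolev0P D u : measurable D ->
  sobolev0 s p Omega D u <-> [/\ measurable_fun setT u,
    forall x, ~ Omega x -> u x = 0 &
    exists phi : nat -> 'rV[R]_N -> R, (forall k, test_function Omega (phi k)) /\
      energy D (fun x => u x - phi k x) @[k --> \oo] --> 0%E].
Proof.
move=> mD; split => -[mu_ u0 [phi [tphi phiu]]]; split; [exact: mu_|exact: u0| |exact: mu_|exact: u0| ];
  exists phi; (split; first exact: tphi);
  have mphi k : measurable_fun setT (fun x => u x - phi k x) by
    apply: measurable_funB; [exact: mu_|exact: (test_function_supp _ (tphi k)).1].
- exact: (iffLR (@gagliardo_cvg0P R N s p nat \oo _ D _ p0 mD mphi) phiu).
- exact: (iffRL (@gagliardo_cvg0P R N s p nat \oo _ D _ p0 mD mphi) phiu).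
Qed.

Lemma sobolev0_sub D D' (K : R) : measurable D -> measurable D' ->
  (forall u, measurable_fun setT u -> (forall x, ~ Omega x -> u x = 0) ->
    (energy D' u <= K%:E * energy D u)%E) ->
  sobolev0 s p Omega D `<=` sobolev0 s p Omega D'.
Proof.
move=> mD mD' HK u /(sobolev0P _ _ mD)[mu_ u0 [phi [tphi phiu]]].
apply/(sobolev0P _ _ mD'); split; [exact: mu_|exact: u0|].
exists phi; split; first exact: tphi.
apply: cvge0_leZ phiu => k; [exact: energy_ge0|exact: energy_ge0|].
apply: HK.
  by apply: measurable_funB; [exact: mu_|exact: (test_function_supp _ (tphi k)).1].
by move=> x nO; rewrite u0// (test_function_supp _ (tphi k)).2// subrr.
Qed.

Lemma sobolev0_eball t : 1 < t ->
  sobolev0 s p Omega (eball c (t * Rad)) = sobolev0 s p Omega setT.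
Proof.
move=> t1; have mB : measurable (eball c (t * Rad)) by exact: measurable_eball.
have [K K0 HK] := energy_equiv _ t1.
apply/seteqP; split; first exact: (sobolev0_sub _ _ K mB measurableT HK).
apply: (sobolev0_sub _ _ 1 measurableT mB) => u mu_ u0.
by rewrite mul1e; exact: energy_le.
Qed.

Lemma admissible_eball t : 1 < t ->
  admissible s p Omega (eball c (t * Rad)) = admissible s p Omega setT.
Proof. by move=> t1; rewrite /admissible sobolev0_eball. Qed.

Lemma Lnorm1_integral u : (forall x, ~ Omega x -> u x = 0) ->
  Lnorm (@lebesgue_row R N) p%:E ((EFin \o u) \_ Omega) = 1%E <->
  (\int[mu]_x (`|u x| `^ p)%:E = 1)%E.
Proof.
move=> u0.
have E : (Lnorm (@lebesgue_row R N) p%:E ((EFin \o u) \_ Omega) `^ p =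
    \int[mu]_x (`|u x| `^ p)%:E)%E.
  rewrite (poweR_Lnorm _ _ np0) leb.unlock; apply: eq_integral => x _.
  rewrite patchE; case: ifPn => [_|]; first by rewrite -poweR_EFin.
  by rewrite notin_setE => /u0 ->; rewrite normr0 powR0// abse0 poweR0r.
split => [H|H].
  by rewrite -E H poweR1r.
have /(congr1 (fun x => x `^ p^-1)%E) := E.
by rewrite H poweR1r -poweRrM mulfV// poweRe1// Lnorm_ge0.
Qed.

Lemma admissible_integral u : admissible s p Omega setT u ->
  [/\ measurable_fun setT u, forall x, ~ Omega x -> u x = 0 &
   (\int[mu]_x (`|u x| `^ p)%:E = 1)%E].
Proof.
by move=> [[mu_ u0 _] /Lnorm1_integral-/(_ u0) nu _]; split.
Qed.

(** The first eigenvalue of D as an extended real; the class of functions is the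
    one of the whole space, for every D. *)
Definition energy_inf D := ereal_inf [set energy D u | u in admissible s p Omega setT].

Lemma energy_inf_ge0 D : (0 <= energy_inf D)%E.
Proof. by apply: le_ereal_inf_tmp => _ [u _ <-]; exact: energy_ge0. Qed.

Lemma first_eigenvalueE D : measurable D ->
  admissible s p Omega D = admissible s p Omega setT ->
  first_eigenvalue s p Omega D = fine (energy_inf D).
Proof.
move=> mD aD; rewrite /first_eigenvalue aD; congr (fine (ereal_inf _)).
have E u : admissible s p Omega setT u -> (gagliardo s p D u `^ p)%E = energy D u.
  by move=> /admissible_integral[mu_ _ _]; exact: gagliardo_powR.
apply/seteqP; split => _ [u au <-]; exists u; [exact: au|by rewrite E|exact: au|by rewrite E].
Qed.

Lemma energy_inf_le D D' : measurable D -> measurable D' -> D `<=` D' ->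
  (energy_inf D <= energy_inf D')%E.
Proof.
move=> mD mD' DD'; apply: le_ereal_inf_tmp => _ [u au <-].
apply: (@le_trans _ _ (energy D u)); first by apply: ereal_inf_lbound; exists u.
by apply: energy_le => //; have [] := admissible_integral _ au.
Qed.

Lemma energy_inf_tail D D' (C : R) : measurable D -> measurable D' -> D `<=` D' ->
  Omega `<=` D -> (forall x, Omega x ->
    (\int[mu]_(y in D' `\` D) (sing_kernel s p (x, y))%:E <= C%:E)%E) ->
  (energy_inf D' <= energy_inf D + (2 * C)%:E)%E.
Proof.
move=> mD mD' DD' OD kC; rewrite -leeBlDr//.
apply: le_ereal_inf_tmp => _ [u au <-]; rewrite leeBlDr//.
have [mu_ u0 nu] := admissible_integral _ au.
apply: (@le_trans _ _ (energy D' u)); first by apply: ereal_inf_lbound; exists u.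
have := @energy_tail _ _ s p mu Omega D D' u C p0 mD mD' DD' OD mu_ u0 kC.
by rewrite nu mule1.
Qed.

Let lam t := first_eigenvalue s p Omega (eball c (t * Rad)).
Let lamoo := first_eigenvalue s p Omega [set: 'rV[R]_N].

Lemma eball_sub t t' : t <= t' -> eball c (t * Rad) `<=` eball c (t' * Rad).
Proof.
by move=> tt' x; rewrite /eball /= => /lt_le_trans; apply; rewrite ler_wpM2r// ltW// Rad_gt0.
Qed.

(** Enlarging the domain raises the energy of every admissible function by at
    most 2 C, as its L^p norm is 1. *)
Lemma eigenvalue_increment D D' (C : R) : measurable D -> measurable D' ->
  admissible s p Omega D = admissible s p Omega setT ->
  admissible s p Omega D' = admissible s p Omega setT ->
  D `<=` D' -> Omega `<=` D -> 0 <= C ->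
  (forall x, Omega x ->
    (\int[mu]_(y in D' `\` D) (sing_kernel s p (x, y))%:E <= C%:E)%E) ->
  first_eigenvalue s p Omega D <= first_eigenvalue s p Omega D' <=
  first_eigenvalue s p Omega D + 2 * C.
Proof.
move=> mD mD' aD aD' DD' OD C0 HC; rewrite (first_eigenvalueE _ mD aD) (first_eigenvalueE _ mD' aD').
apply: fine_le_add; [exact: energy_inf_ge0|exact: mulr_ge0|exact: energy_inf_le|exact: energy_inf_tail].
Qed.

Lemma eigenvalue_tail : exists2 C : R, 0 <= C & forall t, 1 < t ->
  lam t <= lamoo <= lam t + C * ((t - 1) * Rad) `^ (- (s * p)).
Proof.
have [C C0 HC] := tail_bound; exists (2 * C); first exact: mulr_ge0.
move=> t t1; rewrite -mulrA; apply: eigenvalue_increment.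
- exact: measurable_eball.
- exact: measurableT.
- exact: admissible_eball.
- by [].
- exact: subsetT.
- exact: Omega_sub_eball.
- by rewrite mulr_ge0 ?powR_ge0.
- by move=> x Ox; exact: HC.
Qed.

Lemma eigenvalue_mono t t' : 1 < t -> t <= t' -> lam t <= lam t'.
Proof.
move=> t1 tt'; have [C C0 HC] := tail_bound.
have t'1 := lt_le_trans t1 tt'.
have := @eigenvalue_increment (eball c (t * Rad)) (eball c (t' * Rad)) (C * ((t - 1) * Rad) `^ (- (s * p))).
move=> /(_ (measurable_eball _ _) (measurable_eball _ _) (admissible_eball _ t1) (admissible_eball _ t'1)
  (eball_sub _ _ tt') (Omega_sub_eball _ t1)) H.
have /andP[] : lam t <= lam t' <= lam t + 2 * (C * ((t - 1) * Rad) `^ (- (s * p))).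
  apply: H; first by rewrite mulr_ge0 ?powR_ge0.
  by move=> x Ox; apply: HC => //; exact: measurable_eball.
by [].
Qed.

Lemma eigenvalue_cvg : lam t @[t --> +oo] --> lamoo.
Proof.
have [C C0 HC] := eigenvalue_tail.
apply/cvgrPdist_le => e e0.
have C10 : 0 < C + 1 by rewrite ltr_wpDl.
have /cvgrPdist_le/(_ _ (divr_gt0 e0 C10)) := powRN_cvg0 _ _ sp0 Rad_gt0.
apply: filter_app; near=> t.
rewrite sub0r normrN ger0_norm ?powR_ge0// => He.
have t1 : 1 < t by near: t; exact: nbhs_pinfty_gt.
have /andP[H1 H2] := HC _ t1.
rewrite ger0_norm ?subr_ge0//.
apply: (@le_trans _ _ (C * ((t - 1) * Rad) `^ (- (s * p)))); first lra.
apply: (@le_trans _ _ ((C + 1) * ((t - 1) * Rad) `^ (- (s * p)))).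
  by rewrite ler_wpM2r ?powR_ge0// lerDl.
by rewrite mulrC -ler_pdivlMr.
Unshelve. all: by end_near. Qed.

Let shell (t : R) (m : nat) := eball c ((t + (t - 1) / 2 / m.+1%:R) * Rad) `\`
  eball c ((t - (t - 1) / 2 / m.+1%:R) * Rad).

Lemma bigcap_shell t : 1 < t ->
  \bigcap_m shell t m = [set v | enorm (v - c) = t * Rad].
Proof.
move=> t1; have Rad0 := Rad_gt0.
have w0 : 0 < (t - 1) / 2 by rewrite divr_gt0// subr_gt0.
apply/seteqP; split => v /=; last first.
  move=> vt m _; rewrite /shell /eball /= vt !ltr_pM2r//.
  have d0 : 0 < (t - 1) / 2 / m.+1%:R :> R by rewrite divr_gt0// ltr0n.
  move: d0; set d := _ / m.+1%:R => d0.
  by split; [lra|apply/negP; rewrite -leNgt; lra].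
move=> H; apply/eqP; rewrite -subr_eq0 -normr_eq0; apply/negP => /negP n0.
have {}n0 : 0 < `|enorm (v - c) - t * Rad| by rewrite lt_neqAle eq_sym n0 normr_ge0.
pose K := (t - 1) / 2 * Rad; have K0 : 0 < K by rewrite mulr_gt0.
have q0 : 0 <= K / `|enorm (v - c) - t * Rad| by rewrite divr_ge0// ltW.
pose m := Num.bound (K / `|enorm (v - c) - t * Rad|).
have := H m Logic.I; rewrite /shell /eball /= => -[H1 /negP]; rewrite -leNgt => H2.
have {}H1 : `|enorm (v - c) - t * Rad| <= K / m.+1%:R.
  have KE : K / m.+1%:R = (t - 1) / 2 / m.+1%:R * Rad by rewrite /K mulrAC.
  move: H1 H2; rewrite ler_norml KE; set d := _ / m.+1%:R => H1 H2.
  by apply/andP; split; nra.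
have : K / `|enorm (v - c) - t * Rad| < m.+1%:R.
  by apply: lt_trans (archi_boundP q0) _; rewrite ltr_nat.
by rewrite ltr_pdivrMr// mulrC -ltr_pdivrMr ?ltr0n// ltNge H1.
Qed.

Lemma shell_cvg0 t : 1 < t -> mu (shell t m) @[m --> \oo] --> 0%E.
Proof.
move=> t1; have Rad0 := Rad_gt0.
rewrite -(leb_esphere0 _ _ c (t * Rad) hN); last by rewrite mulr_ge0 ?ltW//; lra.
rewrite -bigcap_shell//.
have mS m : measurable (shell t m) by apply: measurableD; exact: measurable_eball.
have w0 : 0 < (t - 1) / 2 by rewrite divr_gt0// subr_gt0.
apply: (@nonincreasing_cvg_mu _ _ _ mu (shell t)).
- apply: (@le_lt_trans _ _ (mu (eball c ((t + (t - 1) / 2 / 1) * Rad)))).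
    apply: le_measure; rewrite ?inE; [exact: mS|exact: measurable_eball|exact: subDsetl].
  apply: le_lt_trans (leb_eball_le _ _ _ _ _) (ltry _).
  rewrite mulr_ge0 ?(ltW Rad0)// addr_ge0//; first lra.
  by rewrite divr_ge0 ?(ltW w0).
- exact: mS.
- exact: bigcapT_measurable.
move=> i j ij; apply/subsetPset => v; rewrite /shell /eball /= => -[H1 H2].
have dij : (t - 1) / 2 / j.+1%:R <= (t - 1) / 2 / i.+1%:R :> R.
  by rewrite ler_wpM2l ?(ltW w0)// lef_pV2 ?posrE ?ltr0n// ler_nat.
split; first by apply: lt_le_trans H1 _; rewrite ler_wpM2r ?(ltW Rad0)// lerD2l.
move=> H3; apply: H2; apply: lt_le_trans H3 _.
by rewrite ler_wpM2r ?(ltW Rad0)// lerD2l lerN2.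
Qed.

(** The ball of radius t2 Rad minus that of radius t1 Rad lies in a shell around
    the sphere of radius t Rad, whose measure is small, and the kernel is bounded
    there because the shell is away from Omega. *)
Lemma eigenvalue_loc t e : 1 < t -> 0 < e -> exists2 delta, 0 < delta &
  forall t1 t2, 1 < t1 -> t - delta <= t1 -> t1 <= t2 -> t2 <= t + delta ->
     lam t2 <= lam t1 + e.
Proof.
move=> t1 e0; have Rad0 := Rad_gt0.
have w0 : 0 < (t - 1) / 2 by rewrite divr_gt0// subr_gt0.
pose r := (t - 1) / 2 * Rad; have r0 : 0 < r by rewrite mulr_gt0.
pose kappa := r `^ (- (N%:R + s * p)).
have k0 : 0 < kappa by rewrite powR_gt0.
have e2k0 : 0 < e / 2 / kappa by rewrite !divr_gt0.
have /(cvge0P _ _ (fun m => measure_ge0 mu (shell t m)))/(_ _ e2k0)[m _ Hm] := shell_cvg0 t t1.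
have {}Hm : (mu (shell t m) <= (e / 2 / kappa)%:E)%E by apply: Hm => /=.
have mS : measurable (shell t m) by apply: measurableD; exact: measurable_eball.
pose delta : R := (t - 1) / 2 / m.+1%:R.
have d0 : 0 < delta by rewrite divr_gt0// ltr0n.
have dw : delta <= (t - 1) / 2.
  by rewrite ler_pdivrMr ?ltr0n// ler_peMr ?(ltW w0)// ler1n.
exists delta => // a b a1 ta ab bt.
have b1 := lt_le_trans a1 ab.
have [mB mB'] : measurable (eball c (a * Rad)) /\ measurable (eball c (b * Rad)).
  by split; exact: measurable_eball.
have /andP[_] : lam a <= lam b <= lam a + 2 * (e / 2).
  apply: (eigenvalue_increment _ _ _ mB mB' (admissible_eball _ a1) (admissible_eball _ b1)
    (eball_sub _ _ ab) (Omega_sub_eball _ a1)); first by rewrite divr_ge0// ltW.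
  move=> x Ox.
  have mk : measurable_fun setT (fun y => (sing_kernel s p (x, y))%:E).
    apply/measurable_EFinP.
    exact: (measurableT_comp (measurable_sing_kernel s p) (@pair1_measurable _ _ 'rV[R]_N 'rV[R]_N x)).
  apply: (@le_trans _ _ (\int[mu]_(y in eball c (b * Rad) `\` eball c (a * Rad)) (cst kappa%:E y))%E).
    apply: ge0_le_integral.
    - exact: measurableD.
    - by move=> y _; rewrite lee_fin sing_kernel_ge0.
    - exact: measurable_funTS.
    - exact: measurable_cst.
    move=> y [yb ya]; rewrite lee_fin /sing_kernel /kappa /=.
    apply: ler_powRN => //; first by rewrite addr_ge0// ltW.
    have := dist_Omega_far _ _ _ a1 Ox ya; rewrite /eball /= => /negP.
    rewrite -leNgt enormC; apply: le_trans; rewrite /r ler_wpM2r ?(ltW Rad0)//; lra.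
  rewrite integral_cst; last exact: measurableD.
  apply: (@le_trans _ _ (kappa%:E * mu (shell t m))%E).
    rewrite lee_wpmul2l ?lee_fin ?(ltW k0)//; apply: le_measure; rewrite ?inE//.
      exact: measurableD.
    move=> y [yb ya]; split.
      by apply: eball_sub yb.
    by move=> ya'; apply: ya; apply: eball_sub ya'.
  by rewrite -lee_pdivlMl// -EFinM mulrC.
by rewrite mulrC divfK.
Qed.

(** * The Sobolev space is a lattice *)

Lemma poincare_full : exists2 K : R, 0 <= K & forall u,
  measurable_fun setT u -> (forall x, ~ Omega x -> u x = 0) ->
  (\int[mu]_x (`|u x| `^ p)%:E <= K%:E * energyT u)%E.
Proof.
have [K K0 HK] := poincare_ball 2 lt12.
exists K => // u mu_ u0; apply: le_trans (HK u mu_ u0) _.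
by rewrite lee_wpmul2l ?lee_fin//; apply: energy_le => //; exact: measurable_eball.
Qed.

Lemma test_function_energy_lty phi : test_function Omega phi -> (energyT phi < +oo)%E.
Proof.
move=> tphi; have [mphi phi0] := test_function_supp _ tphi.
have [K K0 HK] := energy_equiv 2 lt12.
have [L L0 HL] := test_function_lipschitz _ _ tphi.
have [M M0 HM] := test_function_bounded _ _ tphi.
apply: le_lt_trans (HK phi mphi phi0) _.
apply: lte_mul_pinfty; rewrite ?lee_fin//.
apply: (@lipschitz_energy_lty R N p hp s hs0 hs1 _ phi L M) => //.
  exact: measurable_eball.
apply: le_lt_trans (leb_eball_le _ _ _ _ _) (ltry _).
by rewrite mulr_ge0// ltW// (Rad_gt0).
Qed.

Lemma sobolev0TP u : S u <-> [/\ measurable_fun setT u,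
    forall x, ~ Omega x -> u x = 0 &
    exists phi : nat -> 'rV[R]_N -> R, (forall k, test_function Omega (phi k)) /\
      energyT (fun x => u x - phi k x) @[k --> \oo] --> 0%E].
Proof. by apply: sobolev0P. Qed.

Lemma sobolev0_measurable u : S u -> measurable_fun setT u. Proof. by case. Qed.

Lemma sobolev0_supp u : S u -> forall x, ~ Omega x -> u x = 0. Proof. by case. Qed.

Lemma energy_cvgD (u v : nat -> 'rV[R]_N -> R) :
  (forall k, measurable_fun setT (u k)) -> (forall k, measurable_fun setT (v k)) ->
  energyT (u k) @[k --> \oo] --> 0%E -> energyT (v k) @[k --> \oo] --> 0%E ->
  energyT (fun x => u k x + v k x) @[k --> \oo] --> 0%E.
Proof.
move=> mu_ mv u0 v0.
apply: (@cvge0_leZ _ _ _ _ (2 `^ p) _ (fun k => energyT (u k) + energyT (v k))%E) => [k|k|k|].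
- exact: energy_ge0.
- by rewrite adde_ge0// energy_ge0.
- by apply: energyD => //; exact: ltW.
- exact: (cvge0D (fun k => energyT (u k)) (fun k => energyT (v k))
    (fun k => energy_ge0 _ _ _ _ (u k)) (fun k => energy_ge0 _ _ _ _ (v k)) u0 v0).
Qed.

Lemma sobolev0_energy_lty u : S u -> (energyT u < +oo)%E.
Proof.
move=> /sobolev0TP[mu_ u0 [phi [tphi phiu]]].
have /(cvge0P _ _ (fun k => energy_ge0 _ _ _ _ _))/(_ _ ltr01)[k _ Hk] := phiu.
have {}Hk := Hk k (leqnn k).
have mphi := (test_function_supp _ (tphi k)).1.
have -> : u = (fun x => (u x - phi k x) + phi k x)%R.
  by apply/funext => x; rewrite subrK.
apply: le_lt_trans (energyD _ _ _ _ _ _ _ _ _ _) _ => //.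
- exact: ltW.
- exact: measurable_funB.
apply: lte_mul_pinfty; rewrite ?lee_fin ?powR_ge0//.
apply: lte_add_pinfty; last exact: test_function_energy_lty.
by apply: le_lt_trans Hk (ltry _).
Qed.

Lemma sobolev0D u v : S u -> S v -> S (fun x => u x + v x).
Proof.
move=> /sobolev0TP[mu_ u0 [phi [tphi phiu]]] /sobolev0TP[mv v0 [psi [tpsi psiv]]].
apply/sobolev0TP; split; [exact: measurable_funD|by move=> x nx; rewrite u0// v0// addr0|].
exists (fun k x => phi k x + psi k x); split; first by move=> k; exact: test_functionD.
rewrite (_ : (fun k => _) = fun k => energyT (fun x => (u x - phi k x) + (v x - psi k x))%R).
  apply: energy_cvgD.
  - by move=> k; apply: measurable_funB; [|exact: (test_function_supp _ (tphi k)).1].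
  - by move=> k; apply: measurable_funB; [|exact: (test_function_supp _ (tpsi k)).1].
  - exact: phiu.
  - exact: psiv.
by apply/funext => k; congr energyT; apply/funext => x; ring.
Qed.

Lemma sobolev0Z (a : R) u : S u -> S (fun x => a * u x).
Proof.
move=> /sobolev0TP[mu_ u0 [phi [tphi phiu]]].
apply/sobolev0TP; split; [exact: measurable_funM|by move=> x nx; rewrite u0// mulr0|].
exists (fun k x => a * phi k x); split; first by move=> k; exact: test_functionZ.
have mphi k := (test_function_supp _ (tphi k)).1.
apply: (@cvge0_leZ _ _ _ _ (`|a| `^ p) _ (fun k => energyT (fun x => u x - phi k x)%R)) => [k|k|k|].
- exact: energy_ge0.
- exact: energy_ge0.
- rewrite -(energyZ s p mu setT (fun x => u x - phi k x) a measurableT (measurable_funB mu_ (mphi k))).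
  rewrite (_ : (fun x => a * u x - _) = fun x => a * (u x - phi k x))//.
  by apply/funext => x; ring.
- exact: phiu.
Qed.

Lemma sobolev0B u v : S u -> S v -> S (fun x => u x - v x).
Proof.
move=> Su Sv; have := sobolev0D _ _ Su (sobolev0Z (-1) _ Sv).
by congr (S _); apply/funext => x; rewrite mulN1r.
Qed.

Lemma sobolev0_powR_lty u : S u -> (\int[mu]_x (`|u x| `^ p)%:E < +oo)%E.
Proof.
move=> Su; have [K K0 HK] := poincare_full.
apply: le_lt_trans (HK u (sobolev0_measurable _ Su) (sobolev0_supp _ Su)) _.
by apply: lte_mul_pinfty; rewrite ?lee_fin ?energy_ge0//; exact: sobolev0_energy_lty.
Qed.

(** By the Poincare inequality, w k tends to 0 in L^p. *)
Lemma cvg_energy_subseq_ae (w : nat -> 'rV[R]_N -> R) :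
  (forall k, measurable_fun setT (w k)) ->
  (forall k x, ~ Omega x -> w k x = 0) ->
  energyT (w k) @[k --> \oo] --> 0%E ->
  exists2 sigma : nat -> nat, (forall k, (k <= sigma k)%N) &
    {ae mu, forall x, w (sigma k) x @[k --> \oo] --> (0 : R)}.
Proof.
move=> mw w0 ew; have [K K0 HK] := poincare_full.
have iw : (\int[mu]_x (`|w k x| `^ p)%:E)%E @[k --> \oo] --> 0%E.
  apply: (@cvge0_leZ _ _ _ _ K _ (fun k => energyT (w k))) => [k|k|k|].
  - by apply: integral_ge0 => x _; rewrite lee_fin powR_ge0.
  - exact: energy_ge0.
  - exact: (HK _ (mw k) (w0 k)).
  - exact: ew.
have [||sigma sn H] := @cvg_integral0_subseq_ae _ _ _ mu (fun k x => (`|w k x| `^ p)%:E) _ _ iw.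
- by move=> k; apply/measurable_EFinP; exact: measurable_normr_powR.
- by move=> k x; rewrite lee_fin powR_ge0.
exists sigma => //; apply: filterS H => x /fine_cvg /= wx.
by apply: (iffRL (cvg_normr_powR0 p hp _ _)) wx.
Qed.

(** If the test functions phi k approximate v, then so do sqrt(phi k^2 + e^2) - e
    the function |v|, with e = 1 / (k + 1): as t -> sqrt(t^2 + e^2) is
    1-Lipschitz, their differences from |v| have increments bounded by those of
    2 v and of v - phi k, and along a subsequence they tend to 0 almost
    everywhere. *)
Lemma sobolev0_abs v : S v -> S (fun x => `|v x|).
Proof.
move=> Sv; have [mv v0 [phi [tphi phiv]]] := iffLR (sobolev0TP v) Sv.
have mphi k := (test_function_supp _ (tphi k)).1.
have mw k : measurable_fun setT (fun x => v x - phi k x) by exact: measurable_funB.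
have w0 k x : ~ Omega x -> v x - phi k x = 0.
  by move=> nO; rewrite v0// (test_function_supp _ (tphi k)).2// subrr.
have [sigma sn aes] := cvg_energy_subseq_ae (fun k x => v x - phi k x) mw w0 phiv.
have mav : measurable_fun setT (fun x => `|v x|) by exact: measurableT_comp.
apply/sobolev0TP; split; [exact: mav|by move=> x nO; rewrite v0// normr0|].
pose e k : R := k.+1%:R^-1.
have e0 k : 0 < e k by rewrite invr_gt0 ltr0n.
pose h k x := soft_abs (e k) (phi (sigma k) x).
have th k : test_function Omega (h k) by exact: test_function_soft_abs.
have mh k := (test_function_supp _ (th k)).1.
exists h; split; first exact: th.
pose w k x := v x - phi (sigma k) x.
have mws k : measurable_fun setT (w k) by exact: mw.
have ews : energyT (w k) @[k --> \oo] --> 0%E.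
  exact: (cvg_sigma (fun k => energyT (fun x => v x - phi k x)) _ _ sn phiv).
have E0 : energyT (fun _ => 0) = 0%E.
  rewrite /energy integral0_eq// => z _.
  by rewrite /density subrr normr0 powR0// mul0r.
apply: (@energy_dominated R N p hp s _ w (fun _ => 0) (fun x => 2 * v x)).
- by move=> k; exact: measurable_funB.
- exact: mws.
- exact: measurable_cst.
- exact: measurable_funM.
- move=> k x y.
  have -> : (`|v x| - h k x) - (`|v y| - h k y) =
      (`|v x| - `|v y|) - (h k x - h k y) by ring.
  apply: le_trans (ler_normB _ _) _.
  have H1 := ler_dist_dist (v x) (v y).
  have H2 := soft_abs_lip (e k) (phi (sigma k) x) (phi (sigma k) y) (e0 k).
  have H3 := ler_normB (v x - v y) (w k x - w k y).
  have H4 : (v x - v y) - (w k x - w k y) = phi (sigma k) x - phi (sigma k) y.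
    by rewrite /w; ring.
  rewrite H4 in H3; rewrite -mulrBr normrM (@ger0_norm _ 2)//.
  rewrite -/(h k x) -/(h k y) in H2.
  lra.
- apply: filterS aes => x wx.
  apply: (@cvg0_norm_le R _ (fun k => `|w k x| + e k)) => [k|].
    have A := soft_abs_approx (e k) (phi (sigma k) x) (e0 k).
    have B := ler_dist_dist (v x) (phi (sigma k) x).
    rewrite -/(h k x) in A; rewrite -/(w k x) in B.
    have -> : `|v x| - h k x = (`|v x| - `|phi (sigma k) x|) - (h k x - `|phi (sigma k) x|) by ring.
    apply: le_trans (ler_normB _ _) _; lra.
  rewrite -[X in _ --> X](addr0 (0 : R)); apply: cvgD.
    by rewrite -(normr0 R); apply: cvg_norm.
  exact: cvg_harmonic.
- exact: aes.
- by rewrite E0; exact: ews.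
- by rewrite E0 ltry.
- rewrite (energyZ s p mu setT v 2 measurableT mv).
  by apply: lte_mul_pinfty; rewrite ?lee_fin ?powR_ge0 ?sobolev0_energy_lty.
Qed.

Lemma sobolev0_max u v : S u -> S v -> S (fun x => Num.max (u x) (v x)).
Proof.
move=> Su Sv; have := sobolev0Z 2^-1 _ (sobolev0D _ _ (sobolev0D _ _ Su Sv) (sobolev0_abs _ (sobolev0B _ _ Su Sv))).
by congr (S _); apply/funext => x; rewrite maxr_absE mulrC.
Qed.

Lemma sobolev0_min u v : S u -> S v -> S (fun x => Num.min (u x) (v x)).
Proof.
move=> Su Sv; have := sobolev0Z 2^-1 _ (sobolev0B _ _ (sobolev0D _ _ Su Sv) (sobolev0_abs _ (sobolev0B _ _ Su Sv))).
by congr (S _); apply/funext => x; rewrite minr_absE mulrC.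
Qed.

(** After division by its L^p norm, v is admissible; the inequality is trivial
    if that norm is 0. *)
Lemma rayleigh u : (forall v, admissible s p Omega setT v -> (energyT u <= energyT v)%E) ->
  forall v, S v -> {ae mu, forall x, 0 <= v x} ->
  (energyT u * \int[mu]_x (`|v x| `^ p)%:E <= energyT v)%E.
Proof.
move=> Hu v Sv v0.
have i0 : (0 <= \int[mu]_x (`|v x| `^ p)%:E)%E.
  by apply: integral_ge0 => x _; rewrite lee_fin powR_ge0.
have := sobolev0_powR_lty v Sv; move: i0.
case E : (\int[mu]_x (`|v x| `^ p)%:E)%E => [m| |]//; rewrite lee_fin.
rewrite le_eqVlt => /predU1P[<- _|m0 _]; first by rewrite mule0 energy_ge0.
pose a := m `^ (- p^-1).
have a0 : 0 < a by rewrite powR_gt0.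
have apE : `|a| `^ p = m^-1.
  by rewrite ger0_norm ?ltW// /a -powRrM mulNr mulVf// powR_inv1// ltW.
have mv := sobolev0_measurable _ Sv.
have adm : admissible s p Omega setT (fun x => a * v x).
  split; first exact: sobolev0Z.
    apply/Lnorm1_integral => //.
      by move=> x nO; rewrite (sobolev0_supp _ Sv)// mulr0.
    rewrite (_ : (fun x => _) = fun x => ((`|a| `^ p)%:E * (`|v x| `^ p)%:E)%E); last first.
      by apply/funext => x; rewrite normrM powRM.
    rewrite ge0_integralZl_EFin ?powR_ge0//; last first.
      by apply/measurable_EFinP; exact: measurable_normr_powR.
    by rewrite E apE -EFinM mulVf// gt_eqF.
  rewrite leb.unlock in v0; apply: filterS v0 => x vx; by rewrite mulr_ge0// ltW.
have := Hu _ adm; rewrite energyZ// apE muleC.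
by rewrite lee_pdivlMr.
Qed.

(** * Comparison of two functions by their maximum and minimum *)

Definition excess v u (z : 'rV[R]_N * 'rV[R]_N) : R :=
  deficit p (v z.1) (v z.2) (u z.1) (u z.2) * sing_kernel s p z.

Lemma excess_ge0 v u z : 0 <= excess v u z.
Proof. by rewrite mulr_ge0 ?sing_kernel_ge0//; exact: deficit_ge0. Qed.

Lemma excessE v u z : density s p v z + density s p u z =
  density s p (fun x => Num.max (v x) (u x)) z +
  density s p (fun x => Num.min (v x) (u x)) z + excess v u z.
Proof. by rewrite /excess /deficit /density; ring. Qed.

Lemma measurable_excess v u : measurable_fun setT v -> measurable_fun setT u ->
  measurable_fun setT (excess v u).
Proof.
move=> mv mu_.
have -> : excess v u = (fun z => density s p v z + density s p u z -
    density s p (fun x => Num.max (v x) (u x)) z - density s p (fun x => Num.min (v x) (u x)) z).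
  by apply/funext => z; rewrite excessE; ring.
apply: measurable_funB; [apply: measurable_funB|].
- by apply: measurable_funD; exact: measurable_density.
- by apply: measurable_density; exact: measurable_maxr.
- by apply: measurable_density; exact: measurable_minr.
Qed.

Lemma energy_max_min v u : measurable_fun setT v -> measurable_fun setT u ->
  (energyT v + energyT u = energyT (fun x => Num.max (v x) (u x)) +
    energyT (fun x => Num.min (v x) (u x)) +
    \int[(mu \x mu)]_z (excess v u z)%:E)%E.
Proof.
move=> mv mu_.
have mM : measurable_fun setT (fun x => Num.max (v x) (u x)) by exact: measurable_maxr.
have mm : measurable_fun setT (fun x => Num.min (v x) (u x)) by exact: measurable_minr.
have d0 (w : 'rV[R]_N -> R) z : setT z -> (0 <= (density s p w z)%:E)%E.
  by move=> _; rewrite lee_fin density_ge0.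
have md (w : 'rV[R]_N -> R) (mw : measurable_fun setT w) := measurable_density_EFin s p setT w mw.
pose F (w : 'rV[R]_N -> R) z := (density s p w z)%:E.
have e0 z : setT z -> (0 <= (excess v u z)%:E)%E by rewrite lee_fin excess_ge0.
have me : measurable_fun setT (fun z => (excess v u z)%:E).
  by apply/measurable_EFinP; exact: measurable_excess.
rewrite /energy setXTT.
rewrite -(ge0_integralD (mu \x mu)%E measurableT (d0 v) (md _ mv) (d0 u) (md _ mu_)).
rewrite -(ge0_integralD (mu \x mu)%E measurableT (d0 _) (md _ mM) (d0 _) (md _ mm)).
have s0 z : setT z -> (0 <= (density s p (fun x => Num.max (v x) (u x)) z)%:E +
    (density s p (fun x => Num.min (v x) (u x)) z)%:E)%E.
  by move=> _; rewrite adde_ge0// lee_fin density_ge0.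
rewrite -(ge0_integralD (mu \x mu)%E measurableT s0 (emeasurable_funD (md _ mM) (md _ mm)) e0 me).
by apply: eq_integral => z _; rewrite -!EFinD excessE.
Qed.

Lemma integral_max_min v u : measurable_fun setT v -> measurable_fun setT u ->
  (\int[mu]_x (`|v x| `^ p)%:E + \int[mu]_x (`|u x| `^ p)%:E =
   \int[mu]_x (`|Num.max (v x) (u x)| `^ p)%:E +
   \int[mu]_x (`|Num.min (v x) (u x)| `^ p)%:E)%E.
Proof.
move=> mv mu_.
have m (w : 'rV[R]_N -> R) : measurable_fun setT w -> measurable_fun setT (fun x => (`|w x| `^ p)%:E).
  by move=> mw; exact/measurable_EFinP/measurable_normr_powR.
have w0 (w : 'rV[R]_N -> R) (x : 'rV[R]_N) : setT x -> (0 <= (`|w x| `^ p)%:E)%E.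
  by move=> _; rewrite lee_fin powR_ge0.
have mM := m _ (measurable_maxr mv mu_); have mm := m _ (measurable_minr mv mu_).
rewrite -(ge0_integralD mu measurableT (w0 v) (m _ mv) (w0 u) (m _ mu_)).
rewrite -(ge0_integralD mu measurableT (w0 (fun x => Num.max (v x) (u x))) mM
  (w0 (fun x => Num.min (v x) (u x))) mm).
apply: eq_integral => x _; rewrite -!EFinD; congr (_%:E).
by have [_|_] := leP (v x) (u x); rewrite 1?addrC.
Qed.

(** The Rayleigh inequality for the maximum and the minimum, whose p-th powers
    have integrals adding up to 2, gives 2 E(u) <= E(max) + E(min). *)
Lemma excess_le u v tau : (forall w, adm w -> (energyT u <= energyT w)%E) ->
  adm u -> adm v -> (energyT v <= energyT u + tau%:E)%E ->
  (\int[(mu \x mu)]_z (excess v u z)%:E <= tau%:E)%E.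
Proof.
move=> umin au av Evu.
have Su : S u by case: au. have Sv : S v by case: av.
have [mu_ _ iu] := admissible_integral u au.
have [mv _ iv] := admissible_integral v av.
have u0 : {ae mu, forall x, 0 <= u x} by rewrite leb.unlock; case: au.
have v0 : {ae mu, forall x, 0 <= v x} by rewrite leb.unlock; case: av.
pose M x := Num.max (v x) (u x); pose m x := Num.min (v x) (u x).
have SM : S M by exact: (sobolev0_max v u Sv Su).
have Sm : S m by exact: (sobolev0_min v u Sv Su).
have M0 : {ae mu, forall x, 0 <= M x}.
  by apply: filterS2 u0 v0 => x ux vx; rewrite /M le_max vx.
have m0 : {ae mu, forall x, 0 <= m x}.
  by apply: filterS2 u0 v0 => x ux vx; rewrite /m le_min vx ux.
have RM := rayleigh u umin M SM M0.
have Rm := rayleigh u umin m Sm m0.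
have Efin w : S w -> exists2 r : R, 0 <= r & energyT w = r%:E.
  move=> Sw; apply: ge0_lty_EFin; first exact: energy_ge0.
  exact: (sobolev0_energy_lty).
have Ifin w : S w -> exists2 r : R, 0 <= r & (\int[mu]_x (`|w x| `^ p)%:E)%E = r%:E.
  move=> Sw; apply: ge0_lty_EFin.
    by apply: integral_ge0 => x _; rewrite lee_fin powR_ge0.
  exact: (sobolev0_powR_lty).
have := energy_max_min v u mv mu_; have := integral_max_min v u mv mu_.
rewrite iu iv -/M -/m.
have [iM iM0 EiM] := Ifin _ SM; have [im im0 Eim] := Ifin _ Sm.
have [eM eM0 EeM] := Efin _ SM; have [em em0 Eem] := Efin _ Sm.
have [eu eu0 Eeu] := Efin _ Su; have [ev ev0 Eev] := Efin _ Sv.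
rewrite EiM in RM; rewrite Eim in Rm.
rewrite Eeu EeM in RM; rewrite Eeu Eem in Rm.
rewrite Eeu Eev -EFinD lee_fin in Evu.
rewrite -!EFinM !lee_fin in RM Rm.
rewrite [in X in X -> _]EiM [in X in X -> _]Eim Eeu Eev EeM Eem -!EFinD => -[i2].
case: (\int[(mu \x mu)]_z (excess v u z)%:E)%E => [r| |]//; rewrite -?EFinD => -[H].
rewrite lee_fin; nra.
Qed.

(** * Convergence of the eigenfunctions *)

Definition above v u (eta : R) : set 'rV[R]_N :=
  [set x | `|u x| `^ p + eta < `|v x| `^ p].

Lemma measurable_above v u eta : measurable_fun setT v -> measurable_fun setT u ->
  measurable (above v u eta).
Proof.
move=> mv mu_; rewrite -[X in measurable X]setTI.
apply: measurable_fun_ltr => //.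
  by apply: measurable_funD => //; exact: measurable_normr_powR.
exact: measurable_normr_powR.
Qed.

Lemma above_sub v u eta : 0 <= eta -> (forall x, ~ Omega x -> v x = 0) ->
  above v u eta `<=` Omega.
Proof.
move=> eta0 v0 x; rewrite /above /=; apply: contraPP => nO; apply/negP; rewrite -leNgt.
by rewrite v0// normr0 powR0// addr_ge0// powR_ge0.
Qed.

(** At almost every (x, y) off the diagonal, membership of (x, y) in the product
    of the two sets bounds the excess from below by a constant that does not
    depend on k; so (x, y) eventually leaves it. *)
Lemma above_prod_cvg0 (v : nat -> 'rV[R]_N -> R) u (eta : R) : 0 < eta ->
  (forall k, measurable_fun setT (v k)) -> measurable_fun setT u ->
  (forall k x, ~ Omega x -> v k x = 0) -> (forall x, ~ Omega x -> u x = 0) ->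
  (forall k, {ae mu, forall x, 0 <= v k x}) -> {ae mu, forall x, 0 <= u x} ->
  {ae (mu \x mu)%E, forall z, (excess (v k) u z)%:E @[k --> \oo] --> 0%E} ->
  (mu (above (v k) u eta) * mu (above u (v k) eta))%E @[k --> \oo] --> 0%E.
Proof.
move=> eta0 mv mu_ v0 u0 vge uge ex0.
pose B k := above (v k) u eta `*` above u (v k) eta.
have mB k : measurable (B k) by apply: measurableX; exact: measurable_above.
have mO : measurable Omega by exact: measurable_Omega.
have BO k : B k `<=` Omega `*` Omega.
  by move=> z [z1 z2]; split; [exact: (above_sub _ _ _ (ltW eta0) (v0 k)) z1|
    exact: (above_sub _ _ _ (ltW eta0) u0) z2].
have OO : measurable (Omega `*` Omega) by exact: measurableX.
have -> : (fun k => (mu (above (v k) u eta) * mu (above u (v k) eta))%E) =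
    (fun k => \int[(mu \x mu)]_z (\1_(B k) z)%:E)%E.
  apply/funext => k; rewrite integral_indic// setIT.
  have := product_measure1E mu mu (measurable_above _ _ eta (mv k) mu_)
    (measurable_above _ _ eta mu_ (mv k)).
  by move=> H; exact: esym H.
have vae : {ae mu, forall x, (forall k, 0 <= v k x) /\ 0 <= u x}.
  by apply: filterS2 (ae_foralln vge) uge => x; split.
apply: (@pratt _ _ _ (mu \x mu)%E (fun k => \1_(B k)) (fun _ => \1_(Omega `*` Omega)) (\1_(Omega `*` Omega))).
- by move=> k; exact: measurable_indic.
- by move=> k; exact: measurable_indic.
- exact: measurable_indic.
- move=> k z; rewrite !indicE ler0n/= ler_nat.
  by have [/set_mem/BO/mem_set->|] := boolP (z \in B k).
- by move=> z; rewrite indicE.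
- have := ae_prod _ _ mu _ vae; apply: filterS2 ex0 => z ez [[v1 u1] [v2 u2]].
  have [zz|zz] := eqVneq z.1 z.2.
    rewrite (_ : (fun n => _) = fun=> 0); first exact: cvg_cst.
    apply/funext => k; rewrite indicE memNset// /B /above => -[/=]; rewrite zz.
    lra.
  have [d d0 Hd] := deficit_gap p hp (u z.1) (u z.2) eta u1 u2 eta0.
  have K0 : 0 < sing_kernel s p z.
    by rewrite powR_gt0// lt_neqAle enorm_ge0 andbT eq_sym enorm_eq0 subr_eq0.
  have e0 : 0 < d * sing_kernel s p z / 2 by rewrite divr_gt0// mulr_gt0.
  have/cvge0P := ez => /(_ (fun k => _))/(_ _ e0) H.
  apply/cvgrPdist_le => e epos; apply: filterS (H _) => [k ek|k]; last first.
    by rewrite lee_fin excess_ge0.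
  rewrite indicE memNset ?subrr ?normr0 ?(ltW epos)// => -[/= z1 z2].
  have := Hd (v k z.1) (v k z.2) (v1 k) (v2 k) (ltW z1) (ltW z2).
  rewrite -(ler_pM2r K0) => H1.
  rewrite lee_fin /excess in ek.
  have : 0 < d * sing_kernel s p z by rewrite mulr_gt0.
  lra.
- by apply: aeW => z; exact: cvg_cst.
- exact: cvg_cst.
- rewrite integral_indic// setIT.
  have := product_measure1E mu mu mO mO.
  move=> H; rewrite [X in (X < _)%E]H; apply: lte_mul_pinfty => //; last exact: (mu_Omega_lty).
  by rewrite ge0_fin_numE//; exact: (mu_Omega_lty).
Qed.

(** In the estimate of [equi_integrable], choose first delta to make the energy
    term at most half of eps, then kappa for the term with the measure of A. *)
Lemma small_set_integral (E eps : R) : 0 <= E -> 0 < eps ->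
  exists2 kappa : R, 0 < kappa & forall w A, measurable_fun setT w -> measurable A ->
    (energyT w <= E%:E)%E -> (\int[mu]_x (`|w x| `^ p)%:E = 1)%E ->
    (mu A <= kappa%:E)%E -> (\int[mu]_(x in A) (`|w x| `^ p)%:E <= eps%:E)%E.
Proof.
move=> E0 eps0.
pose C : R := 2 `^ p * (N%:R / 2) ^+ N.
have N0 : 0 < N%:R :> R by rewrite ltr0n.
have C0 : 0 < C by rewrite mulr_gt0 ?powR_gt0// exprn_gt0// divr_gt0.
pose delta := (eps / (2 * C * (E + 1))) `^ (s * p)^-1.
have E10 : 0 < E + 1 by rewrite ltr_wpDl.
have dd : 0 < eps / (2 * C * (E + 1)) by apply: divr_gt0 => //; apply: mulr_gt0 => //; exact: mulr_gt0.
have delta0 : 0 < delta by exact: powR_gt0.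
have deltaE : delta `^ (s * p) = eps / (2 * C * (E + 1)).
  by rewrite -powRrM mulVf ?gt_eqF// powRr1// ltW.
have dN0 : 0 < delta ^+ N by rewrite exprn_gt0.
exists (eps * delta ^+ N / (2 * C)); first by apply: divr_gt0; apply: mulr_gt0.
move=> w A mw mA wE w1 muA.
have := @equi_integrable R N hN p hp s hs0 delta w A delta0 mw mA.
rewrite w1 mule1 => H.
have G0 : 0 < (2 * (delta / N%:R)) ^+ N by rewrite exprn_gt0// mulr_gt0// divr_gt0.
rewrite -(@lee_pmul2l _ ((2 * (delta / N%:R)) ^+ N)%:E)//.
apply: le_trans H _.
apply: (@le_trans _ _ ((2 `^ p)%:E * ((delta `^ (N%:R + s * p))%:E * E%:E +
    (eps * delta ^+ N / (2 * C))%:E))%E).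
  rewrite lee_wpmul2l ?lee_fin ?powR_ge0//; apply: leeD muA.
  by rewrite lee_wpmul2l ?lee_fin ?powR_ge0.
rewrite -[(_%:E * E%:E)%E]EFinM -EFinD -!EFinM lee_fin.
rewrite powRD ?(gt_eqF delta0) ?implybT// powR_mulrn ?(ltW delta0)// deltaE.
have -> : (2 * (delta / N%:R)) ^+ N = 2 `^ p * delta ^+ N / C.
  rewrite /C !exprMn !exprVn; field.
  by rewrite ?expf_neq0 ?gt_eqF ?powR_gt0.
have -> : 2 `^ p * delta ^+ N / C * eps = 2 `^ p * (delta ^+ N * (C^-1 * eps)) by ring.
rewrite ler_wpM2l ?powR_ge0//.
have -> : delta ^+ N * (eps / (2 * C * (E + 1))) * E + eps * delta ^+ N / (2 * C)
   = delta ^+ N * (C^-1 * eps) * ((E / (E + 1) + 1) / 2).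
  by field; rewrite ?gt_eqF.
rewrite ler_piMr//; first by rewrite mulr_ge0 ?(ltW dN0)// mulr_ge0 ?invr_ge0 ?(ltW C0) ?(ltW eps0).
rewrite ler_pdivrMr// mul1r -[leRHS](addrC 1) .
have : E / (E + 1) <= 1 by rewrite ler_pdivrMr// mul1r lerDl.
lra.
Qed.

(** On Omega, max(|v|^p, |u|^p) exceeds |u|^p by at most eta outside the set
    where |v|^p > |u|^p + eta, and it is at most |u|^p + |v|^p on this set. *)
Lemma integral_max_le v u eta : 0 <= eta -> measurable_fun setT v -> measurable_fun setT u ->
  (forall x, ~ Omega x -> v x = 0) -> (forall x, ~ Omega x -> u x = 0) ->
  (\int[mu]_x (Num.max (`|v x| `^ p) (`|u x| `^ p))%:E <=
   \int[mu]_x (`|u x| `^ p)%:E + (eta%:E * mu Omega +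
   \int[mu]_(x in above v u eta) (`|v x| `^ p)%:E))%E.
Proof.
move=> eta0 mv mu_ v0 u0.
have mO : measurable Omega by exact: measurable_Omega.
have m (w : 'rV[R]_N -> R) : measurable_fun setT w -> measurable_fun setT (fun x => (`|w x| `^ p)%:E).
  by move=> mw; exact/measurable_EFinP/measurable_normr_powR.
have w0 (w : 'rV[R]_N -> R) (x : 'rV[R]_N) : setT x -> (0 <= (`|w x| `^ p)%:E)%E.
  by move=> _; rewrite lee_fin powR_ge0.
have mA := measurable_above v u eta mv mu_.
pose f1 (x : 'rV[R]_N) : \bar R := (eta * \1_Omega x)%:E.
have f10 x : setT x -> (0 <= f1 x)%E by move=> _; rewrite lee_fin mulr_ge0// indicE.
have mf1 : measurable_fun setT f1.
  by apply/measurable_EFinP; apply: measurable_funM => //; exact: measurable_indic.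
pose f2 := ((fun x => (`|v x| `^ p)%:E) \_ (above v u eta)).
have f20 x : setT x -> (0 <= f2 x)%E.
  by move=> _; rewrite /f2 patchE; case: ifP => // _; rewrite lee_fin powR_ge0.
have mf2 : measurable_fun setT f2.
  by apply/(measurable_restrictT _ mA); apply: measurable_funTS; exact: m.
have -> : (eta%:E * mu Omega = \int[mu]_x f1 x)%E.
  rewrite -[in LHS](setIT Omega) -integral_indic// -ge0_integralZl_EFin//.
  by apply/measurable_EFinP; exact: measurable_indic.
rewrite [X in (_ + (_ + X))%E]integral_mkcond -/f2.
rewrite -(ge0_integralD mu measurableT f10 mf1 f20 mf2).
have f120 x : setT x -> (0 <= f1 x + f2 x)%E by move=> _; rewrite adde_ge0 ?f10 ?f20.
rewrite -(ge0_integralD mu measurableT (w0 u) (m _ mu_) f120 (emeasurable_funD mf1 mf2)).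
apply: ge0_le_integral => //.
- apply/measurable_EFinP; apply: measurable_maxr; exact: measurable_normr_powR.
- by apply: emeasurable_funD; [exact: m|exact: emeasurable_funD].
move=> x _; rewrite /f1 /f2 patchE.
have [Ox|nOx] := pselect (Omega x); last first.
  rewrite memNset; last by move/(above_sub v u eta eta0 v0).
  rewrite v0// u0// !normr0 powR0// maxxx adde0 -EFinD lee_fin add0r.
  by rewrite mulr_ge0// indicE.
rewrite indicE mem_set// mulr1; case: ifPn => [_|/negP nA].
  rewrite -!EFinD lee_fin ge_max; have := powR_ge0 `|v x| p; have := powR_ge0 `|u x| p.
  by move=> *; apply/andP; split; lra.
rewrite adde0 -EFinD lee_fin ge_max; apply/andP; split; last by lra.
rewrite leNgt; apply/negP => H; apply: nA; exact/mem_set.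
Qed.

(** Since both p-th powers have integral 1, the integral of their distance is
    2 (int max - 1), and the maximum can be estimated with either of the two
    sets, of which one has small measure. *)
Lemma powR_dist_cvg0 (v : nat -> 'rV[R]_N -> R) u (E : R) : 0 <= E ->
  (forall k, measurable_fun setT (v k)) -> measurable_fun setT u ->
  (forall k x, ~ Omega x -> v k x = 0) -> (forall x, ~ Omega x -> u x = 0) ->
  (forall k, \int[mu]_x (`|v k x| `^ p)%:E = 1)%E -> (\int[mu]_x (`|u x| `^ p)%:E = 1)%E ->
  (forall k, energyT (v k) <= E%:E)%E -> (energyT u <= E%:E)%E ->
  (forall eta : R, 0 < eta ->
    (mu (above (v k) u eta) * mu (above u (v k) eta))%E @[k --> \oo] --> 0%E) ->
  (\int[mu]_x (`| `|v k x| `^ p - `|u x| `^ p|)%:E)%E @[k --> \oo] --> 0%E.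
Proof.
move=> E0 mv mu_ v0 u0 iv iu vE uE H.
have [mO O0 mOE] := ge0_lty_EFin (mu Omega) (measure_ge0 _ _)
  (mu_Omega_lty).
apply/cvge0P => [k|e e0]; first by apply: integral_ge0 => x _; rewrite lee_fin.
pose e' := e / 4; have e'0 : 0 < e' by rewrite divr_gt0.
have [kappa kappa0 small] := small_set_integral E e' E0 e'0.
pose eta := e' / (mO + 1); have mO1 : 0 < mO + 1 by rewrite ltr_wpDl.
have eta0 : 0 < eta by rewrite divr_gt0.
have etaO : (eta%:E * mu Omega <= e'%:E)%E.
  rewrite mOE -EFinM lee_fin /eta mulrAC ler_pdivrMr// ler_wpM2l ?(ltW e'0)//; lra.
(* If both sets had measure above kappa, the product would exceed kappa^2. *)
have kk : 0 < kappa * kappa by rewrite mulr_gt0.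
have/cvge0P := H _ eta0 => /(_ (fun k => mule_ge0 (measure_ge0 _ _) (measure_ge0 _ _)))/(_ _ kk).
apply: filterS => k Hk.
have maxle : (\int[mu]_x (Num.max (`|v k x| `^ p) (`|u x| `^ p))%:E <= (1 + (e' + e'))%:E)%E.
  have [A1|A1] := leP (mu (above (v k) u eta)) kappa%:E.
    apply: le_trans (integral_max_le (v k) u eta (ltW eta0) (mv k) mu_ (v0 k) u0) _.
    rewrite iu EFinD EFinD; apply: leeD => //; apply: leeD => //.
    exact: (small _ _ (mv k) (measurable_above _ _ eta (mv k) mu_) (vE k) (iv k) A1).
  have A2 : (mu (above u (v k) eta) <= kappa%:E)%E.
    rewrite leNgt; apply/negP => A2.
    have : (kappa%:E * kappa%:E < mu (above (v k) u eta) * mu (above u (v k) eta))%E.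
      by apply: lte_pmul => //; rewrite lee_fin ltW.
    by rewrite -EFinM ltNge Hk.
  under eq_integral do rewrite maxC.
  apply: le_trans (integral_max_le u (v k) eta (ltW eta0) mu_ (mv k) u0 (v0 k)) _.
  rewrite iv EFinD EFinD; apply: leeD => //; apply: leeD => //.
  exact: (small _ _ mu_ (measurable_above _ _ eta mu_ (mv k)) uE iu A2).
pose f x := `| `|v k x| `^ p - `|u x| `^ p|.
have m (w : 'rV[R]_N -> R) : measurable_fun setT w -> measurable_fun setT (fun x => `|w x| `^ p).
  by move=> mw; exact/measurable_normr_powR.
have mF := m _ (mv k); have mG := m _ mu_.
have F0 (w : 'rV[R]_N -> R) (x : 'rV[R]_N) : setT x -> (0 <= (`|w x| `^ p)%:E)%E.
  by move=> _; rewrite lee_fin powR_ge0.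
have f0 (x : 'rV[R]_N) : setT x -> (0 <= (f x)%:E)%E.
  by move=> _; rewrite lee_fin /f normr_ge0.
have mf : measurable_fun setT (fun x => (f x)%:E).
  by apply/measurable_EFinP; apply: measurableT_comp => //; exact: measurable_funB.
have sum : (\int[mu]_x (f x)%:E + (1 + 1) =
    2%:E * \int[mu]_x (Num.max (`|v k x| `^ p) (`|u x| `^ p))%:E)%E.
  rewrite -{1}(iv k) -iu.
  have mFE := iffRL (measurable_EFinP _ _) mF; have mGE := iffRL (measurable_EFinP _ _) mG.
  rewrite -(ge0_integralD mu measurableT (F0 (v k)) mFE (F0 u) mGE).
  have FG0 x : setT x -> (0 <= (`|v k x| `^ p)%:E + (`|u x| `^ p)%:E)%E.
    by move=> _; rewrite adde_ge0// F0.
  rewrite -(ge0_integralD mu measurableT f0 mf FG0 (emeasurable_funD mFE mGE)).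
  rewrite -ge0_integralZl_EFin//.
    apply: eq_integral => x _; rewrite -!EFinD -EFinM; congr (_%:E).
    by rewrite /f maxr_absE; field.
  by apply/measurable_EFinP; exact: measurable_maxr.
have : (\int[mu]_x (f x)%:E + (1 + 1) <= 2%:E * (1 + (e' + e'))%:E)%E.
  by rewrite sum lee_wpmul2l// lee_fin.
change (\int[mu]_x (f x)%:E + (1 + 1) <= 2%:E * (1 + (e' + e'))%:E ->
  \int[mu]_x (f x)%:E <= e%:E)%E.
case: (\int[mu]_x (f x)%:E)%E => [r| |]//; last by move=> _; exact: leNye.
rewrite -EFinM -!EFinD !lee_fin /e'; lra.
Qed.

(** The Rayleigh bound makes the excess converge to 0, and this forces almost
    everywhere convergence along a subsequence; as the energies also converge,
    so does the energy of the difference. *)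
Lemma minimizing_subseq (v : nat -> 'rV[R]_N -> R) u (tau : nat -> R) (T : R) :
  (forall w, adm w -> (energyT u <= energyT w)%E) -> adm u -> (forall k, adm (v k)) ->
  (forall k, 0 <= tau k <= T) ->
  (forall k, energyT (v k) <= energyT u + (tau k)%:E)%E -> tau k @[k --> \oo] --> (0 : R) ->
  exists2 sigma : nat -> nat, (forall k, (k <= sigma k)%N) &
    energyT (fun x => v (sigma k) x - u x) @[k --> \oo] --> 0%E.
Proof.
move=> umin au av tauT Ev tau_0.
have tau0 k : 0 <= tau k by case/andP: (tauT k).
have HT k : tau k <= T by case/andP: (tauT k).
have T0 : 0 <= T := le_trans (tau0 0%N) (HT 0%N).
have Sa w : adm w -> S w by case.
have mw w (aw : adm w) := sobolev0_measurable w (Sa _ aw).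
have w0 w (aw : adm w) := sobolev0_supp w (Sa _ aw).
have iw w : adm w -> (\int[mu]_x (`|w x| `^ p)%:E = 1)%E.
  by move=> /(admissible_integral)[].
have gew w : adm w -> {ae mu, forall x, 0 <= w x} by rewrite leb.unlock; case.
have [Eu Eu0 EuE] := ge0_lty_EFin _ (energy_ge0 s p mu setT u)
  (sobolev0_energy_lty u (Sa _ au)).
have iex : (\int[(mu \x mu)]_z (excess (v k) u z)%:E)%E @[k --> \oo] --> 0%E.
  apply/cvge0P => [k|e e0]; first by apply: integral_ge0 => z _; rewrite lee_fin excess_ge0.
  move/cvgrPdist_le : tau_0 => /(_ _ e0); apply: filterS => k.
  rewrite sub0r normrN ger0_norm// => tk.
  apply: le_trans (excess_le u (v k) (tau k) umin au (av k) (Ev k)) _.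
  by rewrite lee_fin.
have [||sigma sn ex0] := @cvg_integral0_subseq_ae _ _ _ (mu \x mu)%E
    (fun k z => (excess (v k) u z)%:E) _ _ iex.
- move=> k; apply/measurable_EFinP; apply: measurable_excess; exact: mw.
- by move=> k z; rewrite lee_fin excess_ge0.
pose v1 k := v (sigma k).
have av1 k : adm (v1 k) by exact: av.
have tau1 := cvg_sigma tau 0 sigma sn tau_0.
have Ev1 k : (energyT (v1 k) <= energyT u + (tau (sigma k))%:E)%E by exact: Ev.
have dist0 : (\int[mu]_x (`| `|v1 k x| `^ p - `|u x| `^ p|)%:E)%E @[k --> \oo] --> 0%E.
  apply: (powR_dist_cvg0 v1 u (Eu + T)).
  - exact: addr_ge0.
  - by move=> k; exact: mw.
  - exact: mw.
  - by move=> k; exact: w0.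
  - exact: w0.
  - by move=> k; exact: iw.
  - exact: iw.
  - by move=> k; apply: le_trans (Ev1 k) _; rewrite EuE -EFinD lee_fin lerD2l.
  - by rewrite EuE lee_fin lerDl.
  move=> eta eta0; apply: (above_prod_cvg0 v1 u eta).
  - exact: eta0.
  - by move=> k; exact: mw.
  - exact: mw.
  - by move=> k; exact: w0.
  - exact: w0.
  - by move=> k; exact: gew.
  - exact: gew.
  - exact: ex0.
have [||rho rn cv] := @cvg_integral0_subseq_ae _ _ _ mu
    (fun k x => (`| `|v1 k x| `^ p - `|u x| `^ p|)%:E) _ _ dist0.
- move=> k; apply/measurable_EFinP; apply: measurableT_comp => //.
  by apply: measurable_funB; apply: measurable_normr_powR; exact: mw.
- by move=> k z; rewrite lee_fin.
exists (sigma \o rho) => [k|]; first exact: leq_trans (rn k) (sn _).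
pose v2 k := v1 (rho k).
have av2 k : adm (v2 k) by exact: av.
have vu0 : {ae mu, forall x, v2 k x - u x @[k --> \oo] --> (0 : R)}.
  apply: filterS3 (ae_foralln (fun k => gew _ (av2 k))) (gew _ au) cv => x v2x ux /fine_cvg /= H.
  apply: (iffRL (cvg_normr_powR0 p hp _ _)).
  by apply: (cvg0_norm_le _ _ _ H) => k; rewrite ger0_norm ?powR_ge0// distr_powR_le.
have tau2 := cvg_sigma (tau \o sigma) 0 rho rn tau1.
apply: (@energy_dominated R N p hp s (fun k x => v2 k x - u x) v2 u u).
- by move=> k; apply: measurable_funB; exact: mw.
- by move=> k; exact: mw.
- exact: mw.
- exact: mw.
- move=> k x y; have -> : v2 k x - u x - (v2 k y - u y) = v2 k x - v2 k y - (u x - u y) by ring.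
  exact: ler_normB.
- exact: vu0.
- apply: filterS vu0 => x H.
  rewrite (_ : (fun k => v2 k x) = fun k => (v2 k x - u x) + u x); last first.
    by apply/funext => k; rewrite subrK.
  by rewrite -[X in _ --> X]add0r; apply: cvgD => //; exact: cvg_cst.
- apply: (@squeeze_cvge _ _ _ _ (fun=> energyT u) _ (fun k => (energyT u + (tau (sigma (rho k)))%:E)%E)).
  + by apply: nearW => k; apply/andP; split; [exact: umin|exact: Ev].
  + exact: cvg_cst.
  + rewrite -[X in _ --> X]adde0; rewrite EuE; apply: cvgeD.
    * by [].
    * exact: cvg_cst.
    * by apply/cvg_EFin; [exact: nearW|exact: tau2].
- by rewrite EuE ltry.
- by rewrite EuE ltry.
Qed.

Lemma eigenfunction_energy_le (u : 'rV[R]_N -> R) : first_eigenfunction s p Omega setT u ->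
  adm u /\ forall w, adm w -> (energyT u <= energyT w)%E.
Proof.
have Eg w : adm w -> (gagliardo s p setT w `^ p)%E = energyT w.
  by move=> /(admissible_integral)[mw _ _]; exact: gagliardo_powR.
move=> [au Hu]; split; first exact: au.
by move=> w aw; rewrite -(Eg u au) -(Eg w aw); exact: Hu.
Qed.

(** E(v) <= E_B(v) + tail <= E_B(u) + tail <= E(u) + tail, by minimality of v
    on the ball B. *)
Lemma local_eigenfunction_energy_le : exists2 C : R, 0 <= C & forall u v t, 1 < t ->
  first_eigenfunction s p Omega setT u ->
  first_eigenfunction s p Omega (eball c (t * Rad)) v ->
  adm v /\ (energyT v <= energyT u + (C * ((t - 1) * Rad) `^ (- (s * p)))%:E)%E.
Proof.
have [C C0 HC] := tail_bound.
exists (2 * C); first exact: mulr_ge0.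
move=> u v t t1 [au _] [av Hv].
rewrite (admissible_eball t t1) in av Hv.
split=> //.
have mB : measurable (eball c (t * Rad)) by exact: measurable_eball.
have [mu_ u0 iu] := admissible_integral u au.
have [mv v0 iv] := admissible_integral v av.
have OB := Omega_sub_eball t t1.
have := energy_tail s p mu Omega _ _ v _ p0 mB measurableT (@subsetT _ _) OB mv v0
  (fun x Ox => HC t setT t1 measurableT x Ox).
rewrite iv mule1 mulrA => H; apply: le_trans H _.
have H : (energy (eball c (t * Rad)) v <= energy (eball c (t * Rad)) u)%E.
  by rewrite -(gagliardo_powR s p _ _ np0 mB mv) -(gagliardo_powR s p _ _ np0 mB mu_); exact: Hv.
apply: leeD; last exact: lexx.
by apply: le_trans H _; exact: (energy_le s p mu _ _ u mB measurableT mu_ (@subsetT _ _)).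
Qed.

(** A failure of convergence would give a sequence t_n >= n + 2 along which the
    energy of v (t_n) - u stays above some e > 0, which [minimizing_subseq]
    excludes. *)
Lemma eigenfunction_cvg (u : 'rV[R]_N -> R) (v : R -> 'rV[R]_N -> R) :
  first_eigenfunction s p Omega setT u ->
  (forall t, 1 < t -> first_eigenfunction s p Omega (eball c (t * Rad)) (v t)) ->
  gagliardo s p setT (fun x => v t x - u x) @[t --> +oo] --> 0%E.
Proof.
move=> eu ev; have [C C0 HC] := local_eigenfunction_energy_le.
have [au umin] := eigenfunction_energy_le u eu.
have Rad0 := Rad_gt0.
have av t (t1 : 1 < t) : adm (v t) := (HC u (v t) t t1 eu (ev t t1)).1.
have mw w : adm w -> measurable_fun setT w by move=> /(admissible_integral)[].
pose w t x := if 1 < t then v t x - u x else 0.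
have mwt t : measurable_fun setT (w t).
  have [t1|t1] := boolP (1 < t); rewrite /w ?t1 ?(negbTE t1); last exact: measurable_cst.
  by apply: measurable_funB; apply: mw => //; exact: av.
suff : gagliardo s p setT (w t) @[t --> +oo] --> 0%E.
  move=> H; apply: cvg_trans H; apply: near_eq_cvg; near=> t.
  have t1 : 1 < t by near: t; apply: nbhs_pinfty_gt; exact: num_real.
  by congr gagliardo; apply/funext => x; rewrite /w t1.
apply: (iffRL (@gagliardo_cvg0P _ _ s p _ _ _ setT w p0 measurableT mwt)).
apply/cvge0P => [t|e e0]; first exact: energy_ge0.
apply: contrapT => nH.
have /choice[t_ tP] (n : nat) : exists t, n%:R + 2 <= t /\ ~ (energyT (w t) <= e%:E)%E.
  apply: contrapT => H; apply: nH; near=> t.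
  have tn : n%:R + 2 <= t by near: t; apply: nbhs_pinfty_ge; exact: num_real.
  by apply: contrapT => H'; apply: H; exists t.
have n0 n : 0 <= n%:R :> R by exact: ler0n.
have t1 n : 1 < t_ n by have := (tP n).1; have := n0 n; lra.
have too : t_ n @[n --> \oo] --> +oo.
  apply/cvgryPge => A; near=> n; apply: le_trans (tP n).1.
  have : A <= n%:R by near: n; exact: nbhs_infty_ger.
  lra.
pose tau n := C * ((t_ n - 1) * Rad) `^ (- (s * p)).
have tau_0 : tau n @[n --> \oo] --> (0 : R).
  rewrite -[X in _ --> X](mulr0 C); apply: cvgM; first exact: cvg_cst.
  exact: (cvg_comp t_ (fun t => ((t - 1) * Rad) `^ (- (s * p))) too (powRN_cvg0 _ _ sp0 Rad0)).
have tauT n : 0 <= tau n <= C * Rad `^ (- (s * p)).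
  rewrite mulr_ge0 ?powR_ge0//= ler_wpM2l// ler_powRN ?(ltW sp0)//.
  by rewrite ler_peMl ?(ltW Rad0)//; have := (tP n).1; have := n0 n; lra.
have [sigma sn H] := minimizing_subseq
  (fun n => v (t_ n)) u tau _ umin au (fun n => av _ (t1 n)) tauT
  (fun n => (HC u _ _ (t1 n) eu (ev _ (t1 n))).2) tau_0.
have/cvge0P := H => /(_ (fun n => energy_ge0 _ _ _ _ _))/(_ _ e0)[n _ /(_ n (leqnn n)) /= Hn].
apply: (tP (sigma n)).2; rewrite (_ : w (t_ (sigma n)) = fun x => v (t_ (sigma n)) x - u x)//.
by apply/funext => x; rewrite /w t1.
Unshelve. all: by end_near. Qed.

End eigenvalue_problem.

Theorem theorem3p1 (R : realType) (N : nat) (hN : (1 <= N)%N)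
    (p : R) (hp : 1 < p) (s : R) (hs0 : 0 < s) (hs1 : s < 1)
    (Omega : set 'rV[R]_N) (Omega_open : open Omega)
    (Omega_bounded : bounded_set Omega) (Omega_neq0 : Omega !=set0)
    (c : 'rV[R]_N) (Rad : R) (hball : smallest_ball Omega c Rad) :
  let lambda_s := first_eigenvalue s p Omega [set: 'rV[R]_N] in
  let lambda_st := fun t : R =>
    first_eigenvalue s p Omega (eball c (t * Rad)) in
  [/\ forall t t' : R, 1 < t -> t <= t' -> lambda_st t <= lambda_st t',
      forall eps : R, 0 < eps -> exists2 delta : R, 0 < delta &
        forall t t' : R, 1 < t -> 1 < t' -> `|t - t'| < delta ->
          `|lambda_st t - lambda_st t'| < eps,
      lambda_st t @[t --> +oo] --> lambda_s &
      forall (u_s : 'rV[R]_N -> R) (u_st : R -> 'rV[R]_N -> R),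
        first_eigenfunction s p Omega [set: 'rV[R]_N] u_s ->
        (forall t : R, 1 < t ->
          first_eigenfunction s p Omega (eball c (t * Rad)) (u_st t)) ->
        gagliardo s p [set: 'rV[R]_N] (fun x => u_st t x - u_s x)
          @[t --> +oo] --> 0%E].

Proof.
move=> lambda_s lambda_st.
have mono t t' := @eigenvalue_mono R N hN p hp s hs0 Omega Omega_open Omega_neq0 c Rad hball t t'.
split.
- exact: mono.
- have [C C0 HC] := @eigenvalue_tail R N hN p hp s hs0 Omega Omega_open Omega_neq0 c Rad hball.
  apply: (@monotone_bounded_unif R lambda_st 1 lambda_s).
  + exact: mono.
  + move=> t t1; have /andP[H _] := HC t t1; rewrite H andbT.
    apply: fine_ge0; apply: le_ereal_inf_tmp => _ [u _ <-]; exact: poweR_ge0.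
  + move=> t e; exact: (@eigenvalue_loc R N hN p hp s hs0 Omega Omega_open Omega_neq0 c Rad hball).
- exact: (@eigenvalue_cvg R N hN p hp s hs0 Omega Omega_open Omega_neq0 c Rad hball).
- move=> u_s u_st eu ev.
  exact: (@eigenfunction_cvg R N hN p hp s hs0 hs1 Omega Omega_open Omega_neq0 c Rad hball u_s u_st eu ev).
Qed.
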